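(* Let $n\ge0$, $0\le k\le n$ and $\mathcal{S}\subset[1,n]$. The dg algebra $\mathcal{B}_r(n,k,\mathcal{S})$ is formal if and only if one of the following conditions holds: (a) $\mathcal{S}=\varnothing$, $\mathcal{S}=\{1\}$, $k=0$, or $k=n$; (b) $k=n-1$ and $1\in\mathcal{S}$.
   Context: Notation: $[a,b]=\{a,\ldots,b\}$. $V(n,k)$ is the set of $k$-element subsets of $[0,n]$. For $\mathbf{x},\mathbf{y}\in V(n,k)$, $1\le i\le n$: $v_i(\mathbf{x},\mathbf{y})=|\mathbf{y}\cap[i,n]|-|\mathbf{x}\cap[i,n]|$, $|v|_i=|v_i|$. $\mathcal{B}_0(n,k)$ is the free $\mathbb{F}_2[U_1,\ldots,U_n]$-module on $\{f_{\mathbf{x},\mathbf{y}}\}_{\mathbf{x},\mathbf{y}\in V(n,k)}$ with $\mathbb{F}_2[U_1,\ldots,U_n]$-bilinear product $f_{\mathbf{x},\mathbf{y}}f_{\mathbf{y},\mathbf{z}}=\prod_{i}U_i^{(|v|_i(\mathbf{y},\mathbf{z})-|v|_i(\mathbf{x},\mathbf{z})+|v|_i(\mathbf{x},\mathbf{y}))/2}f_{\mathbf{x},\mathbf{z}}$ and $f_{\mathbf{x},\mathbf{y}}f_{\mathbf{y}',\mathbf{z}}=0$ for $\mathbf{y}\neq\mathbf{y}'$; $\mathbf{I}_{\mathbf{x}}=f_{\mathbf{x},\mathbf{x}}$. Put $R_i=\sum f_{\mathbf{x},(\mathbf{x}\setminus\{i-1\})\cup\{i\}}$ (over $\mathbf{x}$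 with $\mathbf{x}\cap\{i-1,i\}=\{i-1\}$), $L_i=\sum f_{\mathbf{x},(\mathbf{x}\setminus\{i\})\cup\{i-1\}}$ (over $\mathbf{x}$ with $\mathbf{x}\cap\{i-1,i\}=\{i\}$), $U_i=\sum_{\mathbf{x}}U_if_{\mathbf{x},\mathbf{x}}$. $\mathcal{B}(n,k)$ is the quotient of $\mathcal{B}_0(n,k)$ by the two-sided ideal generated by $R_iR_{i+1}$ and $L_{i+1}L_i$ ($1\le i\le n-1$) and $\mathbf{I}_{\mathbf{x}}U_i$ for $1\le i\le n$, $\mathbf{x}\cap\{i-1,i\}=\varnothing$. $\mathcal{B}(n,k,\mathcal{S})=\mathcal{B}(n,k)[C_i\mid i\in\mathcal{S}]/(C_i^2=0)$ (the $C_i$ central), with $\mathbb{F}_2$-linear differential satisfying the Leibniz rule, zero on $\mathcal{B}(n,k)$, and $\partial(C_i)=U_i$. Truncation: $\mathcal{B}_r(n,k,\mathcal{S})=e\,\mathcal{B}(n,k,\mathcal{S})\,e$ with $e=\sum_{\mathbf{x}\in V_r(n,k)}\mathbf{I}_{\mathbf{x}}$, where $V_r(n,k)=\{\mathbf{x}\in V(n,k): 0\notin\mathbf{x}\}$; differential and gradings are restricted. Gradings: for $a=C_{i_1}\cdots C_{i_l}U_1^{r_1}\cdots U_n^{r_n}f_{\mathbf{x},\mathbf{y}}$ ($i_1,\dots,i_l\in\mathcal{S}$ distinct), the (refined) Alexander multi-degree $w(a)\in(\tfrac12\mathbb{Z})^n$ has components $w_i(a)=r_i+\tfrac12|v|_i(\mathbf{x},\mathbf{y})+\#\{j:i_j=i\}$,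 and the Maslov (homological) degree is $\mathfrak{m}(a)=l-2\sum_{i\in\mathcal{S}}w_i(a)\in\mathbb{Z}$. The differential preserves $w$ and lowers $\mathfrak{m}$ by $1$. Formality: the algebra is regarded as a dg algebra over the idempotent ring $\mathbb{F}_2^{V_r(n,k)}$ with homological grading $\mathfrak{m}$ and additional intrinsic grading $w$. A dg algebra $\mathcal{A}$ is formal if it is $\mathcal{A}_\infty$ homotopy equivalent (over the idempotent ring, respecting the homological and intrinsic gradings) to $H_*(\mathcal{A})$ equipped with its induced multiplication and all other $\mathcal{A}_\infty$ operations ($\mu_1$ and $\mu_m$, $m\ge3$) equal to zero; here $\mu_m$ shifts homological degree by $m-2$ and preserves intrinsic degree. *)

(* Defs.v *)
From HB Require Import structures.
From mathcomp Require Import all_boot all_order all_algebra.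
From mathcomp Require Import boolp mpoly.
From mathcomp Require Import zify ring lra.

Set Implicit Arguments.
Unset Strict Implicit.
Unset Printing Implicit Defensive.

Import GRing.Theory.
Local Open Scope ring_scope.

(* ring_quotient only builds quotient rings of commutative rings. *)
HB.mixin Record isTwoSided (R : pzRingType) (I : R -> bool) := {
  ideal_lmul : forall a u, u \in I -> a * u \in I;
  ideal_rmul : forall a u, u \in I -> u * a \in I
}.

#[short(type="twoSidedIdeal")]
HB.structure Definition TwoSidedIdeal (R : pzRingType) :=
  {I of GRing.ZmodClosed R I & isTwoSided R I}.

Section RingQuotient.
Local Open Scope quotient_scope.
Variables (R : pzRingType) (I : twoSidedIdeal R).

Definition rquot : Type := Quotient.quot I.
HB.instance Definition _ := EqQuotient.on rquot.
HB.instance Definition _ := GRing.Zmodule.on rquot.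

Definition rquot_pi (a : R) : rquot := \pi_(Quotient.quot I) a.

Lemma rquot_piP (q : rquot) : exists a, q = rquot_pi a.
Proof. by exists (repr q); rewrite /rquot_pi reprK. Qed.

Lemma rquot_pi_eq a b : rquot_pi a = rquot_pi b <-> a - b \in I.
Proof.
by rewrite Quotient.idealrBE; split=> [h|/eqP //]; apply/eqP.
Qed.

Definition rquot_one : rquot := rquot_pi 1.
Definition rquot_mul (p q : rquot) : rquot := rquot_pi (repr p * repr q).

Lemma rquot_piB : {morph rquot_pi : a b / a - b}.
Proof.
by move=> a b; apply: (raddfB (\pi_(Quotient.quot I))).
Qed.

HB.instance Definition _ := GRing.isZmodMorphism.Build R rquot rquot_pi
  rquot_piB.

Lemma rquot_mul_pi a b : rquot_mul (rquot_pi a) (rquot_pi b) = rquot_pi (a * b).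
Proof.
rewrite /rquot_mul; apply/rquot_pi_eq.
have ha : repr (rquot_pi a) - a \in I by apply/rquot_pi_eq; rewrite /rquot_pi reprK.
have hb : repr (rquot_pi b) - b \in I by apply/rquot_pi_eq; rewrite /rquot_pi reprK.
rewrite -[X in X - _](addrNK (repr (rquot_pi a) * b)) -mulrBr -addrA -mulrBl.
by rewrite rpredD //; [apply: ideal_lmul | apply: ideal_rmul].
Qed.

Fact rquot_mulA : associative rquot_mul.
Proof.
move=> p q r; have [a ->] := rquot_piP p; have [b ->] := rquot_piP q.
by have [c ->] := rquot_piP r; rewrite !rquot_mul_pi mulrA.
Qed.
Fact rquot_mul1 : left_id rquot_one rquot_mul.
Proof. by move=> p; have [a ->] := rquot_piP p; rewrite rquot_mul_pi mul1r. Qed.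
Fact rquot_mulr1 : right_id rquot_one rquot_mul.
Proof. by move=> p; have [a ->] := rquot_piP p; rewrite rquot_mul_pi mulr1. Qed.
Fact rquot_mulDl : left_distributive rquot_mul +%R.
Proof.
move=> p q r; have [a ->] := rquot_piP p; have [b ->] := rquot_piP q.
by have [c ->] := rquot_piP r; rewrite -raddfD !rquot_mul_pi mulrDl raddfD.
Qed.
Fact rquot_mulDr : right_distributive rquot_mul +%R.
Proof.
move=> p q r; have [a ->] := rquot_piP p; have [b ->] := rquot_piP q.
by have [c ->] := rquot_piP r; rewrite -raddfD !rquot_mul_pi mulrDr raddfD.
Qed.

HB.instance Definition _ := GRing.Zmodule_isPzRing.Build rquot
  rquot_mulA rquot_mul1 rquot_mulr1 rquot_mulDl rquot_mulDr.

Lemma rquot_pi_monoid : monoid_morphism rquot_pi.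
Proof. by split=> // a b; rewrite -rquot_mul_pi. Qed.

HB.instance Definition _ := GRing.isMonoidMorphism.Build R rquot rquot_pi
  rquot_pi_monoid.

End RingQuotient.

Section GeneratedIdeal.
Variables (R : pzRingType) (G : R -> Prop).

Inductive ideal_gen : R -> Prop :=
| ideal_gen_in g : G g -> ideal_gen g
| ideal_gen0 : ideal_gen 0
| ideal_genB u v : ideal_gen u -> ideal_gen v -> ideal_gen (u - v)
| ideal_genMl a u : ideal_gen u -> ideal_gen (a * u)
| ideal_genMr a u : ideal_gen u -> ideal_gen (u * a).

Definition ideal_span : R -> bool := fun u => `[< ideal_gen u >].

Fact ideal_span_zmod : zmod_closed ideal_span.
Proof.
split=> [|u v /asboolP hu /asboolP hv]; apply/asboolP.
  exact: ideal_gen0.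
exact: ideal_genB.
Qed.
Fact ideal_span_l a u : u \in ideal_span -> a * u \in ideal_span.
Proof. by move=> /asboolP hu; apply/asboolP/ideal_genMl. Qed.
Fact ideal_span_r a u : u \in ideal_span -> u * a \in ideal_span.
Proof. by move=> /asboolP hu; apply/asboolP/ideal_genMr. Qed.

HB.instance Definition _ := GRing.isZmodClosed.Build R ideal_span
  ideal_span_zmod.
HB.instance Definition _ := isTwoSided.Build R ideal_span
  ideal_span_l ideal_span_r.
Definition generated_ideal : twoSidedIdeal R :=
  TwoSidedIdeal.clone R ideal_span _.
End GeneratedIdeal.

(* A dg algebra over the idempotent ring F_2^X, with homological degrees in
   int and intrinsic degrees in W; dga_homog m w is the subgroup of elements
   homogeneous of bidegree (m, w); that the algebra is the direct sum of
   these subgroups is not recorded.  Over F_2, linear means additive.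
   The ring F_2^X acts through the orthogonal idempotents dga_idem x. *)
Record dga (X : finType) (W : zmodType) := Dga {
  dga_car :> pzRingType;
  dga_idem : X -> dga_car;
  dga_diff : {additive dga_car -> dga_car};
  dga_homog : int -> W -> dga_car -> Prop;
  dga_char2 : 1 + 1 = 0 :> dga_car;
  dga_idemM : forall x y,
    dga_idem x * dga_idem y = if x == y then dga_idem x else 0;
  dga_idem_sum : \sum_x dga_idem x = 1;
  dga_diff_idem : forall x, dga_diff (dga_idem x) = 0;
  dga_diffM : forall a b, dga_diff (a * b) = dga_diff a * b + a * dga_diff b;
  dga_diffK : forall a, dga_diff (dga_diff a) = 0;
  dga_homog0 : forall m w, dga_homog m w 0;
  dga_homogB : forall m w a b,
    dga_homog m w a -> dga_homog m w b -> dga_homog m w (a - b);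
  dga_homog_idem : forall x, dga_homog 0 0 (dga_idem x);
  dga_homogM : forall m w m' w' a b, dga_homog m w a -> dga_homog m' w' b ->
    dga_homog (m + m') (w + w') (a * b);
  dga_homog_diff : forall m w a, dga_homog m w a ->
    dga_homog (m - 1) w (dga_diff a)
}.

Lemma dga_addrr X W (A : dga X W) (a : A) : a + a = 0.
Proof. by rewrite -[a]mul1r -mulrDl dga_char2 mul0r. Qed.

Lemma dga_oppr X W (A : dga X W) (a : A) : - a = a.
Proof. by apply/eqP; rewrite eq_sym -addr_eq0 dga_addrr. Qed.

Section Homology.
Variables (X : finType) (W : zmodType) (A : dga X W).

Definition cycle_pred : A -> bool := fun a => dga_diff A a == 0.

Fact cycle_subring : subring_closed cycle_pred.
Proof.
split=> [|a b|a b]; rewrite !unfold_in /cycle_pred.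
- by rewrite -(dga_idem_sum A) raddf_sum big1 // => x _; rewrite dga_diff_idem.
- by move=> /eqP ha /eqP hb; rewrite raddfB ha hb subrr.
- by move=> /eqP ha /eqP hb; rewrite dga_diffM ha hb mul0r mulr0 addr0.
Qed.
HB.instance Definition _ := GRing.isSubringClosed.Build A cycle_pred
  cycle_subring.

Record cycle := Cycle { cycle_val : A; _ : cycle_pred cycle_val }.
HB.instance Definition _ := [isSub for cycle_val].
HB.instance Definition _ := [Choice of cycle by <:].
HB.instance Definition _ := GRing.SubChoice_isSubPzRing.Build A cycle_pred cycle
  cycle_subring.

Lemma cycleP (z : cycle) : dga_diff A (val z) = 0.
Proof. exact/eqP/(valP z). Qed.

Definition boundary : cycle -> bool :=
  fun z => `[< exists a, val z = dga_diff A a >].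

Fact boundary_zmod : zmod_closed boundary.
Proof.
split=> [|u v /asboolP[a ha] /asboolP[b hb]]; apply/asboolP.
  by exists 0; rewrite !raddf0.
by exists (a - b); rewrite !raddfB /= ha hb.
Qed.
Fact boundary_l (z u : cycle) : u \in boundary -> z * u \in boundary.
Proof.
move=> /asboolP[a ha]; apply/asboolP; exists (val z * a).
by rewrite rmorphM dga_diffM /= ha (cycleP z) mul0r add0r.
Qed.
Fact boundary_r (z u : cycle) : u \in boundary -> u * z \in boundary.
Proof.
move=> /asboolP[a ha]; apply/asboolP; exists (a * val z).
by rewrite rmorphM dga_diffM /= ha (cycleP z) mulr0 addr0.
Qed.
HB.instance Definition _ := GRing.isZmodClosed.Build cycle boundary
  boundary_zmod.
HB.instance Definition _ := isTwoSided.Build cycle boundary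
  boundary_l boundary_r.
Definition boundary_ideal : twoSidedIdeal cycle :=
  TwoSidedIdeal.clone cycle boundary _.

Definition homology_ring : pzRingType := rquot boundary_ideal.

Fact cycle_idem_subproof x : cycle_pred (dga_idem A x).
Proof. by rewrite /cycle_pred dga_diff_idem. Qed.

Definition homology_idem (x : X) : homology_ring :=
  rquot_pi boundary_ideal (Cycle (cycle_idem_subproof x)).

Definition homology_homog (m : int) (w : W) (q : homology_ring) : Prop :=
  exists2 z : cycle, dga_homog m w (val z) & q = rquot_pi boundary_ideal z.

Fact homology_char2 : 1 + 1 = 0 :> homology_ring.
Proof.
rewrite -(rmorph1 (rquot_pi boundary_ideal)) -rmorphD -[RHS](rmorph0 (rquot_pi boundary_ideal)).
by congr rquot_pi; apply: val_inj; rewrite rmorphD !rmorph1 dga_char2 rmorph0.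
Qed.
Fact homology_idemM x y :
  homology_idem x * homology_idem y = if x == y then homology_idem x else 0.
Proof.
rewrite /homology_idem -rmorphM.
have -> : Cycle (cycle_idem_subproof x) * Cycle (cycle_idem_subproof y) =
  if x == y then Cycle (cycle_idem_subproof x) else 0.
  by apply: val_inj; rewrite rmorphM /= dga_idemM; case: eqP => // _; rewrite rmorph0.
by case: eqP => // _; rewrite rmorph0.
Qed.
Fact homology_idem_sum : \sum_x homology_idem x = 1.
Proof.
rewrite /homology_idem -raddf_sum -(rmorph1 (rquot_pi boundary_ideal)).
by congr rquot_pi; apply: val_inj; rewrite raddf_sum rmorph1 -(dga_idem_sum A).
Qed.
Fact homology_diffM (a b : homology_ring) :
  \0 (a * b) = \0 a * b + a * \0 b :> homology_ring.
Proof. by rewrite /= mul0r mulr0 addr0. Qed.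
Fact homology_homog0 m w : homology_homog m w 0.
Proof. by exists 0; rewrite ?raddf0 //; apply: dga_homog0. Qed.
Fact homology_homogB m w a b :
  homology_homog m w a -> homology_homog m w b -> homology_homog m w (a - b).
Proof.
move=> [z hz ->] [t ht ->]; exists (z - t); last by rewrite raddfB.
by rewrite raddfB; apply: dga_homogB.
Qed.
Fact homology_homog_idem x : homology_homog 0 0 (homology_idem x).
Proof. by exists (Cycle (cycle_idem_subproof x)); first exact: dga_homog_idem. Qed.
Fact homology_homogM m w m' w' a b :
  homology_homog m w a -> homology_homog m' w' b ->
  homology_homog (m + m') (w + w') (a * b).
Proof.
move=> [z hz ->] [t ht ->]; exists (z * t); last by rewrite rmorphM.
by rewrite rmorphM; apply: dga_homogM.
Qed.
Fact homology_homog_diff m w (a : homology_ring) :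
  homology_homog m w a -> homology_homog (m - 1) w (\0 a).
Proof. by move=> _; apply: homology_homog0. Qed.

Definition homology : dga X W :=
  @Dga X W homology_ring homology_idem \0 homology_homog
    homology_char2 homology_idemM homology_idem_sum (fun=> erefl)
    homology_diffM (fun=> erefl) homology_homog0 homology_homogB
    homology_homog_idem homology_homogM homology_homog_diff.

End Homology.

Section Corner.
Variables (X : finType) (W : zmodType) (A : dga X W) (P : pred X).

Definition corner_unit : A := \sum_(x | P x) dga_idem A x.
Local Notation e := corner_unit.

Lemma corner_unitM : e * e = e.
Proof.
rewrite {3}/corner_unit mulr_suml; apply: eq_bigr => x Px.
rewrite mulr_sumr (bigD1 x) //= dga_idemM eqxx big1 ?addr0 // => y /andP[_ nyx].
by rewrite dga_idemM eq_sym (negPf nyx).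
Qed.

Definition corner_pred : A -> bool := fun a => e * a * e == a.

Fact corner_zmod : zmod_closed corner_pred.
Proof.
split=> [|a b]; rewrite !unfold_in /corner_pred ?mulr0 ?mul0r //.
by move=> /eqP ha /eqP hb; rewrite mulrBr mulrBl ha hb.
Qed.
HB.instance Definition _ := GRing.isZmodClosed.Build A corner_pred corner_zmod.

Record corner_car := Corner { corner_val : A; _ : corner_pred corner_val }.
HB.instance Definition _ := [isSub for corner_val].
HB.instance Definition _ := [Choice of corner_car by <:].
HB.instance Definition _ := [SubChoice_isSubZmodule of corner_car by <:].

Fact corner_val_zmod : zmod_morphism corner_val.
Proof. by move=> a b; apply: (raddfB (val : corner_car -> A)). Qed.
HB.instance Definition _ := GRing.isZmodMorphism.Build corner_car A corner_val
  corner_val_zmod.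

Lemma corner_lunit (a : corner_car) : e * val a = val a.
Proof. by have /eqP <- := valP a; rewrite !mulrA corner_unitM. Qed.
Lemma corner_runit (a : corner_car) : val a * e = val a.
Proof. by have /eqP <- := valP a; rewrite -!mulrA corner_unitM. Qed.

Fact corner_one_subproof : corner_pred e.
Proof. by rewrite /corner_pred !corner_unitM. Qed.
Fact corner_mul_subproof (a b : corner_car) : corner_pred (val a * val b).
Proof.
by rewrite /corner_pred mulrA corner_lunit -mulrA corner_runit.
Qed.

Definition corner_one := Corner corner_one_subproof.
Definition corner_mul a b := Corner (corner_mul_subproof a b).

Fact corner_mulA : associative corner_mul.
Proof. by move=> a b c; apply: val_inj; rewrite /= mulrA. Qed.
Fact corner_mul1 : left_id corner_one corner_mul.
Proof. by move=> a; apply: val_inj; apply: corner_lunit. Qed.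
Fact corner_mulr1 : right_id corner_one corner_mul.
Proof. by move=> a; apply: val_inj; apply: corner_runit. Qed.
Fact corner_mulDl : left_distributive corner_mul +%R.
Proof. by move=> a b c; apply: val_inj; rewrite /= mulrDl. Qed.
Fact corner_mulDr : right_distributive corner_mul +%R.
Proof. by move=> a b c; apply: val_inj; rewrite /= mulrDr. Qed.

HB.instance Definition _ := GRing.Zmodule_isPzRing.Build corner_car
  corner_mulA corner_mul1 corner_mulr1 corner_mulDl corner_mulDr.

Lemma dga_diff_unit : dga_diff A e = 0.
Proof. by rewrite raddf_sum big1 // => x _; rewrite dga_diff_idem. Qed.

Fact corner_idem_subproof (x : {x | P x}) : corner_pred (dga_idem A (val x)).
Proof.
rewrite /corner_pred mulr_suml mulr_suml (bigD1 (val x)) ?(valP x) //=.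
rewrite dga_idemM eqxx [X in _ + X]big1 => [|y /andP[_ nyx]]; last first.
  by rewrite dga_idemM (negPf nyx) mul0r.
rewrite addr0 mulr_sumr (bigD1 (val x)) ?(valP x) //=.
rewrite dga_idemM eqxx big1 ?addr0 // => y /andP[_ nyx].
by rewrite dga_idemM eq_sym (negPf nyx).
Qed.
Definition corner_idem x := Corner (corner_idem_subproof x).

Fact corner_diff_subproof (a : corner_car) : corner_pred (dga_diff A (val a)).
Proof.
rewrite /corner_pred -{2}(corner_lunit a) -{2}(corner_runit a) !dga_diffM.
by rewrite dga_diff_unit mul0r mulr0 addr0 add0r mulrA.
Qed.
Definition corner_diff a := Corner (corner_diff_subproof a).
Fact corner_diffB : zmod_morphism corner_diff.
Proof. by move=> a b; apply: val_inj; rewrite /= !raddfB. Qed.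
HB.instance Definition _ := GRing.isZmodMorphism.Build corner_car corner_car
  corner_diff corner_diffB.

Definition corner_homog (m : int) (w : W) (a : corner_car) : Prop :=
  dga_homog m w (val a).

Fact corner_char2 : 1 + 1 = 0 :> corner_car.
Proof. by apply: val_inj; rewrite /= dga_addrr. Qed.
Fact corner_idemM x y :
  corner_idem x * corner_idem y = if x == y then corner_idem x else 0.
Proof.
apply: val_inj; rewrite /= dga_idemM (inj_eq val_inj).
by case: eqP => // _; rewrite raddf0.
Qed.
Fact corner_idem_sum : \sum_x corner_idem x = 1.
Proof.
apply: val_inj; rewrite raddf_sum /= /corner_unit.
rewrite (reindex_omap (val : {x | P x} -> X) insub) => [|x Px]; last first.
  by rewrite insubT.
by apply: eq_bigl => x; rewrite valK eqxx (valP x).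
Qed.
Fact corner_diff_idem x : corner_diff (corner_idem x) = 0.
Proof. by apply: val_inj; rewrite /= dga_diff_idem. Qed.
Fact corner_diffM a b :
  corner_diff (a * b) = corner_diff a * b + a * corner_diff b.
Proof. by apply: val_inj; rewrite raddfD /= dga_diffM. Qed.
Fact corner_diffK a : corner_diff (corner_diff a) = 0.
Proof. by apply: val_inj; rewrite /= dga_diffK. Qed.
Fact corner_homog0 m w : corner_homog m w 0.
Proof. exact: dga_homog0. Qed.
Fact corner_homogB m w a b :
  corner_homog m w a -> corner_homog m w b -> corner_homog m w (a - b).
Proof. by rewrite /corner_homog raddfB; apply: dga_homogB. Qed.
Fact corner_homog_idem x : corner_homog 0 0 (corner_idem x).
Proof. exact: dga_homog_idem. Qed.
Fact corner_homogM m w m' w' a b :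
  corner_homog m w a -> corner_homog m' w' b ->
  corner_homog (m + m') (w + w') (a * b).
Proof. exact: dga_homogM. Qed.
Fact corner_homog_diff m w a :
  corner_homog m w a -> corner_homog (m - 1) w (corner_diff a).
Proof. exact: dga_homog_diff. Qed.

(* e A e, where e is the sum of the idempotents indexed by P *)
Definition corner : dga {x | P x} W :=
  @Dga {x | P x} W corner_car corner_idem corner_diff corner_homog
    corner_char2 corner_idemM corner_idem_sum corner_diff_idem
    corner_diffM corner_diffK corner_homog0 corner_homogB
    corner_homog_idem corner_homogM corner_homog_diff.

End Corner.

(* A graded bimodule over the idempotent ring F_2^X; the basis idempotent x
   acts on the left by gb_l x and on the right by gb_r x. *)
Record gbimod (X : finType) (W : zmodType) := GBimod {
  gb_car :> zmodType;
  gb_l : X -> gb_car -> gb_car;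
  gb_r : X -> gb_car -> gb_car;
  gb_homog : int -> W -> gb_car -> Prop;
  gb_char2 : forall a : gb_car, a + a = 0;
  gb_lB : forall x a b, gb_l x (a - b) = gb_l x a - gb_l x b;
  gb_rB : forall x a b, gb_r x (a - b) = gb_r x a - gb_r x b;
  gb_ll : forall x y a, gb_l x (gb_l y a) = if x == y then gb_l x a else 0;
  gb_rr : forall x y a, gb_r x (gb_r y a) = if x == y then gb_r x a else 0;
  gb_lr : forall x y a, gb_l x (gb_r y a) = gb_r y (gb_l x a);
  gb_sum_l : forall a, \sum_x gb_l x a = a;
  gb_sum_r : forall a, \sum_x gb_r x a = a;
  gb_homog0 : forall m w, gb_homog m w 0;
  gb_homogB : forall m w a b,
    gb_homog m w a -> gb_homog m w b -> gb_homog m w (a - b);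
  gb_homog_l : forall m w x a, gb_homog m w a -> gb_homog m w (gb_l x a);
  gb_homog_r : forall m w x a, gb_homog m w a -> gb_homog m w (gb_r x a)
}.

(* A family f = (f_m)_{m >= 1} of maps M^{(x) m} -> N, the tensor powers being
   taken over F_2^X, such that f_m shifts the homological degree by m + c and
   preserves the intrinsic degree: f s stands for f_(size s) (s_0 (x) s_1 ...),
   and the empty sequence, which is not an input, is sent to 0. *)
Record multimap (X : finType) (W : zmodType) (M N : gbimod X W) (c : int)
    (f : seq M -> N) : Prop := MultiMap {
  mm_nil : f [::] = 0;
  mm_add : forall s a b t,
    f (s ++ (a + b) :: t) = f (s ++ a :: t) + f (s ++ b :: t);
  mm_bal : forall s a x b t,
    f (s ++ gb_r x a :: b :: t) = f (s ++ a :: gb_l x b :: t);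
  mm_l : forall x a s, f (gb_l x a :: s) = gb_l x (f (a :: s));
  mm_r : forall x s a, f (rcons s (gb_r x a)) = gb_r x (f (rcons s a));
  mm_homog : forall u : seq (int * W * M), u != [::] ->
    (forall t, t \in u -> gb_homog t.1.1 t.1.2 t.2) ->
    gb_homog (\sum_(t <- u) t.1.1 + (size u)%:Z + c) (\sum_(t <- u) t.1.2)
      (f [seq t.2 | t <- u])
}.

Lemma mm_0 X W (M N : gbimod X W) c (f : seq M -> N) s t :
  multimap c f -> f (s ++ 0 :: t) = 0.
Proof.
by move=> hf; apply: (addrI (f (s ++ 0 :: t))); rewrite -(mm_add hf) !addr0.
Qed.

(* sum over the ways of applying mu to a nonempty block of consecutive
   entries of s, and then f to the result *)
Definition insertions (M N : zmodType) (f : seq M -> N) (mu : seq M -> M)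
    (s : seq M) : N :=
  \sum_(j < (size s).+1) \sum_(i < j)
    f (take i s ++ mu (drop i (take j s)) :: drop j s).

(* An A_infinity algebra over F_2^X: ainf_mu s stands for mu_(size s). *)
Record ainf (X : finType) (W : zmodType) := Ainf {
  ainf_mod :> gbimod X W;
  ainf_mu : seq ainf_mod -> ainf_mod;
  ainf_mu_multimap : multimap (- 2) ainf_mu;
  ainf_rel : forall s, insertions ainf_mu ainf_mu s = 0
}.

(* all the ways of cutting s into nonempty blocks of consecutive entries *)
Fixpoint blocks (T : Type) (s : seq T) : seq (seq (seq T)) :=
  if s is a :: s' then
    [seq [:: a] :: bs | bs <- blocks s'] ++
    [seq (a :: head [::] bs) :: behead bs | bs <- blocks s' & ~~ nilp bs]
  else [:: [::]].

Lemma mem_blocks (T : eqType) (s : seq T) bs :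
  (bs \in blocks s) = (flatten bs == s) && ([::] \notin bs).
Proof.
elim: s bs => [|a s IHs] bs /=.
  by rewrite inE; case: bs => [|[|b c] bs] //=; rewrite andbF.
rewrite mem_cat; apply/orP/andP => [[]/mapP[cs]|].
- rewrite IHs => /andP[/eqP <- h] ->; split=> //=.
- rewrite mem_filter IHs; case: cs => [|c cs] //= /andP[/eqP <-].
  by rewrite inE negb_or => /andP[_ h] ->; split=> //=.
case: bs => [|[|b [|c d]] bs] []; rewrite ?inE ?eqseq_cons //=.
  case/andP=> /eqP -> /eqP hs hbs; left; apply/mapP; exists bs => //.
  by rewrite IHs; apply/andP; split=> //; apply/eqP.
case/andP=> /eqP -> /eqP hs hbs; right; apply/mapP; exists ((c :: d) :: bs) => //.
by rewrite mem_filter IHs; apply/and3P; split=> //; apply/eqP.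
Qed.

Lemma blocks_uniq (T : eqType) (s : seq T) : uniq (blocks s).
Proof.
elim: s => //= a s IHs; rewrite cat_uniq; apply/and3P; split.
- by rewrite map_inj_uniq // => x y [].
- apply/hasPn => _ /mapP[bs + ->]; rewrite mem_filter mem_blocks.
  case: bs => [|b bs] //= /andP[_]; rewrite inE negb_or => /andP[nb _].
  by apply/mapP => -[cs _ [hb _]]; rewrite hb eqxx in nb.
rewrite map_inj_in_uniq ?filter_uniq // => x y.
rewrite !mem_filter; case: x => [|x xs] //; case: y => [|y ys] //= _ _.
by case=> -> ->.
Qed.

Section AinfMorphisms.
Variables (X : finType) (W : zmodType).
Implicit Types A B C : ainf X W.

Record ainf_morphism A B (f : seq A -> B) : Prop := AinfMorphism {
  ainf_mor_multimap : multimap (- 1) f;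
  ainf_mor_rel : forall s,
    insertions f (ainf_mu (a := A)) s =
    \sum_(bs <- blocks s) ainf_mu [seq f b | b <- bs]
}.

Definition ainf_id A (s : seq A) : A := if s is [:: a] then a else 0.

Definition ainf_comp A B C (g : seq B -> C) (f : seq A -> B) (s : seq A) : C :=
  \sum_(bs <- blocks s) g [seq f b | b <- bs].

Record ainf_homotopy A B (f g : seq A -> B) (h : seq A -> B) : Prop :=
  AinfHomotopy {
  ainf_htp_multimap : multimap 0 h;
  ainf_htp_rel : forall s,
    f s + g s = insertions h (ainf_mu (a := A)) s +
      \sum_(j < (size s).+1) \sum_(i < j)
      \sum_(bs <- blocks (take i s)) \sum_(cs <- blocks (drop j s))
        ainf_mu ([seq f b | b <- bs] ++
                 h (drop i (take j s)) :: [seq g c | c <- cs])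
}.

Definition ainf_homotopic A B (f g : seq A -> B) : Prop :=
  exists h, ainf_homotopy f g h.

Definition ainf_homotopy_equivalent A B : Prop :=
  exists (f : seq A -> B) (g : seq B -> A),
    [/\ ainf_morphism f, ainf_morphism g,
        ainf_homotopic (ainf_comp g f) (@ainf_id A) &
        ainf_homotopic (ainf_comp f g) (@ainf_id B)].

End AinfMorphisms.

Section DgaAsAinf.
Variables (X : finType) (W : zmodType) (A : dga X W).

Fact dga_gbimod_ll x y (a : A) : dga_idem A x * (dga_idem A y * a) =
  if x == y then dga_idem A x * a else 0.
Proof. by rewrite mulrA dga_idemM; case: eqP => // _; rewrite mul0r. Qed.
Fact dga_gbimod_rr x y (a : A) : a * dga_idem A y * dga_idem A x =
  if x == y then a * dga_idem A x else 0.
Proof.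
by rewrite -mulrA dga_idemM eq_sym; case: eqP => [->|_] //; rewrite mulr0.
Qed.
Fact dga_gbimod_suml (a : A) : \sum_x dga_idem A x * a = a.
Proof. by rewrite -mulr_suml dga_idem_sum mul1r. Qed.
Fact dga_gbimod_sumr (a : A) : \sum_x a * dga_idem A x = a.
Proof. by rewrite -mulr_sumr dga_idem_sum mulr1. Qed.
Fact dga_gbimod_homog_l m w x (a : A) :
  dga_homog m w a -> dga_homog m w (dga_idem A x * a).
Proof.
by move=> ha; have := dga_homogM (dga_homog_idem A x) ha; rewrite !add0r.
Qed.
Fact dga_gbimod_homog_r m w x (a : A) :
  dga_homog m w a -> dga_homog m w (a * dga_idem A x).
Proof.
by move=> ha; have := dga_homogM ha (dga_homog_idem A x); rewrite !addr0.
Qed.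

Definition dga_gbimod : gbimod X W :=
  @GBimod X W A (fun x a => dga_idem A x * a) (fun x a => a * dga_idem A x)
    (@dga_homog X W A) (@dga_addrr X W A)
    (fun x a b => mulrBr _ a b) (fun x a b => mulrBl _ a b)
    dga_gbimod_ll dga_gbimod_rr (fun x y a => mulrA _ a _)
    dga_gbimod_suml dga_gbimod_sumr
    (@dga_homog0 X W A) (@dga_homogB X W A)
    dga_gbimod_homog_l dga_gbimod_homog_r.

Definition dga_mu (s : seq dga_gbimod) : dga_gbimod :=
  match s with
  | [:: a] => dga_diff A a
  | [:: a; b] => (a : A) * b
  | _ => 0
  end.

Lemma dga_mu_ge3 s : (2 < size s)%N -> dga_mu s = 0.
Proof. by case: s => [|a [|b [|c s]]]. Qed.

Fact dga_mu_multimap : multimap (- 2) dga_mu.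
Proof.
split=> //.
- move=> [|c [|d s]] a b [|e [|e' t]] //=; rewrite ?addr0 //.
  + by rewrite raddfD.
  + by rewrite mulrDl.
  + by rewrite mulrDr.
  1-3: by case: s => [|? s]; rewrite /= addr0.
- move=> [|c s] a x b [|d t] //=; first by rewrite mulrA.
  1-2: by case: s => [|? [|? s]].
- move=> x a [|b [|c s]] //=; rewrite ?mulr0 //.
    by rewrite dga_diffM dga_diff_idem mul0r add0r.
  by rewrite mulrA.
- move=> x [|b [|c s]] a //=; rewrite ?mul0r //.
  + by rewrite dga_diffM dga_diff_idem mulr0 addr0.
  + by rewrite mulrA.
  + by case: s => [|d s] /=; rewrite mul0r.
case=> [|[[m w] a] [|[[m' w'] b] [|c u]]] // _ hu; rewrite !unlock /=.
- have /= ha := hu _ (mem_head _ _); rewrite !addr0 addrAC.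
  by rewrite -addrA; apply: dga_homog_diff.
- have /= ha := hu _ (mem_head _ _).
  have /= hb := hu (m', w', b); rewrite !addr0 -[_ + _ + _]addrA.
  have -> : 2%:Z + - 2 = 0 by []. 
  rewrite addr0; apply: dga_homogM => //; apply: hb.
  by rewrite !inE eqxx orbT.
exact: dga_homog0.
Qed.

Fact dga_mu_rel s : insertions dga_mu dga_mu s = 0.
Proof.
have ar (i j p : nat) :
  (3 < p -> j <= p -> j - i <= 2 -> i < j -> 2 < i + (p - j).+1)%N by lia.
rewrite /insertions; case: (ltnP 3 (size s)) => hs.
  apply: big1 => j _; apply: big1 => i _.
  have hj := ltn_ord j; have hi := ltn_ord i.
  case: (ltnP 2 (j - i)) => hij.
    rewrite [dga_mu (drop _ _)]dga_mu_ge3 ?(mm_0 _ _ dga_mu_multimap) //.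
    by rewrite size_drop size_takel // -ltnS.
  have hjs : (j <= size s)%N by rewrite -ltnS.
  have his : (i <= size s)%N := leq_trans (ltnW hi) hjs.
  rewrite dga_mu_ge3 // size_cat /= size_drop size_takel //.
  exact: ar.
case: s hs => [|a [|b [|c [|d s]]]] //= _;
  rewrite !big_ord_recr !big_ord0 /= ?add0r ?addr0.
- by [].
- by rewrite dga_diffK.
- by rewrite dga_diffM -[X in _ + X]addrA dga_addrr addr0 dga_addrr.
- by rewrite raddf0 add0r mulrA dga_addrr.
Qed.

Definition ainf_of_dga : ainf X W := Ainf dga_mu_multimap dga_mu_rel.

End DgaAsAinf.

Definition formal (X : finType) (W : zmodType) (A : dga X W) : Prop :=
  ainf_homotopy_equivalent (ainf_of_dga A) (ainf_of_dga (homology A)).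

(* R[C_j | j in J] / (C_j^2 = 0) with central C_j.  The coefficient of a at
   T : {set J} is the coefficient of the monomial \prod_(j in T) C_j. *)
Definition cext (R : pzRingType) (J : finType) : Type := {ffun {set J} -> R}.

Section CExtension.
Variables (R : pzRingType) (J : finType).
Implicit Types (a b c : cext R J) (T : {set J}).

HB.instance Definition _ := GRing.Zmodule.copy (cext R J) {ffun {set J} -> R}.

Definition cext_one : cext R J := [ffun T : {set J} => (T == set0)%:R].
Definition cext_mul a b : cext R J :=
  [ffun T : {set J} => \sum_(T1 : {set J} | T1 \subset T) a T1 * b (T :\: T1)].

Lemma cextD a b T : (a + b) T = a T + b T. Proof. exact: ffunE. Qed.

Fact cext_mulA : associative cext_mul.
Proof.
move=> a b c; apply/ffunP => T; rewrite !ffunE.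
under eq_bigr do rewrite ffunE mulr_sumr.
under [RHS]eq_bigr do rewrite ffunE mulr_suml.
rewrite [RHS](exchange_big_dep (fun T2 : {set J} => T2 \subset T)) /=; last first.
  by move=> T1 T2 h1 h2; apply: subset_trans h2 h1.
apply: eq_bigr => T2 hT2.
rewrite [RHS](reindex_onto (fun T3 => T2 :|: T3) (fun T1 => T1 :\: T2)) /=; last first.
  move=> T1 /andP[_ h]; apply/setP => j; rewrite !inE.
  by have := subsetP h j; case: (j \in T2) => // ->.
apply: eq_big => [T3|T3 hT3].
  rewrite subUset hT2 subsetUl andbT /=; apply/idP/andP.
    move=> h; split; first exact: subset_trans h (subsetDl _ _).
    apply/eqP/setP => j; rewrite !inE; have := subsetP h j; rewrite !inE.
    by case: (j \in T3); rewrite ?orbF ?orbT ?andNb //= andbT => /(_ isT)/andP[].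
  case=> h /eqP <-; apply/subsetP => j; rewrite !inE => /andP[-> /=].
  by case/orP; [apply: (subsetP hT2) | apply: (subsetP h)].
rewrite mulrA; congr (_ * _ * _).
  congr (b _); apply/setP => j; have := subsetP hT3 j; rewrite !inE.
  by case: (j \in T3); rewrite ?orbF ?orbT ?andNb //= => /(_ isT)/andP[->].
by rewrite setDDl.
Qed.
Fact cext_mul1 : left_id cext_one cext_mul.
Proof.
move=> a; apply/ffunP => T; rewrite ffunE (bigD1 set0) ?sub0set //=.
rewrite ffunE eqxx mul1r setD0 big1 ?addr0 // => T1 /andP[_ /negPf h].
by rewrite ffunE h mul0r.
Qed.
Fact cext_mulr1 : right_id cext_one cext_mul.
Proof.
move=> a; apply/ffunP => T; rewrite ffunE (bigD1 T) //=.
rewrite ffunE setDv eqxx mulr1 big1 ?addr0 // => T1 /andP[h1 h2].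
rewrite ffunE setD_eq0; case: (boolP (T \subset T1)) => h3; last by rewrite mulr0.
by rewrite eqEsubset h1 h3 in h2.
Qed.
Fact cext_mulDl : left_distributive cext_mul +%R.
Proof.
move=> a b c; apply/ffunP => T; rewrite cextD !ffunE -big_split.
by apply: eq_bigr => T1 _; rewrite cextD mulrDl.
Qed.
Fact cext_mulDr : right_distributive cext_mul +%R.
Proof.
move=> a b c; apply/ffunP => T; rewrite cextD !ffunE -big_split.
by apply: eq_bigr => T1 _; rewrite cextD mulrDr.
Qed.

HB.instance Definition _ := GRing.Zmodule_isPzRing.Build (cext R J)
  cext_mulA cext_mul1 cext_mulr1 cext_mulDl cext_mulDr.

Lemma cextME a b T :
  (a * b) T = \sum_(T1 : {set J} | T1 \subset T) a T1 * b (T :\: T1).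
Proof. exact: ffunE. Qed.

(* (\prod_(j in T) C_j) r *)
Definition cmono T (r : R) : cext R J :=
  [ffun T' : {set J} => if T' == T then r else 0].
Definition cext_C (j : J) : cext R J := cmono [set j] 1.

Fact cmono_zmod T : zmod_morphism (cmono T).
Proof.
move=> r s; apply/ffunP => T'; rewrite !ffunE.
by case: eqP => _; rewrite ?subr0.
Qed.
HB.instance Definition _ T := GRing.isZmodMorphism.Build R (cext R J) (cmono T)
  (cmono_zmod T).

Lemma cmonoM T1 T2 r s : cmono T1 r * cmono T2 s =
  if [disjoint T1 & T2] then cmono (T1 :|: T2) (r * s) else 0.
Proof.
apply/ffunP => T; rewrite cextME.
have -> : (if [disjoint T1 & T2] then cmono (T1 :|: T2) (r * s) else 0) T =
    if [disjoint T1 & T2] && (T == T1 :|: T2) then r * s else 0.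
  by case: ifP => _; rewrite !ffunE.
case: ifP => [/andP[hd /eqP ->]|h].
  rewrite (bigD1 T1) ?subsetUl //= !ffunE eqxx setDUl setDv set0U.
  have -> : T2 :\: T1 = T2 by apply/setDidPl; rewrite disjoint_sym.
  rewrite eqxx big1 ?addr0 // => T' /andP[_ /negPf hT'].
  by rewrite ffunE hT' mul0r.
apply: big1 => T' hT'; rewrite !ffunE; case: eqP => [eT'|]; last by rewrite mul0r.
case: eqP => [eT2|]; last by rewrite mulr0.
case/negP: h; rewrite -eT2 -eT'; apply/andP; split.
  by rewrite disjoints_subset; apply/subsetP => j; rewrite !inE => ->.
apply/eqP/setP => j; rewrite !inE; have := subsetP hT' j.
by case: (j \in T') => // ->.
Qed.

Lemma cmono_sum a : a = \sum_T cmono T (a T).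
Proof.
apply/ffunP => T; rewrite sum_ffunE (bigD1 T) //= ffunE eqxx big1 ?addr0 //.
by move=> T' /negPf h; rewrite ffunE eq_sym h.
Qed.

Lemma cext_C_sqr j : cext_C j * cext_C j = 0.
Proof. by rewrite cmonoM disjoints1 inE eqxx. Qed.

Lemma cext_C_central j a : cext_C j * a = a * cext_C j.
Proof.
rewrite [a]cmono_sum mulr_sumr mulr_suml; apply: eq_bigr => T _.
by rewrite !cmonoM disjoint_sym setUC mul1r mulr1.
Qed.

Variable u : J -> R.

(* the R-linear map satisfying the Leibniz rule, zero on R, with
   cext_diff (C_j) = u j; see cext_diff_C, cext_diff_base and cext_diffM *)

Definition cext_diff a : cext R J :=
  [ffun T : {set J} => \sum_(j | j \notin T) u j * a (j |: T)].

Fact cext_diff_zmod : zmod_morphism cext_diff.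
Proof.
move=> a b; apply/ffunP => T; rewrite !ffunE -sumrB.
by apply: eq_bigr => j _; rewrite !ffunE mulrBr.
Qed.
HB.instance Definition _ := GRing.isZmodMorphism.Build (cext R J) (cext R J)
  cext_diff cext_diff_zmod.

Lemma cext_diff_cmono T r :
  cext_diff (cmono T r) = \sum_(j in T) cmono (T :\ j) (u j * r).
Proof.
apply/ffunP => T'; rewrite sum_ffunE ffunE.
rewrite [LHS]big_mkcond [RHS]big_mkcond; apply: eq_bigr => j _ /=.
rewrite !ffunE; case: (boolP (j \in T)) => hj; last first.
  case: ifP => // _; case: eqP => [h|]; last by rewrite mulr0.
  by rewrite -h setU11 in hj.
have -> : (T' == T :\ j) = (j \notin T') && (j |: T' == T).
  apply/eqP/andP => [->|[h /eqP <-]]; first by rewrite setD11 setD1K.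
  by rewrite setU1K.
by case: (j \in T') => //=; case: eqP => //; rewrite mulr0.
Qed.

Lemma cext_diff_C j : cext_diff (cext_C j) = cmono set0 (u j).
Proof. by rewrite cext_diff_cmono big_set1 setDv mulr1. Qed.

Lemma cext_diff_base r : cext_diff (cmono set0 r) = 0.
Proof. by rewrite cext_diff_cmono big_set0. Qed.

Hypothesis R2 : forall r : R, r + r = 0.
Hypothesis u_central : forall j r, u j * r = r * u j.

Lemma cext_diffM a b :
  cext_diff (a * b) = cext_diff a * b + a * cext_diff b.
Proof.
apply/ffunP => T; rewrite cextD !cextME ffunE.
have -> : \sum_(T1 : {set J} | T1 \subset T) cext_diff a T1 * b (T :\: T1) =
  \sum_(T1 : {set J} | T1 \subset T) \sum_(j | j \notin T)
     u j * a (j |: T1) * b (T :\: T1) +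
  \sum_(T1 : {set J} | T1 \subset T) \sum_(j in T :\: T1)
     u j * a (j |: T1) * b (T :\: T1).
  rewrite -big_split; apply: eq_bigr => T1 hT1; rewrite ffunE mulr_suml.
  rewrite (bigID (mem T)) /= addrC; congr (_ + _); apply: eq_bigl => j.
    by case: (boolP (j \in T)) => hj; rewrite ?andbF // andbT (contraNN (subsetP hT1 j)).
  by rewrite inE.
have -> : \sum_(T1 : {set J} | T1 \subset T) a T1 * cext_diff b (T :\: T1) =
  \sum_(T1 : {set J} | T1 \subset T) \sum_(j | j \notin T)
     u j * a T1 * b (j |: (T :\: T1)) +
  \sum_(T1 : {set J} | T1 \subset T) \sum_(j in T1)
     u j * a T1 * b (j |: (T :\: T1)).
  rewrite -big_split; apply: eq_bigr => T1 hT1; rewrite ffunE mulr_sumr.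
  rewrite (bigID (mem T)) /= addrC; congr (_ + _); apply: eq_big => j.
  - by rewrite !inE; case: (j \in T); rewrite ?andbF.
  - by move=> _; rewrite mulrA u_central.
  - rewrite !inE; case: (boolP (j \in T1)) => [/(subsetP hT1) -> //|].
    by case: (j \in T).
  - by move=> _; rewrite mulrA u_central.
set A1 := (X in _ = (X + _) + _); set A2 := (X in _ = (_ + X) + _).
set B1 := (X in _ = _ + (X + _)); set B2 := (X in _ = _ + (_ + X)).
have hAB : A2 = B2.
  rewrite /A2 /B2 (exchange_big_dep (mem T)) /=; last first.
    by move=> T1 j _; rewrite inE => /andP[].
  rewrite [RHS](exchange_big_dep (mem T)) /=; last first.
    by move=> T1 j /subsetP; apply.
  apply: eq_bigr => j jT.
  rewrite [RHS](reindex_onto (fun T1 => j |: T1) (fun T1 => T1 :\ j)) /=; last first.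
    by move=> T1 /andP[_ h]; rewrite setD1K.
  apply: eq_big => T1.
    rewrite subUset sub1set jT setU11 !inE jT !andbT /=; congr (_ && _).
    apply/idP/eqP => [h|<-]; first by rewrite setU1K.
    by rewrite setD11.
  move=> /andP[_ ]; rewrite inE => /andP[h _]; congr (_ * b _).
  apply/setP => i; rewrite !inE; case: eqP => [->|] /=; last by [].
  by rewrite jT h.
rewrite hAB addrACA R2 addr0 /A1 /B1 [X in _ = X + _]exchange_big /=.
rewrite [X in _ = _ + X]exchange_big -big_split /=.
apply: eq_bigr => j jT; rewrite cextME (bigID (fun T1 : {set J} => j \in T1)) /=.
rewrite mulrDr !mulr_sumr; congr (_ + _).
  rewrite [LHS](reindex_onto (fun T1 => j |: T1) (fun T1 => T1 :\ j)) /=; last first.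
    by move=> T1 /andP[_ h]; rewrite setD1K.
  apply: eq_big => T1.
    rewrite setU11 andbT; apply/andP/idP => [[h /eqP <-]|h].
      apply/subsetP => i; rewrite !inE => /andP[/negPf hi].
      by move=> h1; have := subsetP h i; rewrite !inE h1 hi => /(_ isT).
    split; first exact: setUS.
    by apply/eqP; rewrite setU1K //; apply: contra (subsetP h j) _.
  move=> /andP[_ /eqP hT1]; rewrite mulrA; congr (_ * b _).
  apply/setP => i; rewrite !inE; case: eqP => [->|//] /=.
  by rewrite (negPf jT) andbF.
apply: eq_big => T1.
  apply/andP/idP => [[h hj]|h].
    apply/subsetP => i hi; have := subsetP h i hi; rewrite !inE.
    by case: eqP => // ei; rewrite -ei hi in hj.
  split; first exact: subset_trans h (subsetUr _ _).
  by apply: contra (subsetP h j) _.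
move=> /andP[h hj]; rewrite mulrA; congr (_ * b _).
apply/setP => i; rewrite !inE; case: eqP => [->|//] /=.
by rewrite hj.
Qed.

Lemma cext_diffK a : cext_diff (cext_diff a) = 0.
Proof.
rewrite [a]cmono_sum raddf_sum raddf_sum big1 // => T _ /=.
rewrite cext_diff_cmono raddf_sum /=.
pose F i j := cmono (T :\ i :\ j) (u j * (u i * a T)).
have hF i j : F i j = F j i.
  by rewrite /F !setDDl setUC !mulrA (u_central i).
pose lt (i j : J) := (enum_rank i < enum_rank j)%N.
pose D := \sum_(i in T) \sum_(j in T | lt i j) F i j.
transitivity (D + D); last by apply/ffunP => T'; rewrite cextD ffunE R2.
rewrite {2}/D (exchange_big_dep (mem T)) /=; last by move=> i j _ /andP[].
rewrite -big_split; apply: eq_bigr => i iT; rewrite cext_diff_cmono.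
rewrite (bigID (lt i)) /=; congr (_ + _).
  apply: eq_bigl => j; rewrite !inE /lt.
  by case: eqP => [->|//]; rewrite ltnn !andbF.
apply: eq_big => [j|j _]; last exact: hF.
rewrite !inE iT /lt -leqNgt leq_eqVlt /= andbC.
rewrite (inj_eq val_inj) (inj_eq enum_rank_inj).
by case: eqP => [->|_] /=; rewrite ?ltnn ?andbF //= andbC.
Qed.

End CExtension.

Section KauffmanStatesAlgebra.
Variables n k : nat.

(* The set [0,n] is 'I_n.+1.  The set [1,n] is encoded by 'I_n: the index
   i : 'I_n stands for the integer label i = i + 1. *)
Definition label (i : 'I_n) : nat := i.+1.

(* the elements label i - 1 and label i of [0,n] *)
Definition lo (i : 'I_n) : 'I_n.+1 := widen_ord (leqnSn n) i.
Definition hi (i : 'I_n) : 'I_n.+1 := lift ord0 i.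

Definition V : Type := {x : {set 'I_n.+1} | #|x| == k}.
HB.instance Definition _ := Finite.on V.
HB.instance Definition _ := SubType.copy V {x : {set 'I_n.+1} | #|x| == k}.
Implicit Types x y z t : V.

Definition tail x (i : 'I_n) : {set 'I_n.+1} :=
  [set j in val x | (label i <= j)%N].
Definition v x y (i : 'I_n) : int := #|tail y i|%:Z - #|tail x i|%:Z.
Definition absv x y (i : 'I_n) : nat := `|v x y i|%N.

(* The truncated subtraction and the halving are exact, see vexpE. *)
Definition vexp x y z : 'X_{1..n} :=
  [multinom (absv y z i + absv x y i - absv x z i)./2 | i < n].

Lemma vexpE x y z i : ((vexp x y z i).*2 + absv x z i = absv x y i + absv y z i)%N.
Proof.
rewrite mnmE /absv; have -> : v x z i = v x y i + v y z i by rewrite /v; ring.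
by move: (v x y i) (v y z i) => p q; lia.
Qed.

Local Notation P := {mpoly 'F_2[n]}.

(* The coefficient of a : B0 at (x, y) is its coefficient on f_{x,y}. *)
Definition B0 : Type := {ffun V * V -> P}.
HB.instance Definition _ := GRing.Zmodule.copy B0 {ffun V * V -> P}.
HB.instance Definition _ := GRing.Lmodule.copy B0 {ffun V * V -> P}.
Implicit Types a b c : B0.

Definition B0_one : B0 := [ffun p => (p.1 == p.2)%:R].
Definition B0_mul a b : B0 :=
  [ffun p => \sum_y 'X_[vexp p.1 y p.2] * (a (p.1, y) * b (y, p.2))].

Lemma B0D a b p : (a + b) p = a p + b p. Proof. exact: ffunE. Qed.

Lemma B0_sumE (I : finType) (Q : pred I) (F : I -> B0) p :
  (\sum_(i | Q i) F i) p = \sum_(i | Q i) F i p.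
Proof.
apply: (big_morph (fun a : B0 => a p)) => [a b|]; first exact: B0D.
exact: ffunE.
Qed.

Lemma vexpA x y z t :
  (vexp x y z + vexp x z t = vexp y z t + vexp x y t)%MM.
Proof.
apply/mnmP => i; rewrite !mnmDE.
have := vexpE x y z i; have := vexpE x z t i.
by have := vexpE y z t i; have := vexpE x y t i; lia.
Qed.

Lemma v_id x i : v x x i = 0. Proof. by rewrite /v subrr. Qed.

Lemma vexpxx x y : vexp x x y = 0%MM.
Proof.
apply/mnmP => i; have := vexpE x x y i; rewrite mnm0E /absv v_id absz0; lia.
Qed.
Lemma vexpyy x y : vexp x y y = 0%MM.
Proof.
apply/mnmP => i; have := vexpE x y y i; rewrite mnm0E /absv v_id absz0; lia.
Qed.

Fact B0_mulA : associative B0_mul.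
Proof.
move=> a b c; apply/ffunP => -[x t]; rewrite !ffunE /=.
under eq_bigr do rewrite ffunE /= !mulr_sumr.
under [RHS]eq_bigr do rewrite ffunE /= mulr_suml mulr_sumr.
rewrite exchange_big; apply: eq_bigr => z _; apply: eq_bigr => y _ /=.
have := congr1 (fun m => 'X_[m] : P) (vexpA x y z t); rewrite !mpolyXD => h.
transitivity ('X_[vexp y z t] * 'X_[vexp x y t] * (a (x, y) * b (y, z) * c (z, t)));
  first by ring.
by rewrite -h; ring.
Qed.
Fact B0_mul1 : left_id B0_one B0_mul.
Proof.
move=> a; apply/ffunP => -[x z]; rewrite ffunE (bigD1 x) //= ffunE eqxx.
rewrite vexpxx mpolyX0 !mul1r big1 ?addr0 // => y /negPf h.
by rewrite ffunE /= eq_sym h mul0r mulr0.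
Qed.
Fact B0_mulr1 : right_id B0_one B0_mul.
Proof.
move=> a; apply/ffunP => -[x z]; rewrite ffunE (bigD1 z) //= ffunE eqxx.
rewrite vexpyy mpolyX0 mul1r mulr1 big1 ?addr0 // => y /negPf h.
by rewrite ffunE /= h !mulr0.
Qed.
Fact B0_mulDl : left_distributive B0_mul +%R.
Proof.
move=> a b c; apply/ffunP => p; rewrite B0D !ffunE -big_split.
by apply: eq_bigr => y _; rewrite B0D mulrDl mulrDr.
Qed.
Fact B0_mulDr : right_distributive B0_mul +%R.
Proof.
move=> a b c; apply/ffunP => p; rewrite B0D !ffunE -big_split.
by apply: eq_bigr => y _; rewrite B0D !mulrDr.
Qed.

HB.instance Definition _ := GRing.Zmodule_isPzRing.Build B0
  B0_mulA B0_mul1 B0_mulr1 B0_mulDl B0_mulDr.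

Lemma B0ME a b p :
  (a * b) p = \sum_y 'X_[vexp p.1 y p.2] * (a (p.1, y) * b (y, p.2)).
Proof. exact: ffunE. Qed.

(* U_1^(r_1) ... U_n^(r_n) f_{x,y} *)
Definition B0_mono (r : 'X_{1..n}) x y : B0 :=
  [ffun p => if p == (x, y) then 'X_[r] else 0].

Lemma B0_monoE r x y p :
  B0_mono r x y p = if p == (x, y) then 'X_[r] else 0.
Proof. exact: ffunE. Qed.

Lemma B0_monoM r s x y y' z : B0_mono r x y * B0_mono s y' z =
  if y == y' then B0_mono (r + s + vexp x y z)%MM x z else 0.
Proof.
apply/ffunP => -[x1 z1]; rewrite B0ME /=.
have -> : (if y == y' then B0_mono (r + s + vexp x y z)%MM x z else 0) (x1, z1) =
    if (y == y') && ((x1, z1) == (x, z)) then 'X_[(r + s + vexp x y z)%MM] else 0.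
  by case: ifP => _; rewrite !ffunE.
rewrite (bigD1 y) //= big1 => [|y1 /negPf h]; last first.
  by rewrite B0_monoE xpair_eqE h andbF mul0r mulr0.
rewrite !B0_monoE !xpair_eqE eqxx andbT addr0.
case: (eqVneq x1 x) => [->|_]; rewrite ?andbF ?mul0r ?mulr0 //=.
case: (y == y'); case: (eqVneq z1 z) => [->|_] /=; rewrite ?mulr0 //.
by rewrite !mpolyXD mulrC.
Qed.

Definition B0_f x y : B0 := B0_mono 0%MM x y.
Definition B0_I x : B0 := B0_f x x.
Definition B0_U i : B0 := \sum_x B0_mono U_(i)%MM x x.

(* sum of the f_{x,y} where y is x with label i - 1 replaced by label i *)
Definition B0_R i : B0 :=
  \sum_(x : V) \sum_(y : V | [&& lo i \in val x, hi i \notin val x &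
                       val y == hi i |: (val x :\ lo i)]) B0_f x y.
(* sum of the f_{x,y} where y is x with label i replaced by label i - 1 *)
Definition B0_L i : B0 :=
  \sum_(x : V) \sum_(y : V | [&& hi i \in val x, lo i \notin val x &
                       val y == lo i |: (val x :\ hi i)]) B0_f x y.

Inductive B_relation : B0 -> Prop :=
| B_relation_RR i j : label j = (label i).+1 -> B_relation (B0_R i * B0_R j)
| B_relation_LL i j : label j = (label i).+1 -> B_relation (B0_L j * B0_L i)
| B_relation_IU i x : lo i \notin val x -> hi i \notin val x ->
    B_relation (B0_I x * B0_U i).

Definition B : pzRingType := rquot (generated_ideal B_relation).
Definition B_pi : {rmorphism B0 -> B} := rquot_pi (generated_ideal B_relation).
Definition B_U i : B := B_pi (B0_U i).

Lemma B0_char2 a : a + a = 0.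
Proof.
apply/ffunP => p; rewrite B0D ffunE; apply/mpolyP => m.
by rewrite mcoeffD mcoeff0; case: (a p)@_m => -[|[|?]] // ?; apply: val_inj.
Qed.

Lemma B_char2 (r : B) : r + r = 0.
Proof. by have [a ->] := rquot_piP r; rewrite -raddfD B0_char2 raddf0. Qed.

Lemma B0_UE i x y : B0_U i (x, y) = if x == y then 'X_i else 0.
Proof.
rewrite /B0_U B0_sumE; under eq_bigr do rewrite B0_monoE xpair_eqE.
rewrite (bigD1 x) //= eqxx eq_sym big1 ?addr0 // => z /negPf h.
by rewrite eq_sym h.
Qed.

Lemma B0_UM i a p : (B0_U i * a) p = 'X_i * a p.
Proof.
case: p => x z; rewrite B0ME /= (bigD1 x) //= B0_UE eqxx vexpxx mpolyX0 mul1r.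
rewrite big1 ?addr0 // => y /negPf h.
by rewrite B0_UE eq_sym h mul0r mulr0.
Qed.

Lemma B0_MU i a p : (a * B0_U i) p = 'X_i * a p.
Proof.
case: p => x z; rewrite B0ME /= (bigD1 z) //= B0_UE eqxx vexpyy mpolyX0 mul1r.
rewrite big1 => [|y /negPf h]; first by rewrite addr0 mulrC.
by rewrite B0_UE h !mulr0.
Qed.

Lemma B_U_central i (r : B) : B_U i * r = r * B_U i.
Proof.
have [a ->] := rquot_piP r; rewrite /B_U -!rmorphM; congr (B_pi _).
by apply/ffunP => p; rewrite B0_UM B0_MU.
Qed.

Lemma B0_U_mono i r x y : B0_U i * B0_mono r x y = B0_mono (U_(i) + r)%MM x y.
Proof.
apply/ffunP => p; rewrite B0_UM !B0_monoE mpolyXD.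
by case: eqP => // _; rewrite mulr0.
Qed.

Variable S : {set 'I_n}.
Local Notation J := {i : 'I_n | i \in S}.
Implicit Types (T : {set J}) (r : 'X_{1..n}).

Definition BS : pzRingType := cext B J.
Definition BS_diff : {additive BS -> BS} := cext_diff (fun j : J => B_U (val j)).

Definition BS_idem x : BS := cmono set0 (B_pi (B0_I x)).

(* C_{i_1} ... C_{i_l} U_1^(r_1) ... U_n^(r_n) f_{x,y}, T = {i_1, ..., i_l} *)
Definition BS_mono T r x y : BS := cmono T (B_pi (B0_mono r x y)).

(* intrinsic degrees lie in (1/2 Z)^n, a subgroup of rat^n *)
Definition alex_group : zmodType := {ffun 'I_n -> rat}.

Definition alex T r x y : alex_group :=
  [ffun i => (r i)%:R + (absv x y i)%:R / 2%:R + #|[set j in T | val j == i]|%:R].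

Definition maslov T r x y : rat :=
  #|T|%:R - 2%:R * \sum_(i in S) alex T r x y i.

(* the subgroup spanned by the monomials of bidegree (m, w) *)
Inductive BS_homog (m : int) (w : alex_group) : BS -> Prop :=
| BS_homog_mono T r x y : maslov T r x y = m%:~R -> alex T r x y = w ->
    BS_homog m w (BS_mono T r x y)
| BS_homog0 : BS_homog m w 0
| BS_homogB (a b : BS) : BS_homog m w a -> BS_homog m w b -> BS_homog m w (a - b).

Lemma BS_homogD m w (a b : BS) :
  BS_homog m w a -> BS_homog m w b -> BS_homog m w (a + b).
Proof.
move=> ha hb; rewrite -[b]opprK -[- b]sub0r.
by apply: BS_homogB => //; apply: BS_homogB => //; apply: BS_homog0.
Qed.

Fact BS_addrr (a : BS) : a + a = 0.
Proof. by apply/ffunP => T; rewrite cextD B_char2 ffunE. Qed.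

Fact BS_idemM x y : BS_idem x * BS_idem y = if x == y then BS_idem x else 0.
Proof.
rewrite /BS_idem cmonoM -setI_eq0 setI0 eqxx setU0 -rmorphM B0_monoM.
case: eqP => [<-|_]; last by rewrite !raddf0.
by rewrite vexpxx !addm0.
Qed.

Fact BS_idem_sum : \sum_x BS_idem x = 1.
Proof.
have h1 : \sum_x B0_I x = 1.
  apply/ffunP => -[x y]; rewrite B0_sumE [RHS]ffunE /=.
  under eq_bigr do rewrite B0_monoE xpair_eqE mpolyX0.
  rewrite (bigD1 x) //= eqxx eq_sym big1 ?addr0 => [|z /negPf h].
    by case: eqP.
  by rewrite eq_sym h.
transitivity (cmono set0 (B_pi (\sum_x B0_I x)) : BS).
  by rewrite !raddf_sum.
rewrite h1 (rmorph1 B_pi).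
by apply/ffunP => T; rewrite !ffunE; case: eqP.
Qed.

Fact BS_diff_idem x : BS_diff (BS_idem x) = 0.
Proof. exact: cext_diff_base. Qed.

Fact BS_diffM (a b : BS) : BS_diff (a * b) = BS_diff a * b + a * BS_diff b.
Proof. by apply: cext_diffM => *; [apply: B_char2 | apply: B_U_central]. Qed.

Fact BS_diffK (a : BS) : BS_diff (BS_diff a) = 0.
Proof. by apply: cext_diffK => *; [apply: B_char2 | apply: B_U_central]. Qed.

Fact BS_homog_idem x : BS_homog 0 0 (BS_idem x).
Proof.
have h : alex set0 0%MM x x = 0.
  apply/ffunP => i; rewrite !ffunE mnm0E /absv v_id absz0 mul0r !add0r.
  by rewrite (_ : [set j in _ | _] = set0) ?cards0 //; apply/setP => j; rewrite !inE.
apply: (BS_homog_mono _ h).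
by rewrite /maslov h cards0 big1 ?mulr0 ?subr0 // => i _; rewrite ffunE.
Qed.

Lemma alexM T1 T2 r s x y z : [disjoint T1 & T2] ->
  alex (T1 :|: T2) (r + s + vexp x y z)%MM x z = alex T1 r x y + alex T2 s y z.
Proof.
move=> hd; apply/ffunP => i; rewrite !ffunE !mnmDE.
have -> : #|[set j in T1 :|: T2 | val j == i]| =
    (#|[set j in T1 | val j == i]| + #|[set j in T2 | val j == i]|)%N.
  rewrite -cardsUI; set I := _ :&: _; have -> : I = set0.
    apply/setP => j; rewrite !inE andbACA andbb; apply/andP => -[/andP[h1 h2] _].
    by rewrite (disjointFr hd h1) in h2.
  by rewrite cards0 addn0; apply: eq_card => j; rewrite !inE andb_orl.
have := congr1 (fun m : nat => m%:R : rat) (vexpE x y z i).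
rewrite -muln2 !natrD natrM => h.
move: h; move: (vexp x y z i)%:R (absv x z i)%:R (absv x y i)%:R (absv y z i)%:R.
by move=> p q1 q2 q3 h; lra.
Qed.

Lemma maslovM T1 T2 r s x y z : [disjoint T1 & T2] ->
  maslov (T1 :|: T2) (r + s + vexp x y z)%MM x z =
  maslov T1 r x y + maslov T2 s y z.
Proof.
move=> hd; rewrite /maslov alexM // cardsU (disjoint_setI0 hd) cards0 subn0.
under eq_bigr do rewrite ffunE.
by rewrite big_split natrD /=; ring.
Qed.

Fact BS_homogM m w m' w' (a b : BS) : BS_homog m w a -> BS_homog m' w' b ->
  BS_homog (m + m') (w + w') (a * b).
Proof.
elim=> [T r x y hm hw||a1 a2 _ h1 _ h2 hb]; last 2 first.
- by rewrite mul0r => _; apply: BS_homog0.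
- by rewrite mulrBl; apply: BS_homogB; [apply: h1 | apply: h2].
elim=> [T' s y' z hm' hw'||b1 b2 _ h1 _ h2]; last 2 first.
- by rewrite mulr0; apply: BS_homog0.
- by rewrite mulrBr; apply: BS_homogB.
rewrite /BS_mono cmonoM; case: (boolP [disjoint T & T']) => hd; last first.
  exact: BS_homog0.
rewrite -rmorphM B0_monoM; case: eqP => [ey|_]; last first.
  by rewrite !raddf0; apply: BS_homog0.
subst y'; apply: BS_homog_mono; last by rewrite alexM // hw hw'.
by rewrite maslovM // hm hm' rmorphD.
Qed.

Fact BS_homog_diff m w (a : BS) : BS_homog m w a -> BS_homog (m - 1) w (BS_diff a).
Proof.
elim=> [T r x y hm hw||a1 a2 _ h1 _ h2]; last 2 first.
- by rewrite raddf0; apply: BS_homog0.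
- by rewrite raddfB; apply: BS_homogB.
rewrite /BS_mono [BS_diff _]cext_diff_cmono.
apply: (big_ind (BS_homog (m - 1) w)) => [||j jT]; first exact: BS_homog0.
  exact: BS_homogD.
rewrite -rmorphM B0_U_mono.
have halex : alex (T :\ j) (U_(val j) + r)%MM x y = w.
  rewrite -hw; apply/ffunP => i; rewrite !ffunE mnmDE mnm1E.
  have -> : #|[set j0 in T | val j0 == i]| =
      ((val j == i) + #|[set j0 in T :\ j | val j0 == i]|)%N.
    rewrite (cardsD1 j) !inE jT /=; congr (_ + _)%N.
    by apply: eq_card => j'; rewrite !inE andbA.
  by rewrite !natrD; ring.
apply: (BS_homog_mono _ halex).
have -> : (m - 1)%:~R = m%:~R - 1 :> rat by rewrite rmorphB.
by rewrite -hm /maslov halex hw (cardsD1 j T) jT natrD mulr1n; ring.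
Qed.

Definition BS_dga : dga V alex_group :=
  @Dga V alex_group BS BS_idem BS_diff BS_homog
    (BS_addrr 1) BS_idemM BS_idem_sum BS_diff_idem BS_diffM BS_diffK
    BS_homog0 BS_homogB BS_homog_idem BS_homogM BS_homog_diff.

Definition Vr_pred (x : V) : bool := ord0 \notin val x.

Definition Br_dga : dga {x : V | Vr_pred x} alex_group := corner BS_dga Vr_pred.

End KauffmanStatesAlgebra.

(* Main.v *)
From HB Require Import structures.
Require Import Defs.
From mathcomp Require Import all_boot all_order all_algebra.
From mathcomp Require Import boolp mpoly.
From mathcomp Require Import zify ring lra.

(** Formality.  On maps from words in an algebra to a dg algebra, convolution
    (cut the word in two and multiply) and the bar differential form a dg
    algebra in which A_infinity morphisms are the solutions of [D f = f * f].
    Starting from a contraction of [A] onto its homology [H], the morphisms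
    [A -> H] and [H -> A] and the homotopy between their composite and the
    identity are solutions of fixed point equations for convolution.  If [H] is
    pure, i.e. its homological degree is an additive function of its intrinsic
    degree, then all higher operations on [H] vanish for degree reasons, so [A]
    is formal.  B_r(n,k) is spanned by the monomials outside a monomial ideal,
    and the homotopy that multiplies by [C_j / U_j] contracts B_r(n,k,S) as far
    as possible; in cases (a) and (b) what remains is pure.

    Non-formality.  If [y -> z] crosses only the line [j] of [S], then
    [f_yz f_zy = U_j I_y] is the boundary of [C_j I_y].  When [f_zy] annihilates
    a cycle [c] starting at [y], the Massey product [<f_yz, f_zy, c>] contains
    [C_j c], and degrees leave no room for indeterminacy.  Outside cases (a) and
    (b) there is such a [c] with [C_j c] not a boundary: a step
    continuing the move of [f_zy] in the same direction if [k < n - 1], and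
    [U_1 ... U_(j-1)] if [k = n - 1]. *)

(** Purity enters through a linear form [psi] on intrinsic degrees. If every letter of degree [w]
    sits in homological degree [psi w], a nonzero value sits in [psi] of the total, whereas an
    operation on [m] letters shifts by [m - 2]; only the product survives. In the two forms
    containing [w_1] this component counts the [C] left after contraction (none or one): the
    truncation forces [|v|_1 = 0], so [w_1] is an integer. For [k = n - 1] a truncated state has one
    hole besides 0, and a monomial from [x] to [y] vanishes iff every line below both holes occurs
    in it. If it is missing from [S], the product of the [U_t] below the least line of [S] contains
    no factor that the differential can produce, yet it is annihilated by a move across that
    line. *)

Set Implicit Arguments.
Unset Strict Implicit.
Unset Printing Implicit Defensive.

Import Order.TTheory GRing.Theory Num.Theory.
Local Open Scope ring_scope.

(** * Sums in groups of exponent 2 *)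

(* Reflexive decision of equalities between sums in a group of exponent 2:
   both sides must contain every atom with the same parity. *)
Inductive sumexpr := SumAtom of nat | SumAdd of sumexpr & sumexpr | SumZero.

Fixpoint sum_eval (V : zmodType) (env : seq V) e : V :=
  match e with
  | SumAtom i => nth 0 env i
  | SumAdd e1 e2 => sum_eval env e1 + sum_eval env e2
  | SumZero => 0
  end.

Fixpoint sum_parity i e : bool :=
  match e with
  | SumAtom j => i == j
  | SumAdd e1 e2 => sum_parity i e1 (+) sum_parity i e2
  | SumZero => false
  end.

Fixpoint sum_bounded k e : bool :=
  match e with
  | SumAtom j => (j < k)%N
  | SumAdd e1 e2 => sum_bounded k e1 && sum_bounded k e2
  | SumZero => true
  end.

Lemma sum_evalE (V : zmodType) (env : seq V) e :
    (forall a : V, a + a = 0) -> sum_bounded (size env) e ->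
  sum_eval env e = \sum_(i < size env) nth 0 env i *+ sum_parity i e.
Proof.
move=> V2; elim: e => [j|e1 IH1 e2 IH2|] /=.
- move=> jk; rewrite (bigD1 (Ordinal jk)) //= eqxx big1 ?addr0 // => i ij.
  by rewrite (_ : _ == _ = false) //; apply: contraNF ij => /eqP ij; apply/eqP/val_inj.
- case/andP=> /IH1 -> /IH2 ->; rewrite -big_split; apply: eq_bigr => i _ /=.
  by case: sum_parity; case: sum_parity; rewrite ?addr0 ?add0r //= V2.
- by rewrite big1.
Qed.

Lemma sum_eq2 (V : zmodType) (env : seq V) e1 e2 :
    (forall a : V, a + a = 0) ->
    sum_bounded (size env) e1 && sum_bounded (size env) e2 ->
    all (fun i => sum_parity i e1 == sum_parity i e2) (iota 0 (size env)) ->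
  sum_eval env e1 = sum_eval env e2.
Proof.
move=> V2 /andP[b1 b2] /allP h; rewrite !sum_evalE //.
by apply: eq_bigr => i _; rewrite (eqP (h i _)) // mem_iota /=.
Qed.

Ltac sum_index a env :=
  lazymatch env with
  | a :: _ => constr:(0%N)
  | _ :: ?env' => let i := sum_index a env' in constr:(i.+1)
  end.
Ltac sum_atoms V env e :=
  lazymatch e with
  | @GRing.add _ ?a ?b => let env1 := sum_atoms V env a in sum_atoms V env1 b
  | @GRing.zero _ => env
  | _ => match env with
         | _ => let i := sum_index e env in env
         | _ => constr:(@cons V e env)
         end
  end.
Ltac sum_reify env e :=
  lazymatch e with
  | @GRing.add _ ?a ?b =>
    let ra := sum_reify env a in let rb := sum_reify env b in
    constr:(SumAdd ra rb)
  | @GRing.zero _ => constr:(SumZero)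
  | _ => let i := sum_index e env in constr:(SumAtom i)
  end.
Ltac sum2 V2 :=
  lazymatch goal with
  | |- @eq ?V ?a ?b =>
    let env0 := constr:(@nil V) in
    let env1 := sum_atoms V env0 a in
    let env := sum_atoms V env1 b in
    let ra := sum_reify env a in let rb := sum_reify env b in
    exact: (@sum_eq2 _ env ra rb V2 isT isT)
  end.

(** * Convolution of maps on words *)

Section Convolution.
Variables (T : Type) (R : pzRingType).
Implicit Types (F G H : seq T -> R) (s t : seq T).

(** Cuts are enumerated from the left so that identities follow by induction on the word, with [F]
    generalised to its translates [fun t => F (a :: t)]; [conv_sumE] gives the sum over cuts. *)
Fixpoint conv F G s : R :=
  F [::] * G s + (if s is a :: s' then conv (fun t => F (a :: t)) G s' else 0).

Lemma eq_conv F F' G G' : F =1 F' -> G =1 G' -> conv F G =1 conv F' G'.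
Proof.
move=> hF hG s; elim: s F F' hF => [|a s IHs] F F' hF /=; rewrite hF hG //.
by congr (_ + _); apply: IHs => t; rewrite hF.
Qed.

Lemma convDl F F' G s : conv (fun t => F t + F' t) G s = conv F G s + conv F' G s.
Proof.
elim: s F F' => [|a s IHs] F F' /=; first by rewrite mulrDl !addr0.
by rewrite IHs mulrDl addrACA.
Qed.

Lemma convDr F G G' s : conv F (fun t => G t + G' t) s = conv F G s + conv F G' s.
Proof.
elim: s F => [|a s IHs] F /=; first by rewrite mulrDr !addr0.
by rewrite IHs mulrDr addrACA.
Qed.

Lemma convMl c F G s : conv (fun t => c * F t) G s = c * conv F G s.
Proof.
elim: s F => [|a s IHs] F /=; first by rewrite !addr0 mulrA.
by rewrite IHs mulrDr mulrA.
Qed.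

Lemma conv0l G s : conv (fun=> 0) G s = 0.
Proof. by elim: s => [|a s IHs] /=; rewrite ?IHs mul0r addr0. Qed.

Lemma convA F G H s : conv (conv F G) H s = conv F (conv G H) s.
Proof.
elim: s F => [|a s IHs] F /=; first by rewrite !addr0 mulrA.
rewrite addr0 (convDl (fun t => F [::] * G (a :: t)) (conv (fun t => F (a :: t)) G)).
by rewrite convMl IHs !mulrDr !mulrA !addrA.
Qed.

Lemma conv_sumE F G s :
  conv F G s = \sum_(0 <= j < (size s).+1) F (take j s) * G (drop j s).
Proof.
elim: s F => [|a s IHs] F /=; first by rewrite big_nat1 addr0.
by rewrite big_nat_recl // IHs.
Qed.

(** Both pieces are strictly shorter than the word, so an equation written with [conv_proper] can
    serve as a recursive definition. On maps vanishing at the empty word it agrees with [conv]. *)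
Definition conv_proper F G s : R :=
  \sum_(1 <= j < size s) F (take j s) * G (drop j s).

Lemma conv_properE F G s :
  F [::] = 0 -> G [::] = 0 -> conv_proper F G s = conv F G s.
Proof.
move=> F0 G0; rewrite /conv_proper conv_sumE; case: s => [|a s].
  by rewrite big_geq // big_nat1 /= F0 mul0r.
by rewrite big_add1 /= big_nat_recl //= F0 mul0r add0r big_nat_recr //= drop_size G0 mulr0 addr0.
Qed.

Lemma eq_conv_proper F F' G G' s :
    (forall t, (size t < size s)%N -> F t = F' t) ->
    (forall t, (size t < size s)%N -> G t = G' t) ->
  conv_proper F G s = conv_proper F' G' s.
Proof.
move=> hF hG; rewrite /conv_proper; apply: eq_big_nat => j /andP[j0 js].
by rewrite hF ?hG // ?size_drop ?size_takel //; [rewrite -subn_gt0 subKn // ltnW| apply: ltnW].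
Qed.

End Convolution.

Definition unitseq (T : Type) (V : zmodType) (phi : T -> V) (s : seq T) : V :=
  if s is [:: a] then phi a else 0.

(** * Recursion on the length of words *)

Section LocalFixpoint.
Variables (T U : Type) (Phi : (seq T -> U) -> seq T -> U) (F0 : seq T -> U).

Definition local_op := forall F G s,
  (forall t, (size t < size s)%N -> F t = G t) -> Phi F s = Phi G s.

(** A local operator settles the value at [s] after [(size s).+1] iterations; by [iter_local]
    further ones change nothing. *)
Definition local_fix s := iter (size s).+1 Phi F0 s.

Hypothesis Phi_local : local_op.

Lemma iter_local m n s : (size s < m)%N -> (size s < n)%N ->
  iter m Phi F0 s = iter n Phi F0 s.
Proof.
elim: m n s => [//|m IHm] [//|n] s hm hn; apply: Phi_local => t ht.
by apply: IHm; [exact: leq_trans ht hm | exact: leq_trans ht hn].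
Qed.

Lemma local_fixE s : local_fix s = Phi local_fix s.
Proof.
apply: Phi_local => t ht; exact: iter_local.
Qed.

End LocalFixpoint.

Section BarDifferential.
Variables (X : finType) (W : zmodType) (A : dga X W).

(** Precomposition with the differential of the bar construction, in a form that recurses like
    [conv]; [insertions_bar_diff] links it with the sum over blocks. *)
Fixpoint bar_diff (V : zmodType) (F : seq A -> V) (s : seq A) : V :=
  if s is a :: s' then
    F (dga_diff A a :: s') + (if s' is b :: t then F (a * b :: t) else 0) +
    bar_diff (fun t => F (a :: t)) s'
  else 0.

(** A block of three or more letters inserts the letter zero, which [F] kills; only single letters
    and adjacent pairs remain. *)
Lemma insertions_bar_diff (V : zmodType) (F : seq A -> V) s :
  (forall s t, F (s ++ 0 :: t) = 0) ->
  insertions F (dga_mu (A := A)) s = bar_diff F s.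
Proof.
elim: s F => [|a s IHs] F F0; first by rewrite /insertions big_ord_recl !big_ord0 addr0.
rewrite /insertions /= big_ord_recl big_ord0 add0r.
under eq_bigr => j _ do rewrite big_ord_recl /=.
rewrite big_split /=; congr (_ + _); last first.
  by rewrite -IHs // => t t'; exact: (F0 (a :: t) t').
rewrite big_ord_recl take0 drop0 /=; congr (_ + _).
case: s {IHs} => [|b s] /=; first by rewrite big_ord0.
rewrite big_ord_recl /= take0 drop0 big1 ?addr0 // => j _.
case: s j => [[]|c s j] //=; exact: (F0 [::]).
Qed.

Section Linear.
Variable V : zmodType.
Implicit Types F G : seq A -> V.

Lemma eq_bar_diff F G s :
  (forall t, (size t <= size s)%N -> F t = G t) -> bar_diff F s = bar_diff G s.
Proof.
elim: s F G => [//|a s IHs] F G h /=; congr (_ + _ + _).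
- exact: h.
- by case: s h {IHs} => // b s h; apply: h => /=.
- by apply: IHs => t ht; apply: h.
Qed.

Lemma bar_diffD F G s : bar_diff (fun t => F t + G t) s = bar_diff F s + bar_diff G s.
Proof.
elim: s F G => [|a s IHs] F G /=; first by rewrite addr0.
have -> : (if s is b :: t then F (a * b :: t) + G (a * b :: t) else 0) =
    (if s is b :: t then F (a * b :: t) else 0) +
    (if s is b :: t then G (a * b :: t) else 0).
  by case: s {IHs} => //; rewrite addr0.
by rewrite IHs [X in X + _]addrACA [LHS]addrACA.
Qed.

Lemma bar_diff_raddf (V' : zmodType) (phi : {additive V -> V'}) F s :
  bar_diff (fun t => phi (F t)) s = phi (bar_diff F s).
Proof.
elim: s F => [|a s IHs] F /=; first by rewrite raddf0.
by rewrite IHs !raddfD; case: s {IHs} => // ; rewrite raddf0.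
Qed.
End Linear.

Section Product.
Variable R : pzRingType.
Implicit Types F G : seq A -> R.

Lemma bar_diffMl (c : R) F s : bar_diff (fun t => c * F t) s = c * bar_diff F s.
Proof.
elim: s F => [|a s IHs] F /=; first by rewrite mulr0.
by rewrite IHs !mulrDr; case: s {IHs} => //; rewrite mulr0.
Qed.

Hypothesis R2 : forall a : R, a + a = 0.

(** Leibniz rule for convolution: a cut made after an insertion never splits the inserted letter, so
    it comes from an insertion on one side of a cut of the original word. *)
Lemma bar_diff_conv F G s :
  bar_diff (conv F G) s = conv (bar_diff F) G s + conv F (bar_diff G) s.
Proof.
elim: s F => [|a s IHs] F; first by rewrite /= mul0r mulr0 !addr0.
rewrite [LHS]/= [X in _ + X](bar_diffD (fun t => F [::] * G (a :: t))
  (conv (fun t => F (a :: t)) G)).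
rewrite bar_diffMl {}IHs [conv _ _ (a :: s)]/= mul0r add0r [conv F _ _]/=.
set D := bar_diff (fun t => F (a :: t)).
pose Fa t := if t is b :: t' then F (a * b :: t') else 0.
rewrite (convDl (fun t => F (dga_diff A a :: t) + Fa t) D) convDl.
have -> : conv Fa G s = if s is b :: t then conv (fun t' => F (a * b :: t')) G t else 0.
  by case: s => [|b s] /=; rewrite mul0r add0r.
by case: s => [|b s] /=; rewrite ?mulr0 !mulrDr; sum2 R2.
Qed.
End Product.
End BarDifferential.

(** * Composition along cuts into blocks *)

Section Composition.
Variables (T U : Type) (p : seq T -> U).

Definition block_comp (V : zmodType) (F : seq U -> V) (s : seq T) : V :=
  \sum_(bs <- blocks s) F [seq p b | b <- bs].

(* [w] is the block under construction. *)
Fixpoint comp_from (V : zmodType) (F : seq U -> V) (w s : seq T) : V :=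
  if s is a :: s' then
    comp_from (fun t => F (p w :: t)) [:: a] s' + comp_from F (rcons w a) s'
  else F [:: p w].

Lemma comp_fromE (V : zmodType) (F : seq U -> V) w s :
  \sum_(bs <- blocks s) F (p w :: [seq p b | b <- bs]) +
  \sum_(bs <- blocks s | ~~ nilp bs)
     F (p (w ++ head [::] bs) :: [seq p b | b <- behead bs]) = comp_from F w s.
Proof.
elim: s F w => [|a s IHs] F w /=.
  by rewrite !big_cons !big_nil /= !addr0.
rewrite !big_cat !big_map !big_filter /= -IHs -[in X in _ = _ + X]IHs.
congr (_ + _); congr (_ + _).
  by apply: eq_bigr => bs _; rewrite cats1.
by apply: eq_bigr => bs _; rewrite cat_rcons.
Qed.

Lemma block_comp_nil (V : zmodType) (F : seq U -> V) : block_comp F [::] = F [::].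
Proof. by rewrite /block_comp big_seq1. Qed.

Lemma block_comp_cons (V : zmodType) (F : seq U -> V) a s :
  block_comp F (a :: s) = comp_from F [:: a] s.
Proof. by rewrite -comp_fromE /block_comp /= big_cat !big_map big_filter. Qed.

Lemma eq_block_comp (V : zmodType) (F G : seq U -> V) :
  F =1 G -> block_comp F =1 block_comp G.
Proof. by move=> FG s; apply: eq_bigr => bs _; rewrite FG. Qed.

Lemma block_compD (V : zmodType) (F G : seq U -> V) s :
  block_comp (fun t => F t + G t) s = block_comp F s + block_comp G s.
Proof. exact: big_split. Qed.

Lemma block_comp_raddf (V V' : zmodType) (phi : {additive V -> V'}) (F : seq U -> V) s :
  block_comp (fun t => phi (F t)) s = phi (block_comp F s).
Proof. by rewrite /block_comp raddf_sum. Qed.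

Lemma block_comp_unitseq (V : zmodType) (phi : U -> V) s :
  ~~ nilp s -> block_comp (unitseq phi) s = phi (p s).
Proof.
case: s => [//|a s] _; rewrite block_comp_cons -[X in p X]cat1s.
move: [:: a] => w; elim: s w => [|b s IHs] w /=; first by rewrite cats0.
rewrite IHs cat_rcons; suff -> : comp_from (fun t => unitseq phi (p w :: t)) [:: b] s = 0.
  by rewrite add0r.
have : forall F : seq U -> V, (forall x t, F (x :: t) = 0) ->
  forall w, comp_from F w s = 0.
  elim: s {IHs} => [|c s IHs] F F0 w' //=; by rewrite !IHs // addr0.
apply=> x t; by case: t.
Qed.

Section Ring.
Variable R : pzRingType.
Hypothesis R2 : forall a : R, a + a = 0.
Implicit Types F G : seq U -> R.

Lemma comp_fromD F G w s :
  comp_from (fun t => F t + G t) w s = comp_from F w s + comp_from G w s.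
Proof. by rewrite -!comp_fromE !big_split addrACA. Qed.

Lemma comp_fromMl c F w s :
  comp_from (fun t => c * F t) w s = c * comp_from F w s.
Proof. by rewrite -!comp_fromE -!mulr_sumr mulrDr. Qed.

Lemma comp_from_conv F G w s :
  comp_from (conv F G) w s =
  F [::] * comp_from G w s + conv (comp_from F w) (block_comp G) s.
Proof.
elim: s F w => [|a s IHs] F w /=.
  by rewrite !addr0 block_comp_nil.
rewrite (comp_fromD (fun t => F [::] * G (p w :: t)) (conv (fun t => F (p w :: t)) G)).
rewrite comp_fromMl !IHs block_comp_cons.
rewrite (convDl (comp_from (fun t => F (p w :: t)) [:: a]) (comp_from F (rcons w a))).
by rewrite mulrDr; sum2 R2.
Qed.

(** Cutting into blocks and then splitting the list of blocks amounts to splitting the word and then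
    cutting each part. Hence composition with [p] is multiplicative for convolution. *)
Lemma block_comp_conv F G s :
  block_comp (conv F G) s = conv (block_comp F) (block_comp G) s.
Proof.
case: s => [|a s] /=; first by rewrite !block_comp_nil /= addr0.
rewrite !block_comp_cons block_comp_nil comp_from_conv; congr (_ + _).
by apply: eq_conv => // t; rewrite block_comp_cons.
Qed.

End Ring.
End Composition.

Section DgaTarget.
Variables (T : Type) (X : finType) (W : zmodType) (B : dga X W).
Implicit Types f g h : seq T -> B.

Lemma block_comp_if_nil (U : Type) (V : zmodType) (p : seq T -> U) (c : V) s :
  block_comp p (fun t => if nilp t then c else 0) s = if nilp s then c else 0.
Proof.
case: s => [|a s]; first by rewrite block_comp_nil.
rewrite block_comp_cons /=; move: [:: a] => w.
rewrite -comp_fromE /= !big1 ?addr0 // => bs; by case: bs.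
Qed.

Lemma dga_muE (t : seq B) :
  dga_mu (A := B) t = dga_diff B (unitseq id t) + conv (unitseq id) (unitseq id) t.
Proof.
case: t => [|a [|b t]] /=; rewrite ?raddf0 ?mul0r ?mulr0 ?addr0 ?add0r //.
case: t => [|c t] /=; rewrite ?mul0r ?mulr0 ?addr0 ?add0r //.
by rewrite conv0l.
Qed.

Lemma block_comp_dga_mu f s :
  f [::] = 0 -> block_comp f (dga_mu (A := B)) s = dga_diff B (f s) + conv f f s.
Proof.
move=> f0; rewrite (eq_block_comp _ dga_muE) block_compD block_comp_raddf.
rewrite block_comp_conv; last exact: dga_addrr.
have hf t : block_comp f (unitseq id) t = f t.
  case: (boolP (nilp t)) => [/nilP -> | nt]; last exact: block_comp_unitseq.
  by rewrite block_comp_nil.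
by rewrite hf; congr (_ + _); apply: eq_conv.
Qed.

(** The target has only [mu_1] and [mu_2], so next to the letter coming from [h] there is room for
    at most one block, which must then be everything on the left or everything on the right. *)
Lemma homotopy_dga_mu f g h s :
    f [::] = 0 -> g [::] = 0 -> h [::] = 0 ->
  \sum_(j < (size s).+1) \sum_(i < j)
    \sum_(bs <- blocks (take i s)) \sum_(cs <- blocks (drop j s))
      dga_mu (A := B) ([seq f b | b <- bs] ++
        h (drop i (take j s)) :: [seq g c | c <- cs]) =
  dga_diff B (h s) + conv f h s + conv h g s.
Proof.
move=> f0 g0 h0.
have inner z t1 t2 :
    \sum_(bs <- blocks t1) \sum_(cs <- blocks t2)
      dga_mu (A := B) ([seq f b | b <- bs] ++ z :: [seq g c | c <- cs]) =
    if nilp t1 then (if nilp t2 then dga_diff B z else z * g t2)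
    else (if nilp t2 then f t1 * z else 0).
  pose u := if nilp t2 then dga_diff B z else z * g t2.
  pose w (x : B) : B := if nilp t2 then x * z else 0.
  transitivity (block_comp f (fun xs => (if nilp xs then u else 0) + unitseq w xs) t1).
    apply: eq_bigr => bs _; move: [seq f b | b <- bs] => xs.
    transitivity (block_comp g (fun ys => (if nilp ys then dga_mu (A := B) (xs ++ [:: z]) else 0)
        + unitseq (fun y => if nilp xs then z * y else 0) ys) t2).
      apply: eq_bigr => cs _; case: [seq g c | c <- cs] => [|y ys] /=; first by rewrite addr0.
      case: xs => [|x [|x' xs]] /=; first by rewrite add0r.
        by case: ys => *; rewrite addr0.
      by case: ys => *; rewrite addr0; case: xs.
    rewrite (block_compD g (fun ys => if nilp ys then dga_mu (A := B) (xs ++ [:: z]) else 0)) block_comp_if_nil.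
    case: (boolP (nilp t2)) => [/nilP t20|nt].
      rewrite /u /w t20 block_comp_nil /= addr0.
      by case: xs => [|x [|x' xs]] /=; rewrite ?addr0 ?add0r //; case: xs.
    rewrite block_comp_unitseq // /u /w (negPf nt).
    by case: xs => [|x [|x' xs]] /=; rewrite ?addr0 ?add0r.
  rewrite block_compD block_comp_if_nil; case: (boolP (nilp t1)) => [/nilP ->|nt].
    by rewrite block_comp_nil /= addr0.
  by rewrite block_comp_unitseq // add0r.
under eq_bigr => j _ do under eq_bigr => i _ do rewrite inner.
rewrite big_ord_recr /= addrC -addrA; case: s => [|a s].
  by rewrite !big_ord0 /= f0 h0 !mul0r raddf0 !addr0.
have nilE (m : nat) (ms : (m < size (a :: s))%N) : nilp (take m (a :: s)) = (m == 0%N).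
  by rewrite /nilp size_takel // ltnW.
have nildE (m : nat) (ms : (m < size (a :: s))%N) : nilp (drop m (a :: s)) = false.
  by rewrite /nilp size_drop subn_eq0 leqNgt ms.
rewrite [X in X + _]big_ord_recl /= drop_size take_size /= -addrA; congr (_ + (_ + _)).
  rewrite f0 mul0r add0r conv_sumE big_mkord [RHS]big_ord_recr /=.
  by rewrite drop_size h0 mulr0 addr0; apply: eq_bigr.
rewrite h0 mul0r add0r conv_sumE big_mkord [RHS]big_ord_recr /= drop_size g0 mulr0 addr0.
rewrite big_ord_recl big_ord0 add0r; apply: eq_bigr => j _; rewrite lift0 nildE; last exact: (ltn_ord j).
by rewrite big_ord_recl /= big1 ?addr0.
Qed.

End DgaTarget.

(** * Bimodule maps and multimaps *)

Section Bimodules.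
Variables (X : finType) (W : zmodType).
Implicit Types M N P : gbimod X W.

Lemma gb_homogD N m w (a b : N) :
  gb_homog m w a -> gb_homog m w b -> gb_homog m w (a + b).
Proof.
move=> ha hb; rewrite -[b]opprK -[- b]sub0r.
by apply: gb_homogB => //; apply: gb_homogB => //; apply: gb_homog0.
Qed.

Lemma gb_homog_sum N m w (I : Type) (r : seq I) (P : pred I) (F : I -> N) :
  (forall i, P i -> gb_homog m w (F i)) -> gb_homog m w (\sum_(i <- r | P i) F i).
Proof.
by move=> h; apply: big_ind => //; [apply: gb_homog0 | move=> a b; apply: gb_homogD].
Qed.

Record bimod_map M N (e : int) (phi : M -> N) : Prop := BimodMap {
  bimod_map_add : forall a b, phi (a + b) = phi a + phi b;
  bimod_map_l : forall x a, phi (gb_l x a) = gb_l x (phi a);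
  bimod_map_r : forall x a, phi (gb_r x a) = gb_r x (phi a);
  bimod_map_homog : forall m w a, gb_homog m w a -> gb_homog (m + e) w (phi a)
}.

Lemma bimod_map0 M N e (phi : M -> N) : bimod_map e phi -> phi 0 = 0.
Proof. by move=> h; apply: (addrI (phi 0)); rewrite -(bimod_map_add h) !addr0. Qed.

Lemma bimod_map_id N : bimod_map 0 (@id N).
Proof. by split=> // m w a; rewrite addr0. Qed.

Lemma bimod_map_comp M N P e d (phi : M -> N) (psi : N -> P) :
  bimod_map e phi -> bimod_map d psi -> bimod_map (e + d) (psi \o phi).
Proof.
move=> h k; split=> [a b|x a|x a|m w a ha] /=.
- by rewrite (bimod_map_add h) (bimod_map_add k).
- by rewrite (bimod_map_l h) (bimod_map_l k).
- by rewrite (bimod_map_r h) (bimod_map_r k).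
by rewrite addrA; apply: (bimod_map_homog k); apply: (bimod_map_homog h).
Qed.

Lemma gb_l0 N x : gb_l x (0 : N) = 0.
Proof. by rewrite -[X in gb_l _ X](subrr 0) gb_lB subrr. Qed.
Lemma gb_r0 N x : gb_r x (0 : N) = 0.
Proof. by rewrite -[X in gb_r _ X](subrr 0) gb_rB subrr. Qed.
Lemma gb_lD N x (a b : N) : gb_l x (a + b) = gb_l x a + gb_l x b.
Proof. by rewrite -{1}[b]opprK -[- b]sub0r !gb_lB gb_l0 sub0r opprK. Qed.
Lemma gb_rD N x (a b : N) : gb_r x (a + b) = gb_r x a + gb_r x b.
Proof. by rewrite -{1}[b]opprK -[- b]sub0r !gb_rB gb_r0 sub0r opprK. Qed.

Lemma bimod_mapD M N e (phi psi : M -> N) :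
  bimod_map e phi -> bimod_map e psi -> bimod_map e (fun a => phi a + psi a).
Proof.
move=> h k; split=> [a b|x a|x a|m w a ha].
- by rewrite (bimod_map_add h) (bimod_map_add k) addrACA.
- by rewrite (bimod_map_l h) (bimod_map_l k) gb_lD.
- by rewrite (bimod_map_r h) (bimod_map_r k) gb_rD.
by apply: gb_homogD; [apply: (bimod_map_homog h) | apply: (bimod_map_homog k)].
Qed.

Lemma multimap_comp M N P c e (F : seq M -> N) (phi : N -> P) :
  multimap c F -> bimod_map e phi -> multimap (c + e) (phi \o F).
Proof.
move=> h k; split=> /=.
- by rewrite (mm_nil h) (bimod_map0 k).
- by move=> s a b t; rewrite (mm_add h) (bimod_map_add k).
- by move=> s a x b t; rewrite (mm_bal h).
- by move=> x a s; rewrite (mm_l h) (bimod_map_l k).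
- by move=> x s a; rewrite (mm_r h) (bimod_map_r k).
by move=> u nu hu; rewrite addrA; apply: (bimod_map_homog k); apply: (mm_homog h).
Qed.

Lemma multimap0 M N c : multimap c (fun _ : seq M => 0 : N).
Proof.
split=> //; rewrite ?addr0 //.
- by move=> x a s; rewrite gb_l0.
- by move=> x s a; rewrite gb_r0.
by move=> u _ _; apply: gb_homog0.
Qed.

Lemma multimapD M N c (F G : seq M -> N) :
  multimap c F -> multimap c G -> multimap c (fun s => F s + G s).
Proof.
move=> h k; split.
- by rewrite (mm_nil h) (mm_nil k) addr0.
- by move=> s a b t; rewrite (mm_add h) (mm_add k) addrACA.
- by move=> s a x b t; rewrite (mm_bal h) (mm_bal k).
- by move=> x a s; rewrite (mm_l h) (mm_l k) gb_lD.
- by move=> x s a; rewrite (mm_r h) (mm_r k) gb_rD.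
by move=> u nu hu; apply: gb_homogD; [apply: (mm_homog h) | apply: (mm_homog k)].
Qed.

Lemma multimap_unitseq M N e (phi : M -> N) :
  bimod_map e phi -> multimap (e - 1) (unitseq phi).
Proof.
move=> h; split=> //=.
- move=> [|c [|d s]] a b [|t0 t] /=; rewrite ?addr0 //; exact: (bimod_map_add h).
- by move=> [|c [|d s]] a x b t.
- by move=> x a [|c s]; rewrite ?gb_l0 // (bimod_map_l h).
- by move=> x [|c [|d s]] a /=; rewrite ?gb_r0 // (bimod_map_r h).
move=> [|[[m w] a] [|b u]] //= _ hu; last exact: gb_homog0.
rewrite !big_seq1 /= (_ : m + 1 + (e - 1) = m + e); last by ring.
by apply: (bimod_map_homog h); apply: (hu (m, w, a)); rewrite mem_head.
Qed.

(** Each instance of an axiom involves words of bounded length, where a recursively defined map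
    coincides with a finite iterate of its step. *)
Lemma multimap_local M N c (F : seq M -> N) :
  (forall n, exists2 G, multimap c G & forall s, (size s < n)%N -> F s = G s) ->
  multimap c F.
Proof.
move=> h; split.
- by have [G hG ->] := h 1%N; rewrite ?(mm_nil hG).
- move=> s a b t; have [G hG hs] := h (size (s ++ (a + b) :: t)).+1.
  by rewrite !hs ?(mm_add hG) // !size_cat /=.
- move=> s a x b t; have [G hG hs] := h (size (s ++ a :: b :: t)).+1.
  by rewrite !hs ?(mm_bal hG) // !size_cat /=.
- move=> x a s; have [G hG hs] := h (size (a :: s)).+1.
  by rewrite !hs ?(mm_l hG).
- move=> x s a; have [G hG hs] := h (size (rcons s a)).+1.
  by rewrite !hs ?(mm_r hG) // !size_rcons.
move=> u nu hu; have [G hG hs] := h (size [seq t.2 | t <- u]).+1.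
by rewrite hs //; apply: (mm_homog hG).
Qed.

End Bimodules.

Section MultimapProduct.
Variables (X : finType) (W : zmodType) (M : gbimod X W) (B : dga X W).
Implicit Types F G : seq M -> B.

Lemma conv_add F G s a b t :
  (forall s a b t, F (s ++ (a + b) :: t) = F (s ++ a :: t) + F (s ++ b :: t)) ->
  (forall s a b t, G (s ++ (a + b) :: t) = G (s ++ a :: t) + G (s ++ b :: t)) ->
  conv F G (s ++ (a + b) :: t) = conv F G (s ++ a :: t) + conv F G (s ++ b :: t).
Proof.
move=> hF hG; elim: s F hF => [|c s IHs] F hF /=.
  rewrite (hG [::]) mulrDr -addrACA -convDl; congr (_ + _).
  by apply: eq_conv => // t'; apply: (hF [::]).
by rewrite (hG (c :: s)) IHs ?mulrDr 1?addrACA // => s' a' b' t'; apply: (hF (c :: s')).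
Qed.

Lemma conv_bal F G s a x b t :
  (forall s a x b t, F (s ++ gb_r x a :: b :: t) = F (s ++ a :: gb_l x b :: t)) ->
  (forall s a x b t, G (s ++ gb_r x a :: b :: t) = G (s ++ a :: gb_l x b :: t)) ->
  (forall x s a, F (rcons s (gb_r x a)) = F (rcons s a) * dga_idem B x) ->
  (forall x a s, G (gb_l x a :: s) = dga_idem B x * G (a :: s)) ->
  conv F G (s ++ gb_r x a :: b :: t) = conv F G (s ++ a :: gb_l x b :: t).
Proof.
move=> hF hG hr hl; elim: s F hF hr => [|c s IHs] F hF hr /=.
  rewrite (hG [::]) (hr x [::]) /= hl mulrA; congr (_ + (_ + _)).
  by apply: eq_conv => // t'; apply: (hF [::]).
rewrite (hG (c :: s)) IHs // => [s' a' y b' t'|y s' a'].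
  exact: (hF (c :: s')).
exact: (hr y (c :: s')).
Qed.

Lemma conv_r F G x s a :
  (forall x s a, F (rcons s (gb_r x a)) = F (rcons s a) * dga_idem B x) ->
  (forall x s a, G (rcons s (gb_r x a)) = G (rcons s a) * dga_idem B x) ->
  G [::] = 0 ->
  conv F G (rcons s (gb_r x a)) = conv F G (rcons s a) * dga_idem B x.
Proof.
move=> hF hG G0; elim: s F hF => [|c s IHs] F hF /=.
  by rewrite (hG x [::]) /= G0 !mulr0 !addr0 mulrA.
rewrite (hG x (c :: s)) IHs ?mulrDl ?mulrA // => y s' a'.
exact: (hF y (c :: s')).
Qed.

(** At the cut itself, balancedness is the right linearity of [F] against the left linearity of [G].
    Proper cuts matter for homogeneity, which is only known on nonempty words. *)
Lemma multimap_conv_proper c d (F G : seq M -> dga_gbimod B) :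
  multimap c F -> multimap d G ->
  multimap (N := dga_gbimod B) (c + d) (conv_proper (R := B) F G).
Proof.
move=> hF hG; have E s := conv_properE s (mm_nil hF : F [::] = 0 :> B) (mm_nil hG).
split.
- by rewrite /conv_proper big_geq.
- by move=> s a b t; rewrite !E; apply: conv_add; [apply: (mm_add hF) | apply: (mm_add hG)].
- move=> s a x b t; rewrite !E; apply: conv_bal; [apply: (mm_bal hF) | apply: (mm_bal hG) | |].
    exact: (mm_r hF).
  exact: (mm_l hG).
- move=> x a s; rewrite !E /= (mm_nil hF) !mul0r !add0r -convMl.
  by apply: eq_conv => // t; apply: (mm_l hF).
- move=> x s a; rewrite !E; apply: conv_r; last exact: (mm_nil hG).
    exact: (mm_r hF).
  exact: (mm_r hG).
move=> u nu hu; rewrite /conv_proper [X in gb_homog _ _ X]big_seq; apply: gb_homog_sum => j.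
rewrite mem_index_iota size_map => /andP[j0 ju].
rewrite -map_take -map_drop -{1 2 3}(cat_take_drop j u) !big_cat /= size_cat.
set m1 := \sum_(t <- take j u) t.1.1; set m2 := \sum_(t <- drop j u) t.1.1.
have -> : m1 + m2 + (size (take j u) + size (drop j u))%:Z + (c + d) =
    (m1 + (size (take j u))%:Z + c) + (m2 + (size (drop j u))%:Z + d).
  by rewrite PoszD; ring.
apply: dga_homogM.
  apply: (mm_homog hF); first by rewrite -size_eq0 size_takel -?lt0n // ltnW.
  by move=> t /mem_take; apply: hu.
apply: (mm_homog hG); first by rewrite -size_eq0 size_drop subn_eq0 -ltnNge.
by move=> t /mem_drop; apply: hu.
Qed.

End MultimapProduct.

(** * Transfer to a pure homology *)

Section ConvDga.
Variables (T : Type) (X : finType) (W : zmodType) (B : dga X W).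
Implicit Types F G : seq T -> B.

Lemma eq_conv_lt F F' G G' s :
    F [::] = 0 -> F' [::] = 0 -> G [::] = 0 -> G' [::] = 0 ->
    (forall t, (size t < size s)%N -> F t = F' t) ->
    (forall t, (size t < size s)%N -> G t = G' t) ->
  conv F G s = conv F' G' s.
Proof.
by move=> ? ? ? ? hF hG; rewrite -!conv_properE //; apply: eq_conv_proper.
Qed.

Lemma diff_conv F G s :
  dga_diff B (conv F G s) =
  conv (fun t => dga_diff B (F t)) G s + conv F (fun t => dga_diff B (G t)) s.
Proof.
elim: s F => [|a s IHs] F /=; rewrite raddfD dga_diffM ?raddf0 ?addr0 //.
by rewrite IHs addrACA.
Qed.

End ConvDga.

Lemma bar_diff0 X W (A : dga X W) (V : zmodType) (F : seq A -> V) s :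
  (forall a t, F (a :: t) = 0) -> bar_diff F s = 0.
Proof.
elim: s F => [//|a s IHs] F F0 /=.
by rewrite F0 IHs => [|b t]; rewrite ?F0 // !addr0 add0r; case: s {IHs}.
Qed.

Lemma bar_diff_unitseq X W (A : dga X W) (V : zmodType) (phi : A -> V) s :
  phi 0 = 0 -> bar_diff (unitseq phi) s = phi (dga_mu (A := A) s).
Proof.
move=> phi0; case: s => [|a [|b s]] //; first by rewrite /= !addr0.
rewrite [LHS]/= [X in _ + X](@bar_diff0 _ _ _ _ (fun t => unitseq phi (a :: t)) (b :: s)) //.
by case: s => [|c s]; rewrite /= ?addr0 ?add0r.
Qed.

Section Transfer.
Variables (X : finType) (W : zmodType) (A H : dga X W).
Variables (inc : H -> A) (prj : A -> H) (h : A -> A).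
Local Notation d := (dga_diff A).
Local Notation MA := (dga_gbimod A).
Local Notation MH := (dga_gbimod H).
Hypotheses (inc_bm : bimod_map (M := MH) (N := MA) 0 inc)
  (prj_bm : bimod_map (M := MA) (N := MH) 0 prj)
  (h_bm : bimod_map (M := MA) (N := MA) 1 h).
Hypotheses (dH : forall q : H, dga_diff H q = 0)
  (d_inc : forall q, d (inc q) = 0) (prj_d : forall a, prj (d a) = 0)
  (prj_inc : forall q, prj (inc q) = q)
  (d_h : forall a, d (h a) = a + inc (prj a) + h (d a))
  (prjM : forall x y, prj (inc x * inc y) = x * y).
Variable psi : W -> rat.
Hypotheses (psi0 : psi 0 = 0) (psiD : forall w w', psi (w + w') = psi w + psi w').
Hypothesis pureH : forall m w (q : H),
  dga_homog m w q -> m%:~R != psi w -> q = 0.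
Hypothesis spanH : forall q : H, exists2 u : seq (int * W * H),
  (forall t, t \in u -> dga_homog t.1.1 t.1.2 t.2) & q = \sum_(t <- u) t.2.

Let A2 := @dga_addrr X W A.
Let H2 := @dga_addrr X W H.

HB.instance Definition _ := GRing.isNmodMorphism.Build H A inc
  (conj (bimod_map0 inc_bm) (bimod_map_add inc_bm)).
HB.instance Definition _ := GRing.isNmodMorphism.Build A H prj
  (conj (bimod_map0 prj_bm) (bimod_map_add prj_bm)).
HB.instance Definition _ := GRing.isNmodMorphism.Build A A h
  (conj (bimod_map0 h_bm) (bimod_map_add h_bm)).

Notation iota := (@unitseq A A id).

(* With [*] for convolution, the functions below solve
     [tq = base + tf * tk + tk * base], [tk = h tq],
     [tf = inc (prj tq) + h (tf * tf)].
   For [base = iota] they yield the morphism [tp = prj tq] from [A] to [H], its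
   composite [tf] with the morphism [ti] from [H] to [A], and the homotopy [tk]
   from [tf] to the identity; for [base = ti] they compute [tp] after [ti]. *)
Section Recursion.
Variables (T : Type) (base : seq T -> A).

Definition transfer_step (P : seq T -> A * A) (s : seq T) : A * A :=
  let f t := (P t).1 in let k t := h (P t).2 in
  let q := base s + conv_proper f k s + conv_proper k base s in
  (inc (prj q) + h (conv_proper f f s), q).

Lemma transfer_step_local : local_op transfer_step.
Proof.
move=> P P' s hP; rewrite /transfer_step.
pose f (P : seq T -> A * A) t := (P t).1; pose k (P : seq T -> A * A) t := h (P t).2.
have hf t : (size t < size s)%N -> f P t = f P' t by rewrite /f => /hP ->.
have hk t : (size t < size s)%N -> k P t = k P' t by rewrite /k => /hP ->.
by rewrite !(eq_conv_proper hf hk, eq_conv_proper hf hf, @eq_conv_proper _ _ _ _ base base s hk).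
Qed.

Definition transfer := local_fix transfer_step (fun=> (0, 0)).
Definition tf s := (transfer s).1.
Definition tq s := (transfer s).2.
Definition tk s := h (tq s).

Lemma tq_proper s : tq s = base s + conv_proper tf tk s + conv_proper tk base s.
Proof. by rewrite /tq /transfer local_fixE //; exact: transfer_step_local. Qed.
Lemma tf_proper s : tf s = inc (prj (tq s)) + h (conv_proper tf tf s).
Proof.
by rewrite {1}/tf tq_proper /transfer local_fixE //; exact: transfer_step_local.
Qed.

Hypothesis base_nil : base [::] = 0.

Lemma tq_nil : tq [::] = 0.
Proof. by rewrite tq_proper /conv_proper !big_geq // !addr0. Qed.
Lemma tk_nil : tk [::] = 0.
Proof. by rewrite /tk tq_nil raddf0. Qed.
Lemma tf_nil : tf [::] = 0.
Proof. by rewrite tf_proper tq_nil /conv_proper !big_geq // !raddf0 addr0. Qed.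
Lemma tqE s : tq s = base s + conv tf tk s + conv tk base s.
Proof. by rewrite tq_proper !conv_properE ?tf_nil ?tk_nil. Qed.
Lemma tfE s : tf s = inc (prj (tq s)) + h (conv tf tf s).
Proof. by rewrite tf_proper !conv_properE ?tf_nil. Qed.

Lemma transfer_unique (f q : seq T -> A) :
    f [::] = 0 -> q [::] = 0 ->
    (forall s, q s = base s + conv f (h \o q) s + conv (h \o q) base s) ->
    (forall s, f s = inc (prj (q s)) + h (conv f f s)) ->
  forall s, f s = tf s /\ q s = tq s.
Proof.
move=> f0 q0 hq hf s; have [n] := ubnP (size s); elim: n s => [//|n IHn] s hs.
have lt t : (size t < size s)%N -> f t = tf t /\ q t = tq t.
  by move=> ht; apply: IHn; apply: leq_trans ht _.
have ef t : (size t < size s)%N -> f t = tf t by case/lt.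
have ek t : (size t < size s)%N -> (h \o q) t = tk t by case/lt => _ /= ->.
have k0 : (h \o q) [::] = 0 by rewrite /= q0 raddf0.
have e : q s = tq s.
  rewrite hq tqE; congr (_ + _ + _); apply: eq_conv_lt => //; rewrite ?tf_nil ?tk_nil //.
by split=> //; rewrite hf tfE e; congr (_ + h _); apply: eq_conv_lt; rewrite ?tf_nil.
Qed.

End Recursion.

Arguments tf : simpl never.
Arguments tq : simpl never.

(** Composition with [p] commutes with [h] and [inc \o prj] and respects convolution, so it turns
    the system with base [unitseq id] into the system with base [p]; [transfer_unique] concludes. *)
Lemma block_comp_transfer (T : Type) (p : seq T -> A) : p [::] = 0 ->
  forall s, block_comp p (tf iota) s = tf p s /\ block_comp p (tq iota) s = tq p s.
Proof.
move=> p0; have bi s : block_comp p iota s = p s.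
  case: (boolP (nilp s)) => [/nilP -> | ns]; last exact: block_comp_unitseq.
  by rewrite block_comp_nil.
have bk s : block_comp p (tk iota) s = (h \o block_comp p (tq iota)) s.
  exact: block_comp_raddf.
apply: transfer_unique => //; rewrite ?block_comp_nil ?tf_nil ?tq_nil // => s.
  rewrite (eq_block_comp _ (@tqE _ iota erefl)).
  rewrite (block_compD p (fun t => iota t + conv (tf iota) (tk iota) t)) block_compD.
  rewrite bi !block_comp_conv //.
  by congr (_ + _ + _); apply: eq_conv.
rewrite (eq_block_comp _ (@tfE _ iota erefl)) block_compD (block_comp_raddf _ h).
by rewrite (block_comp_raddf _ (inc \o prj)) block_comp_conv.
Qed.

Local Notation f := (tf iota).
Local Notation q := (tq iota).
Local Notation k := (tk iota).

(** The equation for [tq] at [s] uses those for [tf] and [tk] on shorter words; applying [h] and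
    [inc \o prj] to it yields the other two at [s], hence the joint induction. After [prj], the
    first equation makes [tp] a morphism; the second, with [tq] expanded, makes [tk] a homotopy from
    [tf] to the identity. *)
Lemma transfer_maurer_cartan s :
  [/\ bar_diff q s = d (q s) + conv f f s,
      bar_diff k s = d (k s) + f s + q s &
      bar_diff f s = d (f s) + conv f f s].
Proof.
have [n] := ubnP (size s); elim: n s => [//|n IHn] s; rewrite ltnS => hs.
have ltn t : (size t < size s)%N -> (size t < n)%N by move=> ht; apply: leq_trans hs.
have q0 := @tq_nil _ iota erefl; have k0 := @tk_nil _ iota erefl.
have f0 := @tf_nil _ iota erefl.
have c0 : conv f f [::] = 0 by rewrite /= f0 mul0r addr0.
pose dd F (t : seq A) := d (F t).
have dc F G t : d (conv F G t) = conv (dd F) G t + conv F (dd G) t := diff_conv F G t.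
have diota : bar_diff iota =1 (fun t => dd iota t + conv iota iota t).
  by move=> t; rewrite bar_diff_unitseq // dga_muE.
(* A second factor vanishing at the empty word keeps the full word [s] out of the convolution, so
   the induction hypothesis covers every term. *)
have ff G : G [::] = 0 ->
    conv (bar_diff f) G s = conv (fun t => dd f t + conv f f t) G s.
  move=> G0; apply: eq_conv_lt => // [|t /ltn /IHn[]//].
  by rewrite /dd f0 raddf0 add0r c0.
have ff' G : G [::] = 0 ->
    conv G (bar_diff f) s = conv G (fun t => dd f t + conv f f t) s.
  move=> G0; apply: eq_conv_lt => // [|t /ltn /IHn[]//].
  by rewrite /dd f0 raddf0 add0r c0.
have kk G : G [::] = 0 ->
    conv (bar_diff k) G s = conv (fun t => dd k t + f t + q t) G s.
  move=> G0; apply: eq_conv_lt => // [|t /ltn /IHn[]//].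
  by rewrite /dd k0 raddf0 f0 q0 !addr0.
have kk' G : G [::] = 0 ->
    conv G (bar_diff k) s = conv G (fun t => dd k t + f t + q t) s.
  move=> G0; apply: eq_conv_lt => // [|t /ltn /IHn[]//].
  by rewrite /dd k0 raddf0 f0 q0 !addr0.
have Hff : bar_diff (conv f f) s = d (conv f f s).
  rewrite bar_diff_conv // ff // ff' // dc !(convDl (dd f), convDr _ (dd f)) convA.
  by sum2 A2.
have Hq : bar_diff q s = d (q s) + conv f f s.
  rewrite (@eq_bar_diff _ _ _ _ q (fun t => iota t + conv f k t + conv k iota t));
    last by move=> t _; exact: tqE.
  rewrite (bar_diffD (fun t => iota t + conv f k t)) bar_diffD !bar_diff_conv //.
  rewrite diota ff // kk // kk' // (eq_conv (frefl _) diota).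
  rewrite !(convDl (dd f), convDl (fun t => dd k t + f t), convDl (dd k),
    convDr _ (fun t => dd k t + f t), convDr _ (dd k), convDr _ (dd iota)).
  rewrite (eq_conv (frefl f) (@tqE _ iota erefl)) (eq_conv (@tqE _ iota erefl) (frefl iota)).
  rewrite !(convDl (fun t => iota t + conv f k t), convDl iota,
    convDr _ (fun t => iota t + conv f k t), convDr _ iota) !convA.
  rewrite [q s](@tqE _ iota erefl) !raddfD !dc -[d (iota s)]/(dd iota s).
  by sum2 A2.
have Hk : bar_diff k s = d (k s) + f s + q s.
  rewrite /tk (bar_diff_raddf h) Hq d_h raddfD (@tfE _ iota erefl).
  by rewrite /=; sum2 A2.
split=> //.
rewrite (@eq_bar_diff _ _ _ _ f (fun t => inc (prj (q t)) + h (conv f f t)));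
  last by move=> t _; exact: tfE.
rewrite bar_diffD (bar_diff_raddf h) (bar_diff_raddf (inc \o prj)) /= Hq Hff.
rewrite [f s](@tfE _ iota erefl) (bimod_map_add prj_bm) prj_d add0r (raddfD d) d_inc d_h.
by sum2 A2.
Qed.

Local Notation iotaH := (@unitseq H H id).

(** Homotopy transfer in recursive form: unrolled, the solution sums over planar binary trees with
    [inc] at the leaves, a product at each vertex and [h] after each product. *)
Definition ti_step (F : seq H -> A) s : A := unitseq inc s + h (conv_proper F F s).

Lemma ti_step_local : local_op ti_step.
Proof. by move=> F G s hFG; rewrite /ti_step (eq_conv_proper hFG hFG). Qed.

Definition ti := local_fix ti_step (fun=> 0).
Definition tp s := prj (q s).

Lemma ti_proper s : ti s = unitseq inc s + h (conv_proper ti ti s).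
Proof. by rewrite /ti local_fixE //; exact: ti_step_local. Qed.
Lemma ti_nil : ti [::] = 0.
Proof. by rewrite ti_proper /conv_proper big_geq // raddf0 addr0. Qed.
Lemma tiE s : ti s = unitseq inc s + h (conv ti ti s).
Proof. by rewrite ti_proper conv_properE ?ti_nil. Qed.
Arguments ti : simpl never.

Lemma multimap_conv_proper_eq (M : gbimod X W) (F G : seq M -> MA) c c' :
  multimap c F -> multimap c' G -> forall e, e = c + c' ->
  multimap (N := MA) e (conv_proper (R := A) F G).
Proof. by move=> hF hG e ->; apply: multimap_conv_proper. Qed.

Lemma multimap_comp_eq (M N P : gbimod X W) c e (F : seq M -> N) (phi : N -> P) :
  multimap c F -> bimod_map e phi -> forall c', c' = c + e ->
  multimap c' (phi \o F).
Proof. by move=> hF hphi c' ->; apply: multimap_comp. Qed.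

Lemma ti_multimap : multimap (M := MH) (N := MA) (- 1) ti.
Proof.
apply: multimap_local => n; exists (iter n ti_step (fun=> 0)); last first.
  by move=> s sn; apply: (iter_local _ ti_step_local).
elim: n => [|n IHn]; first exact: multimap0.
apply: multimapD; first exact: (multimap_unitseq inc_bm).
apply: (multimap_comp_eq (c := - 2) _ h_bm); last by [].
exact: (multimap_conv_proper_eq IHn IHn).
Qed.

Lemma transfer_multimap (M : gbimod X W) (base : seq M -> MA) :
  multimap (- 1) base ->
  multimap (N := MA) (- 1) (tf base) /\ multimap (N := MA) (- 1) (tq base).
Proof.
move=> hb; pose P n := iter n (transfer_step base) (fun=> (0, 0)).
have loc n s : (size s < n)%N -> transfer base s = P n s.
  move=> sn; rewrite /transfer /local_fix; apply: iter_local => //.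
  exact: transfer_step_local.
have mm n : multimap (N := MA) (- 1) (fun s => (P n s).1) /\
            multimap (N := MA) (- 1) (fun s => (P n s).2).
  elim: n => [|n [hf hq]]; first by split; exact: multimap0.
  have hk : multimap (N := MA) 0 (fun s => h (P n s).2).
    by apply: (multimap_comp_eq hq h_bm); rewrite addNr.
  have hq' : multimap (N := MA) (- 1) (fun s => (P n.+1 s).2).
    apply: multimapD; first apply: multimapD => //.
      exact: (multimap_conv_proper_eq hf hk).
    exact: (multimap_conv_proper_eq hk hb).
  split=> //; apply: multimapD.
    rewrite -[- 1]addr0; apply: (@multimap_comp _ _ _ MA MA _ _ _ (inc \o prj)) hq' _.
    by rewrite -[0]addr0; apply: bimod_map_comp prj_bm inc_bm.
  apply: (multimap_comp_eq (c := - 2) _ h_bm); last by [].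
  exact: (multimap_conv_proper_eq hf hf).
split; apply: multimap_local => n.
  by exists (fun s => (P n s).1) => [|s /loc]; [case: (mm n) | rewrite /tf => ->].
by exists (fun s => (P n s).2) => [|s /loc]; [case: (mm n) | rewrite /tq => ->].
Qed.

Lemma iota_multimap : multimap (M := MA) (N := MA) (- 1) iota.
Proof. exact: (multimap_unitseq (bimod_map_id MA)). Qed.

Lemma tp_multimap : multimap (M := MA) (N := MH) (- 1) tp.
Proof.
rewrite -[- 1]addr0; apply: multimap_comp prj_bm.
by case: (transfer_multimap iota_multimap).
Qed.

Lemma tk_multimap : multimap (M := MA) (N := MA) 0 k.
Proof.
apply: (multimap_comp_eq (c := - 1) _ h_bm); last by [].
by case: (transfer_multimap iota_multimap).
Qed.

(** On homogeneous nonzero letters purity predicts that a nonzero value has the sum of the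
    homological degrees, but the map adds [size s + c] to it. The reduction to homogeneous letters
    rests on [spanH], since [dga] does not record a direct sum decomposition. *)
Lemma pure_multimap0 c (F : seq H -> H) s :
  multimap (M := MH) (N := MH) c F -> (size s)%:Z + c != 0 -> F s = 0.
Proof.
move=> hF sc.
(* [u] holds the letters that are already homogeneous, with their degrees; [t] holds those still to
   be decomposed. *)
have homog0 (u : seq (int * W * H)) t : (size u + size t)%:Z + c != 0 ->
    (forall x, x \in u -> dga_homog x.1.1 x.1.2 x.2) -> F (map snd u ++ t) = 0.
  elim: t u => [|b t IHt] u hc hu.
    case: (boolP (u == [::])) => [/eqP -> | nu]; first by rewrite (mm_nil hF).
    have hz := mm_homog hF nu hu; rewrite cats0; apply/eqP.
    case: (boolP (all (fun x => x.2 != 0) u)) => [/allP hn|]; last first.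
      case/allPn => x /splitPr[u1 u2]; rewrite negbK => /eqP x0.
      by rewrite map_cat /= x0 (mm_0 _ _ hF).
    apply/eqP; apply: (pureH hz); apply: contra hc => /eqP hpsi.
    have : psi (\sum_(x <- u) x.1.2) = (\sum_(x <- u) x.1.1)%:~R.
      rewrite (big_morph psi psiD psi0) rmorph_sum !big_seq; apply: eq_bigr => x xu.
      have := pureH (hu _ xu); case: eqP => // _ /(_ isT) x0.
      by have := hn _ xu; rewrite x0 eqxx.
    move=> e; move: hpsi; rewrite e addn0 => /eqP; rewrite eqr_int.
    by rewrite -addrA -subr_eq0 [_ - _]addrC addKr.
  have [v hv ->] := spanH b; elim: v hv => [|x v IHv] hv.
    by rewrite big_nil (mm_0 _ _ hF).
  rewrite big_cons (mm_add hF) IHv ?addr0; last first.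
    by move=> y yv; apply: hv; rewrite inE yv orbT.
  rewrite -cat_rcons -map_rcons IHt //.
    by rewrite size_rcons addSnnS.
  move=> y; rewrite mem_rcons inE => /orP[/eqP ->|]; last exact: hu.
  by apply: hv; rewrite mem_head.
exact: (homog0 [::] s).
Qed.

(** The left side is the transferred A_infinity structure on [H]. Its shift is [- 2], so purity
    leaves only words of length two, where [prjM] identifies it with the product. *)
Lemma prj_conv_ti s : prj (conv ti ti s) = conv iotaH iotaH s.
Proof.
have ti1 x : ti [:: x] = inc x.
  by rewrite tiE /= ti_nil mul0r mulr0 !addr0 raddf0 addr0.
case: (eqVneq (size s) 2%N) => [|s2].
  case: s => [|x [|y [|z s]]] //= _.
  by rewrite ti_nil !ti1 !mul0r !mulr0 !addr0 !add0r prjM.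
transitivity (0 : H).
  have hC : multimap (M := MH) (N := MH) (- 2) (prj \o conv_proper ti ti).
    rewrite -[- 2]addr0; apply: multimap_comp prj_bm.
    exact: (multimap_conv_proper_eq ti_multimap ti_multimap).
  have /= := pure_multimap0 (s := s) hC; rewrite conv_properE ?ti_nil //; apply.
  by move: s2; lia.
case: s s2 => [|x [|y [|z s]]] //= _; rewrite ?mul0r ?mulr0 ?addr0 ?add0r //.
by rewrite conv0l.
Qed.

Lemma conv_iotaE s : conv iotaH iotaH s = dga_mu (A := H) s.
Proof. by rewrite dga_muE dH add0r. Qed.

(** By induction the bar differential and [d] agree on [conv ti ti]. Then [d_h] expands [d] of
    [h (conv ti ti s)], and the term with [inc \o prj] is the product of [H] by [prj_conv_ti]. *)
Lemma ti_maurer_cartan s : bar_diff ti s = d (ti s) + conv ti ti s.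
Proof.
have [n] := ubnP (size s); elim: n s => [//|n IHn] s; rewrite ltnS => hs.
pose dd t := d (ti t).
have lt t : (size t < size s)%N -> bar_diff ti t = dd t + conv ti ti t.
  by move=> ht; apply: IHn; apply: leq_trans hs.
have b0 : dd [::] + conv ti ti [::] = 0 by rewrite /dd /= ti_nil raddf0 mul0r !addr0.
have Hc : bar_diff (conv ti ti) s = d (conv ti ti s).
  rewrite bar_diff_conv //.
  rewrite (@eq_conv_lt _ _ _ _ (bar_diff ti) (fun t => dd t + conv ti ti t) ti ti) ?ti_nil //.
  rewrite (@eq_conv_lt _ _ _ _ ti ti (bar_diff ti) (fun t => dd t + conv ti ti t)) ?ti_nil //.
  rewrite diff_conv !(convDl dd, convDr _ dd) convA -/dd.
  by sum2 A2.
rewrite (@eq_bar_diff _ _ _ _ ti (fun t => unitseq inc t + h (conv ti ti t)));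
  last by move=> t _; exact: tiE.
rewrite (bar_diffD (unitseq inc)) (bar_diff_raddf h) Hc bar_diff_unitseq ?raddf0 //.
rewrite -conv_iotaE -prj_conv_ti [in d (ti s)]tiE (raddfD d) d_h.
have -> : d (unitseq inc s) = 0.
  by case: s {hs lt Hc} => [|x [|y s]]; rewrite /= ?raddf0 ?d_inc.
by rewrite [LHS]/=; sum2 A2.
Qed.

Lemma ti_morphism : ainf_morphism (A := ainf_of_dga H) (B := ainf_of_dga A) ti.
Proof.
split; first exact: ti_multimap.
move=> s; rewrite [LHS]insertions_bar_diff; last by move=> *; apply: (mm_0 _ _ ti_multimap).
by rewrite ti_maurer_cartan -[RHS]/(block_comp ti (dga_mu (A := A)) s) block_comp_dga_mu // ti_nil.
Qed.

(** Both sides solve [F s = inc (tp s) + h (conv F F s)], which determines [F] by induction on the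
    length. *)
Lemma ti_tp s : block_comp tp ti s = f s.
Proof.
have [n] := ubnP (size s); elim: n s => [//|n IHn] s; rewrite ltnS => hs.
rewrite (eq_block_comp _ tiE) block_compD (block_comp_raddf _ h) block_comp_conv //.
rewrite (@tfE _ iota erefl); congr (_ + h _).
  case: (boolP (nilp s)) => [/nilP -> | ns]; last exact: block_comp_unitseq.
  by rewrite block_comp_nil tq_nil // !raddf0.
apply: eq_conv_lt; rewrite ?block_comp_nil ?ti_nil ?tf_nil // => t ht.
  by apply: IHn; apply: leq_trans hs.
by apply: IHn; apply: leq_trans hs.
Qed.

Lemma tp_morphism : ainf_morphism (A := ainf_of_dga A) (B := ainf_of_dga H) tp.
Proof.
split; first exact: tp_multimap.
move=> s; rewrite [LHS]insertions_bar_diff; last by move=> *; apply: (mm_0 _ _ tp_multimap).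
rewrite -[RHS]/(block_comp tp (dga_mu (A := H)) s) -(eq_block_comp _ conv_iotaE).
rewrite -(eq_block_comp _ prj_conv_ti) (block_comp_raddf _ prj) block_comp_conv //.
rewrite (bar_diff_raddf prj); have [-> _ _] := transfer_maurer_cartan s.
rewrite [LHS]/= (bimod_map_add prj_bm) prj_d add0r; congr prj.
by apply: eq_conv => t; rewrite ti_tp.
Qed.

(** The composite has shift [- 1], so purity confines it to words of length one. The round trip on
    [H] is thus the identity on the nose and its homotopy can be zero. *)
Lemma tp_ti s : block_comp ti tp s = iotaH s.
Proof.
rewrite (block_comp_raddf _ prj); have [_ ->] := block_comp_transfer ti_nil s.
have [_ hq] := transfer_multimap ti_multimap.
case: (eqVneq (size s) 1%N) => [|s1].
  case: s => [|x [|y s]] //= _; rewrite (tqE ti_nil) /= tf_nil ?tk_nil ?ti_nil //.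
  by rewrite tiE /= ti_nil !(mul0r, mulr0, addr0, raddf0) prj_inc.
have hp : multimap (M := MH) (N := MH) (- 1) (prj \o tq ti).
  by rewrite -[- 1]addr0; apply: multimap_comp prj_bm.
transitivity (0 : H); last by case: s s1 => [|x [|y s]].
by apply: (pure_multimap0 hp); move: s1; lia.
Qed.

Theorem transfer_equivalence :
  ainf_homotopy_equivalent (ainf_of_dga A) (ainf_of_dga H).
Proof.
exists tp, ti; split; [exact: tp_morphism | exact: ti_morphism | |].
  exists k; split; first exact: tk_multimap.
  move=> s; rewrite homotopy_dga_mu //; last exact: tk_nil.
    rewrite [insertions _ _ _]insertions_bar_diff; last first.
      by move=> *; apply: (mm_0 _ _ tk_multimap).
    have [_ -> _] := transfer_maurer_cartan s; rewrite (eq_conv ti_tp (frefl k)).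
    rewrite -[ainf_comp _ _ _]/(block_comp tp ti s) ti_tp.
    rewrite (@tqE _ iota erefl); suff: f s + iota s = d (k s) + f s +
      (iota s + conv f k s + conv k iota s) + (d (k s) + conv f k s + conv k iota s) by [].
    by sum2 A2.
  by rewrite -[ainf_comp _ _ _]/(block_comp tp ti [::]) ti_tp tf_nil.
exists (fun=> 0); split; first exact: multimap0.
move=> s; rewrite -[ainf_comp _ _ _]/(block_comp ti tp s) tp_ti -[ainf_id _]/(iotaH s).
rewrite [LHS]H2 [insertions _ _ _]big1 ?add0r => [|j _]; last exact: big1.
rewrite big1 // => j _; rewrite big1 // => i _; rewrite big1 // => bs _.
by rewrite big1 // => cs _; exact: (mm_0 _ _ (dga_mu_multimap H)).
Qed.

End Transfer.

(** * Formality from a contraction off the pure line *)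

Section PureContraction.
Variables (X : finType) (W : zmodType) (A : dga X W).
Local Notation d := (dga_diff A).
Local Notation MA := (dga_gbimod A).
Local Notation H := (homology A).
Local Notation MH := (dga_gbimod H).
Variables (h : A -> A) (psi : W -> rat).
Hypotheses (h_bm : bimod_map (M := MA) (N := MA) 1 h)
  (d_h_d : forall a, d (h (d a)) = d a)
  (psiD : forall w w', psi (w + w') = psi w + psi w')
  (pure : forall m w a, dga_homog m w a -> m%:~R != psi w -> d (h a) + h (d a) = a)
  (span : forall a : A, exists2 u : seq (int * W * A),
    (forall t, t \in u -> dga_homog t.1.1 t.1.2 t.2) & a = \sum_(t <- u) t.2).

Let A2 := @dga_addrr X W A.

HB.instance Definition _ := GRing.isNmodMorphism.Build A A h
  (conj (bimod_map0 h_bm) (bimod_map_add h_bm)).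

Definition pure_proj a := a + (d (h a) + h (d a)).

Lemma d_bm : bimod_map (M := MA) (N := MA) (- 1) d.
Proof.
split=> [a b|x a|x a|m w a] /=.
- exact: raddfD.
- by rewrite dga_diffM dga_diff_idem mul0r add0r.
- by rewrite dga_diffM dga_diff_idem mulr0 addr0.
exact: dga_homog_diff.
Qed.

Lemma pure_proj_bm : bimod_map (M := MA) (N := MA) 0 pure_proj.
Proof.
apply: bimod_mapD; first exact: bimod_map_id.
apply: bimod_mapD.
  by rewrite -(subrr 1); apply: bimod_map_comp h_bm d_bm.
by rewrite -(addNr 1); apply: bimod_map_comp d_bm h_bm.
Qed.

Lemma d_pure_proj a : d (pure_proj a) = 0.
Proof. by rewrite /pure_proj !raddfD /= d_h_d dga_diffK add0r A2. Qed.

Lemma pure_proj_d a : pure_proj (d a) = 0.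
Proof. by rewrite /pure_proj d_h_d dga_diffK raddf0 addr0 A2. Qed.

Fact pure_proj_cycle a : cycle_pred (pure_proj a).
Proof. by rewrite /cycle_pred d_pure_proj. Qed.

Definition class (z : Defs.cycle A) : H := rquot_pi (boundary_ideal A) z.

Definition contr_prj (a : A) : H := class (Cycle (pure_proj_cycle a)).
(** [repr] picks an arbitrary cycle in the class; since [pure_proj] kills boundaries, the result
    does not depend on the choice and is therefore additive and bilinear. *)
Definition contr_inc (q : H) : A := pure_proj (val (repr q : Defs.cycle A)).

Lemma class_eq (z t : Defs.cycle A) :
  class z = class t <-> exists a, val z = val t + d a.
Proof.
rewrite /class rquot_pi_eq; split=> [/asboolP[a e]|[a e]].
  by exists a; rewrite -e raddfB /= addrC subrK.
by apply/asboolP; exists a; rewrite raddfB /= e addrC addKr.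
Qed.

Lemma contr_inc_class (z : Defs.cycle A) : contr_inc (class z) = pure_proj (val z).
Proof.
have [a e] : exists a, val (repr (class z)) = val z + d a.
  by apply/class_eq; rewrite /class /rquot_pi reprK.
by rewrite /contr_inc e (bimod_map_add pure_proj_bm) pure_proj_d addr0.
Qed.

Lemma classP (q : H) : exists z, q = class z.
Proof. by have [z ->] := rquot_piP q; exists z. Qed.

Lemma contr_prj_cycle (z : Defs.cycle A) : contr_prj (val z) = class z.
Proof.
apply/class_eq; exists (h (val z)).
by rewrite /= /pure_proj cycleP raddf0 addr0.
Qed.

Lemma contr_prj_inc q : contr_prj (contr_inc q) = q.
Proof.
have [z ->] := classP q; rewrite contr_inc_class.
rewrite -[pure_proj _]/(val (Cycle (pure_proj_cycle (val z)))) contr_prj_cycle.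
exact: contr_prj_cycle.
Qed.

Lemma contr_prj_bm : bimod_map (M := MA) (N := MH) 0 contr_prj.
Proof.
split=> [a b|x a|x a|m w a ha].
- rewrite /contr_prj /class -raddfD; congr rquot_pi; apply: val_inj.
  by rewrite raddfD /= (bimod_map_add pure_proj_bm).
- rewrite /contr_prj /class /= /homology_idem -rmorphM; congr rquot_pi; apply: val_inj.
  by rewrite rmorphM /= (bimod_map_l pure_proj_bm).
- rewrite /contr_prj /class /= /homology_idem -rmorphM; congr rquot_pi; apply: val_inj.
  by rewrite rmorphM /= (bimod_map_r pure_proj_bm).
by exists (Cycle (pure_proj_cycle a)) => //; exact: (bimod_map_homog pure_proj_bm).
Qed.

Lemma contr_inc_bm : bimod_map (M := MH) (N := MA) 0 contr_inc.
Proof.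
split=> [a b|x a|x a|m w a].
- have [z ->] := classP a; have [t ->] := classP b; rewrite -raddfD !contr_inc_class.
  by rewrite raddfD (bimod_map_add pure_proj_bm).
- have [z ->] := classP a; rewrite /= /homology_idem /class -rmorphM !contr_inc_class.
  by rewrite rmorphM /= (bimod_map_l pure_proj_bm).
- have [z ->] := classP a; rewrite /= /homology_idem /class -rmorphM !contr_inc_class.
  by rewrite rmorphM /= (bimod_map_r pure_proj_bm).
case=> z hz ->; rewrite contr_inc_class; exact: (bimod_map_homog pure_proj_bm).
Qed.

(** [contr_inc \o contr_prj] is [pure_proj] applied twice, and [pure_proj] need not be idempotent:
    the two differ by [d (h (pure_proj a))], which the second summand absorbs. *)
Definition contr_htp a := h a + h (pure_proj a).

Theorem formal_of_contraction : formal A.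
Proof.
have psi0 : psi 0 = 0 by apply: (addrI (psi 0)); rewrite -psiD !addr0.
have htp_bm : bimod_map (M := MA) (N := MA) 1 contr_htp.
  apply: bimod_mapD h_bm _; rewrite -[1]add0r.
  exact: bimod_map_comp pure_proj_bm h_bm.
apply: (transfer_equivalence contr_inc_bm contr_prj_bm htp_bm _ _ _ contr_prj_inc
  _ _ psi0 psiD) => //.
- by move=> q; exact: d_pure_proj.
- move=> a; rewrite -[RHS](raddf0 (rquot_pi (boundary_ideal A))).
  by congr rquot_pi; apply: val_inj; rewrite /= pure_proj_d.
- move=> a; rewrite /contr_prj contr_inc_class /= /contr_htp pure_proj_d !raddf0 addr0.
  rewrite [pure_proj (pure_proj a)]/pure_proj d_pure_proj raddf0 addr0 raddfD /=.
  by move: (d (h (pure_proj a))) => b; rewrite /pure_proj; sum2 A2.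
- move=> x y; have [z ->] := classP x; have [t ->] := classP y.
  rewrite !contr_inc_class.
  rewrite -[LHS]/(contr_prj (val (Cycle (pure_proj_cycle (val z)) * Cycle (pure_proj_cycle (val t))))).
  rewrite contr_prj_cycle /class rmorphM; congr (_ * _); exact: contr_prj_cycle.
- move=> m w q [z hz ->] mw; rewrite -[RHS](raddf0 (rquot_pi (boundary_ideal A))).
  apply/class_eq; exists (h (val z)).
  by rewrite raddf0 add0r -[LHS](pure hz mw) cycleP raddf0 addr0.
move=> q; have [u hu e] := span (contr_inc q).
exists [seq (t.1, contr_prj t.2) | t <- u].
  move=> _ /mapP[t tu ->] /=; rewrite -[t.1.1]addr0.
  exact: (bimod_map_homog contr_prj_bm (hu t tu)).
rewrite big_map /= -[LHS]contr_prj_inc e.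
exact: (big_morph _ (bimod_map_add contr_prj_bm) (bimod_map0 contr_prj_bm)).
Qed.

End PureContraction.

(** * Massey products *)

Lemma insertions_multimap X W (A : dga X W) (N : gbimod X W) c (F : seq A -> N) s :
  multimap (M := dga_gbimod A) c F -> insertions F (dga_mu (A := A)) s = bar_diff F s.
Proof. by move=> hF; apply: insertions_bar_diff => *; apply: (mm_0 _ _ hF). Qed.

Section Massey.
Variables (X : finType) (W : zmodType) (A : dga X W).
Local Notation d := (dga_diff A).
Local Notation H := (homology A).

(** Vanishing homology in one bidegree between two idempotents: such a piece contributes no
    indeterminacy to a Massey product. *)
Definition acyclic_piece (m : int) (w : W) (x y : X) : Prop :=
  forall e : A, dga_homog m w e -> dga_idem A x * e = e -> e * dga_idem A y = e ->
  d e = 0 -> exists e', e = d e'.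

Lemma acyclic_piece_homology m w x y (q : H) : acyclic_piece m w x y ->
  dga_homog m w q -> dga_idem H x * q = q -> q * dga_idem H y = q -> q = 0.
Proof.
move=> hA [z hz ->] <- <-.
(* The idempotents cut the homogeneous representative down to a cycle from [x] to [y] of the same
   degree. *)
pose z' : Defs.cycle A := Cycle (cycle_idem_subproof A x) * z * Cycle (cycle_idem_subproof A y).
have dz' : d (val z') = 0 := cycleP z'.
have -> : dga_idem H x * class z * dga_idem H y = class z' by rewrite /class !rmorphM.
have [|||e' he] := hA (val z') _ _ _ dz'.
- have := dga_homogM (dga_homogM (dga_homog_idem A x) hz) (dga_homog_idem A y).
  by rewrite !add0r !addr0 /z' !rmorphM.
- by rewrite !rmorphM /= !mulrA dga_idemM eqxx.
- by rewrite !rmorphM /= -!mulrA dga_idemM eqxx.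
rewrite -[RHS](raddf0 (rquot_pi (boundary_ideal A))); apply/class_eq.
by exists e'; rewrite he raddf0 add0r.
Qed.

(** As [b * c = 0], the Massey product is represented by [u * c]. For a morphism [f] to the
    homology, acyclicity kills [f [:: u]], [f [:: a; b]] and [f [:: b; c]]. The relation on
    [a, b, c] then gives [f [:: d u; c] = 0], and the one on [u, c] gives [f [:: u * c] = 0]. The
    homotopy from the round trip to the identity finally bounds [u * c]. *)
Lemma formal_massey (a b c u : A) (ma mb mc : int) (wa wb wc : W) (x y z t : X) :
    formal A ->
    dga_homog ma wa a -> dga_homog mb wb b -> dga_homog mc wc c ->
    dga_homog (ma + mb + 1) (wa + wb) u ->
    d a = 0 -> d b = 0 -> d c = 0 -> d u = a * b -> b * c = 0 ->
    dga_idem A x * a = a -> b * dga_idem A y = b ->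
    dga_idem A x * u = u -> u * dga_idem A y = u ->
    dga_idem A z * b = b -> c * dga_idem A t = c ->
    acyclic_piece (ma + mb + 1) (wa + wb) x y ->
    acyclic_piece (mb + mc + 1) (wb + wc) z t ->
  exists e, u * c = d e.
Proof.
move=> [f [g [[fm frel] [gm _] [h [hm hrel]] _]]] ha hb hc hu da db dc du bc0.
move=> xa by_ xu uy zb ct acy1 acy2.
have f0 : f [::] = 0 := mm_nil fm.
have rel s : bar_diff (A := A) f s = conv (R := H) f f s.
  have := frel s; rewrite [LHS](insertions_multimap (A := A) _ fm).
  rewrite -[RHS]/(block_comp f (dga_mu (A := H)) s) block_comp_dga_mu // => ->.
  exact: add0r.
have fu0 : f [:: u] = 0.
  apply: (acyclic_piece_homology acy1); last 2 first.
  - by rewrite -[LHS](mm_l fm x u [::]) /= xu.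
  - by rewrite -[LHS](mm_r fm y [::] u) /= uy.
  have := mm_homog fm (u := [:: (ma + mb + 1, wa + wb, u)]) isT.
  rewrite !big_seq1 /= addrK; apply=> v; rewrite inE => /eqP -> //.
have fab0 : f [:: a; b] = 0.
  apply: (acyclic_piece_homology acy1); last 2 first.
  - by rewrite -[LHS](mm_l fm x a [:: b]) /= xa.
  - by rewrite -[LHS](mm_r fm y [:: a] b) /= by_.
  have := mm_homog fm (u := [:: (ma, wa, a); (mb, wb, b)]) isT.
  rewrite !big_cons !big_nil /= !addr0 -[_ + 2%:Z + _]addrA; apply=> v.
  by rewrite !inE => /orP[] /eqP ->.
have fbc0 : f [:: b; c] = 0.
  apply: (acyclic_piece_homology acy2); last 2 first.
  - by rewrite -[LHS](mm_l fm z b [:: c]) /= zb.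
  - by rewrite -[LHS](mm_r fm t [:: b] c) /= ct.
  have := mm_homog fm (u := [:: (mb, wb, b); (mc, wc, c)]) isT.
  rewrite !big_cons !big_nil /= !addr0 -[_ + 2%:Z + _]addrA; apply=> v.
  by rewrite !inE => /orP[] /eqP ->.
have fz s s' : f (s ++ 0 :: s') = 0 := mm_0 _ _ fm.
have f3 : f [:: d u; c] = 0.
  have := rel [:: a; b; c]; rewrite /= f0 da db dc bc0 (fz [::]) (fz [:: a]) (fz [:: a; b]).
  by rewrite (fz [:: a] [::]) fab0 fbc0 du !(mul0r, mulr0, add0r, addr0).
have fuc : f [:: u * c] = 0.
  have := rel [:: u; c]; rewrite /= f0 f3 dc (fz [:: u]) fu0.
  by rewrite !(mul0r, mulr0, add0r, addr0).
exists (h [:: u * c]).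
have duc : d (u * c) = 0.
  by rewrite dga_diffM dc mulr0 addr0 du -mulrA bc0 mulr0.
have := hrel [:: u * c]; rewrite (@homotopy_dga_mu _ _ _ A) //; last first.
- exact: (mm_nil hm).
- by rewrite -[ainf_comp _ _ _]/(block_comp f g [::]) block_comp_nil (mm_nil gm).
rewrite (insertions_multimap (A := A) _ hm) /= (mm_nil hm) duc (mm_0 [::] _ hm).
rewrite -![ainf_comp _ _ _]/(block_comp f g _) block_comp_nil (mm_nil gm) !block_comp_cons /= fuc.
by rewrite (mm_0 [::] _ gm) !(mul0r, mulr0, add0r, addr0).
Qed.

End Massey.

(** * The monomial ideal of relations *)

Section MonomialIdeal.
Variables n k : nat.
Local Notation V := (V n k).
Local Notation B0 := (B0 n k).
Local Notation P := {mpoly 'F_2[n]}.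
Implicit Types (x y z p q : V) (r s g : 'X_{1..n}) (i j t : 'I_n).

Lemma card_tail_move x y (a b : 'I_n.+1) t :
    a \in val x -> b \notin val x -> val y = b |: (val x :\ a) ->
  (#|tail y t| + (t < a) = #|tail x t| + (t < b))%N.
Proof.
move=> ax bx yE; have ab : a != b by apply: contraNneq bx => <-.
pose C := [set c in val x :\ a | (label t <= c)%N].
have -> : #|tail x t| = ((t < a) + #|C|)%N.
  have [ta|ta] := boolP (t < a)%N.
    rewrite /= (cardsD1 a) !inE ax /label ta /=; congr (_ + _)%N.
    by apply: eq_card => c; rewrite /C !inE andbA.
  rewrite add0n; apply: eq_card => c; rewrite /C !inE.
  by case: eqP => [->|//]; rewrite /label (negPf ta) !andbF.
have -> : #|tail y t| = ((t < b) + #|C|)%N.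
  have [tb|tb] := boolP (t < b)%N.
    rewrite /= (cardsD1 b) !inE yE setU11 /label tb /=; congr (_ + _)%N.
    apply: eq_card => c; rewrite /C !inE yE !inE.
    by case: eqP => [->|//]; rewrite /= (negPf bx) !andbF.
  rewrite add0n; apply: eq_card => c; rewrite /C !inE yE !inE.
  by case: eqP => [->|//]; rewrite /label (negPf tb) !andbF.
by rewrite addnAC [(_ + (t < b))%N]addnC addnA.
Qed.

Lemma vmoveE x y (a b : 'I_n.+1) t :
    a \in val x -> b \notin val x -> val y = b |: (val x :\ a) ->
  v x y t = (t < b)%:Z - (t < a)%:Z.
Proof. by move=> ax bx yE; have := card_tail_move t ax bx yE; rewrite /v; lia. Qed.

(** The nonzero components, from [p] to [q], of the generating relations. Each is a single monomial
    [U^g f_pq], so the ideal is a monomial ideal. *)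
Inductive gen_mono g p q : Prop :=
| gen_RR i j of label j = (label i).+1 & lo i \in val p & hi i \notin val p &
    hi j \notin val p & val q = hi j |: (val p :\ lo i) & g = 0%MM
| gen_LL i j of label j = (label i).+1 & hi j \in val p & hi i \notin val p &
    lo i \notin val p & val q = lo i |: (val p :\ hi j) & g = 0%MM
| gen_U i of lo i \notin val p & hi i \notin val p & q = p & g = U_(i)%MM.

(** Divisibility by a generator: the two [vexp] terms are the exponents produced by [f_xp] on the
    left and [f_qy] on the right of [U^g f_pq]. *)
Definition dead r x y : Prop := exists g p q, gen_mono g p q /\
  forall t, (g t + vexp x p q t + vexp x q y t <= r t)%N.

Lemma dead_le r s x y : dead r x y -> (forall t, r t <= s t)%N -> dead s x y.
Proof.
move=> [g [p [q [hg hr]]]] rs; exists g, p, q; split=> // t.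
exact: leq_trans (hr t) (rs t).
Qed.

Lemma vexpAt x y z w t :
  (vexp x y z t + vexp x z w t = vexp y z w t + vexp x y w t)%N.
Proof. by rewrite -!mnmDE vexpA. Qed.

Lemma dead_mull r s x y z : dead r y z -> dead (s + r + vexp x y z)%MM x z.
Proof.
move=> [g [p [q [hg hr]]]]; exists g, p, q; split=> // t; rewrite !mnmDE.
by have := hr t; have := vexpAt x y p q t; have := vexpAt x y q z t; lia.
Qed.

Lemma dead_mulr r s x y z : dead r x y -> dead (r + s + vexp x y z)%MM x z.
Proof.
move=> [g [p [q [hg hr]]]]; exists g, p, q; split=> // t; rewrite !mnmDE.
by have := hr t; have := vexpAt x q y z t; lia.
Qed.

Lemma dead_gen g p q : gen_mono g p q -> dead g p q.
Proof.
by move=> hg; exists g, p, q; split=> // t; rewrite vexpxx vexpyy !mnm0E !addn0.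
Qed.

Lemma B0_fE x y (u : V * V) : B0_f x y u = if u == (x, y) then 1 else 0.
Proof. by rewrite /B0_f B0_monoE mpolyX0. Qed.

Lemma B0_RE i x y : B0_R k i (x, y) =
  if [&& lo i \in val x, hi i \notin val x & val y == hi i |: (val x :\ lo i)] then 1 else 0.
Proof.
rewrite /B0_R B0_sumE (bigD1 x) //= [X in _ + X]big1 ?addr0 => [|x' /negPf nx]; last first.
  by rewrite B0_sumE big1 // => y' _; rewrite B0_fE xpair_eqE eq_sym nx.
rewrite B0_sumE; case: ifP => [h|/negbT h].
  rewrite (bigD1 y h) big1 => [|y' /andP[_ /negPf ny]].
    by rewrite [LHS]addr0 B0_fE eqxx.
  by rewrite B0_fE xpair_eqE eq_sym ny andbF.
rewrite big1 // => y' hy'; rewrite B0_fE xpair_eqE eqxx /=.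
by case: eqP => // e; rewrite e hy' in h.
Qed.

Lemma B0_LE i x y : B0_L k i (x, y) =
  if [&& hi i \in val x, lo i \notin val x & val y == lo i |: (val x :\ hi i)] then 1 else 0.
Proof.
rewrite /B0_L B0_sumE (bigD1 x) //= [X in _ + X]big1 ?addr0 => [|x' /negPf nx]; last first.
  by rewrite B0_sumE big1 // => y' _; rewrite B0_fE xpair_eqE eq_sym nx.
rewrite B0_sumE; case: ifP => [h|/negbT h].
  rewrite (bigD1 y h) big1 => [|y' /andP[_ /negPf ny]].
    by rewrite [LHS]addr0 B0_fE eqxx.
  by rewrite B0_fE xpair_eqE eq_sym ny andbF.
rewrite big1 // => y' hy'; rewrite B0_fE xpair_eqE eqxx /=.
by case: eqP => // e; rewrite e hy' in h.
Qed.

#[local] Opaque B0_mono B0_R B0_L B0_U.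

Lemma B0_IMI (a : B0) p q u : (B0_I p * a * B0_I q) u = if u == (p, q) then a u else 0.
Proof.
have IM x y z : (B0_I x * a) (y, z) = if y == x then a (y, z) else 0.
  rewrite B0ME (bigD1 y) //= big1 => [|y' ny].
    rewrite B0_monoE xpair_eqE andbb vexpxx mpolyX0 addr0 mul1r.
    by case: eqP => _; rewrite ?mul1r ?mul0r.
  rewrite B0_monoE xpair_eqE; case: andP => [[/eqP e1 /eqP e2]|_]; last by rewrite mul0r mulr0.
  by rewrite e1 e2 eqxx in ny.
case: u => y z; rewrite B0ME (bigD1 z) //= big1 => [|z' nz].
  rewrite B0_monoE !xpair_eqE andbb IM vexpyy mpolyX0 addr0 mul1r.
  by case: (y == p); case: (z == q); rewrite ?mulr1 ?mul1r ?mulr0 ?mul0r.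
rewrite [B0_I q _]B0_monoE xpair_eqE; case: andP => [[/eqP e1 /eqP e2]|_]; last by rewrite !mulr0.
by rewrite e1 e2 eqxx in nz.
Qed.

Lemma exists_move p (a b : 'I_n.+1) : a \in val p -> b \notin val p ->
  exists y : V, val y = b |: (val p :\ a).
Proof.
move=> ap bp; have cy : #|b |: (val p :\ a)| == k.
  rewrite cardsU1 !inE (negPf bp) andbF /= add1n.
  have /eqP := valP p; rewrite (cardsD1 a) ap add1n => ->; exact: eqxx.
by exists (Sub (b |: (val p :\ a)) cy); rewrite SubK.
Qed.

Lemma lo_neq_hi i : lo i != hi i.
Proof. by rewrite -val_eqE /= /bump /= add1n; lia. Qed.

Lemma lo_hi i j : label j = (label i).+1 -> lo j = hi i.
Proof. by move=> h; apply: val_inj; move: h; rewrite /= /bump /label; lia. Qed.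

Lemma absv_move x y (a b : 'I_n.+1) t :
    a \in val x -> b \notin val x -> val y = b |: (val x :\ a) ->
  absv x y t = `|(t < b)%:Z - (t < a)%:Z|%N.
Proof. by move=> ax bx yE; rewrite /absv (vmoveE t ax bx yE). Qed.

Lemma move_trans x y (a b c : 'I_n.+1) : b \notin val x -> c \notin val x -> c != b ->
    a \in val x -> val y = b |: (val x :\ a) ->
  [/\ b \in val y, c \notin val y & c |: (val y :\ b) = c |: (val x :\ a)].
Proof.
move=> bx cx cb ax yE; rewrite yE; split; first exact: setU11.
  by rewrite !inE (negPf cb) (negPf cx) andbF.
congr (_ |: _); apply/setP => u; rewrite !inE.
by case: eqP => //= ->; rewrite (negPf bx) andbF.
Qed.

(** Two moves in the same direction cross lines with the same sign, so the absolute values add up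
    and no [U] appears. *)
Lemma vexp_path x y z (a b c : 'I_n.+1) : b \notin val x -> c \notin val x -> c != b ->
    a \in val x -> val y = b |: (val x :\ a) -> val z = c |: (val x :\ a) ->
  (a < b < c)%N || (c < b < a)%N -> vexp x y z = 0%MM.
Proof.
move=> bx cx cb ax yE zE abc; have [bY cY yz] := move_trans bx cx cb ax yE.
apply/mnmP => t; rewrite mnm0E; apply/eqP; rewrite -double_eq0.
have := vexpE x y z t; rewrite (absv_move t ax bx yE) (absv_move t ax cx zE).
rewrite (absv_move t bY cY) ?yz //.
by case/orP: abc => /andP[]; lia.
Qed.

Lemma hiE i : val (hi i) = i.+1. Proof. by rewrite /= /bump /= add1n. Qed.
Lemma loE i : val (lo i) = i. Proof. by []. Qed.

Lemma B0_RRE i j x z : label j = (label i).+1 ->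
  (B0_R k i * B0_R k j) (x, z) =
  if [&& lo i \in val x, hi i \notin val x, hi j \notin val x &
       val z == hi j |: (val x :\ lo i)] then 1 else 0.
Proof.
move=> ij; have lj := lo_hi ij; have hij : hi j != hi i by rewrite -lj eq_sym lo_neq_hi.
rewrite B0ME /=; under eq_bigr => y _ do rewrite !B0_RE lj.
case: (boolP (hi j \in val x)) => jx.
  rewrite andbF /= andbF big1 // => y _.
  case: (boolP [&& _, _ & _]) => [/and3P[lx hx /eqP yE]|]; last by rewrite mul0r mulr0.
  suff -> : hi j \in val y by rewrite /= andbF !mulr0.
  rewrite [val y]yE !inE jx andbT orbC -val_eqE hiE loE.
  by move: ij; rewrite /label => -[->]; rewrite gtn_eqF // ltnS leqnSn.
case: (boolP (lo i \in val x)) => lx; last by rewrite /= big1 // => y _; rewrite mul0r mulr0.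
case: (boolP (hi i \in val x)) => hx; first by rewrite /= big1 // => y _; rewrite mul0r mulr0.
have [y yE] := exists_move lx hx; have [h1 h2 h3] := move_trans hx jx hij lx yE.
rewrite (bigD1 y) //= big1 => [|y' ny]; last first.
  rewrite (_ : _ == _ = false) ?mul0r ?mulr0 //.
  by apply: contraNF ny => /eqP e; apply/eqP/val_inj; rewrite /= e yE.
rewrite addr0 yE eqxx -yE h1 h2 h3 /= mul1r.
case: eqP => [zE|_]; last by rewrite mulr0.
rewrite mulr1 (vexp_path hx jx hij lx yE zE) ?mpolyX0 // !hiE loE.
by move: ij; rewrite /label => -[->]; rewrite !ltnS leqnn.
Qed.

Lemma B0_LLE i j x z : label j = (label i).+1 ->
  (B0_L k j * B0_L k i) (x, z) =
  if [&& hi j \in val x, hi i \notin val x, lo i \notin val x &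
       val z == lo i |: (val x :\ hi j)] then 1 else 0.
Proof.
move=> ij; have lj := lo_hi ij; have hij := lo_neq_hi i.
rewrite B0ME /=; under eq_bigr => y _ do rewrite !B0_LE lj.
case: (boolP (lo i \in val x)) => jx.
  rewrite andbF /= andbF big1 // => y _.
  case: (boolP [&& _, _ & _]) => [/and3P[lx hx /eqP yE]|]; last by rewrite mul0r mulr0.
  suff -> : lo i \in val y by rewrite /= andbF !mulr0.
  rewrite [val y]yE !inE jx andbT orbC -val_eqE hiE loE.
  by move: ij; rewrite /label => -[->]; rewrite ltn_eqF.
case: (boolP (hi j \in val x)) => lx; last by rewrite /= big1 // => y _; rewrite mul0r mulr0.
case: (boolP (hi i \in val x)) => hx; first by rewrite /= big1 // => y _; rewrite mul0r mulr0.
have [y yE] := exists_move lx hx; have [h1 h2 h3] := move_trans hx jx hij lx yE.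
rewrite (bigD1 y) //= big1 => [|y' ny]; last first.
  rewrite (_ : _ == _ = false) ?mul0r ?mulr0 //.
  by apply: contraNF ny => /eqP e; apply/eqP/val_inj; rewrite /= e yE.
rewrite addr0 yE eqxx -yE h1 h2 h3 /= mul1r.
case: eqP => [zE|_]; last by rewrite mulr0.
rewrite mulr1 (vexp_path hx jx hij lx yE zE) ?mpolyX0 // !hiE loE.
by move: ij; rewrite /label => -[->]; rewrite !ltnS leqnn orbT.
Qed.

Lemma B0_IUE i x (u : V * V) : (B0_I x * B0_U k i) u = if u == (x, x) then 'X_i else 0.
Proof.
rewrite B0_MU B0_monoE mpolyX0.
by case: eqP; rewrite ?mulr1 ?mulr0.
Qed.

Lemma msupp_if (b : bool) r : r \in msupp (if b then 1 else 0 : P) -> b /\ r = 0%MM.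
Proof. by case: b; rewrite ?msupp0 // msupp1 inE => /eqP. Qed.

(** Exponents of sums and products come from those of the operands, so consisting of dead monomials
    passes from the generators to the whole ideal. *)
Lemma ideal_dead (a : B0) : ideal_gen (@B_relation n k) a ->
  forall x y r, r \in msupp (a (x, y)) -> dead r x y.
Proof.
elim=> {a} [a|x y r|u v _ hu _ hv x y r|a u _ hu x z r|a u _ hu x z r].
- case=> {a} [i j ij x z r|i j ij x z r|i p lp hp x z r].
  + rewrite B0_RRE // => /msupp_if[/and4P[h1 h2 h3 /eqP h4] ->].
    exact/dead_gen/(gen_RR ij).
  + rewrite B0_LLE // => /msupp_if[/and4P[h1 h2 h3 /eqP h4] ->].
    exact/dead_gen/(gen_LL ij).
  rewrite B0_IUE; case: eqP => [[-> ->]|_]; last by rewrite msupp0.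
  by rewrite msuppX inE => /eqP ->; exact/dead_gen/(gen_U lp hp).
- by rewrite ffunE msupp0.
- rewrite B0D [(- v) _]ffunE => /msuppD_le; rewrite mem_cat (perm_mem (msuppN _)).
  by case/orP; [apply: hu | apply: hv].
- rewrite B0ME => /msupp_sum_le /flatten_mapP[y _] /=.
  move=> /msuppM_le /allpairsP[[r1 r2] /= [+ + ->]].
  rewrite msuppX inE => /eqP -> /msuppM_le /allpairsP[[r3 r4] /= [_ h ->]].
  by rewrite addmC; apply: dead_mull; apply: hu.
rewrite B0ME => /msupp_sum_le /flatten_mapP[y _] /=.
move=> /msuppM_le /allpairsP[[r1 r2] /= [+ + ->]].
rewrite msuppX inE => /eqP -> /msuppM_le /allpairsP[[r3 r4] /= [h _ ->]].
by rewrite addmC; apply: dead_mulr; apply: hu.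
Qed.

Lemma gen_ideal g p q : gen_mono g p q -> ideal_gen (@B_relation n k) (B0_mono g p q).
Proof.
have IMI (a : B0) : ideal_gen (@B_relation n k) a -> a (p, q) = 1 ->
    ideal_gen (@B_relation n k) (B0_mono 0%MM p q).
  move=> ha a1; have -> : B0_mono 0%MM p q = B0_I p * a * B0_I q.
    by apply/ffunP => u; rewrite B0_monoE B0_IMI mpolyX0; case: eqP => // ->.
  by apply: ideal_genMr; apply: ideal_genMl.
case=> [i j ij h1 h2 h3 h4 ->|i j ij h1 h2 h3 h4 ->|i h1 h2 -> ->].
- apply: (IMI (B0_R k i * B0_R k j)); first exact/ideal_gen_in/B_relation_RR.
  by rewrite B0_RRE // h1 h2 h3 h4 eqxx.
- apply: (IMI (B0_L k j * B0_L k i)); first exact/ideal_gen_in/B_relation_LL.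
  by rewrite B0_LLE // h1 h2 h3 h4 eqxx.
have -> : B0_mono U_(i)%MM p p = B0_I p * B0_U k i.
  by apply/ffunP => u; rewrite B0_IUE B0_monoE.
exact/ideal_gen_in/B_relation_IU.
Qed.

Lemma B_pi_eq0 (a : B0) : B_pi n k a = 0 <-> ideal_gen (@B_relation n k) a.
Proof.
rewrite -(raddf0 (B_pi n k)); split=> [/rquot_pi_eq|h].
  by rewrite subr0 => /asboolP.
by apply/rquot_pi_eq; rewrite subr0; apply/asboolP.
Qed.

Lemma B_pi_mono_eq0 r x y : B_pi n k (B0_mono r x y) = 0 <-> dead r x y.
Proof.
rewrite B_pi_eq0; split=> [/ideal_dead h|[g [p [q [hg hr]]]]].
  by apply: h; rewrite B0_monoE eqxx msuppX inE.
pose s : 'X_{1..n} := [multinom (r t - (g t + vexp x p q t + vexp x q y t))%N | t < n].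
have -> : B0_mono r x y = B0_mono s x p * B0_mono g p q * B0_mono 0%MM q y.
  rewrite B0_monoM eqxx B0_monoM eqxx; congr (B0_mono _ _ _); apply/mnmP => t.
  by rewrite !mnmDE mnm0E mnmE; have := hr t; lia.
by apply: ideal_genMr; apply: ideal_genMl; apply: gen_ideal.
Qed.

End MonomialIdeal.

(** * Contractions of B_r *)

Section PolynomialExtension.
Variables (n : nat) (Z : zmodType).
Hypothesis Z2 : forall z : Z, z + z = 0.
Local Notation P := {mpoly 'F_2[n]}.
Implicit Types (g : 'X_{1..n} -> Z) (p q : P).

Definition poly_ext g p : Z := \sum_(m <- msupp p) g m *+ (p@_m : 'F_2).

Lemma poly_ext_uniq g p (s : seq 'X_{1..n}) : uniq s -> {subset msupp p <= s} ->
  poly_ext g p = \sum_(m <- s) g m *+ (p@_m : 'F_2).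
Proof.
move=> us ps; rewrite /poly_ext [RHS](bigID (fun m => m \in msupp p)) /=.
rewrite [X in _ + X]big1 ?addr0 => [|m mp]; last by rewrite memN_msupp_eq0.
rewrite -[RHS]big_filter; apply: perm_big; apply: uniq_perm; [exact: msupp_uniq | exact: filter_uniq |].
by move=> m; rewrite mem_filter; case: (boolP (m \in msupp p)) => // /ps ->.
Qed.

Lemma poly_extD g p q : poly_ext g (p + q) = poly_ext g p + poly_ext g q.
Proof.
pose s := undup (msupp p ++ msupp q); have us : uniq s := undup_uniq _.
have sE m : (m \in s) = (m \in msupp p) || (m \in msupp q) by rewrite mem_undup mem_cat.
rewrite (poly_ext_uniq g (p := p + q) us) => [|m /msuppD_le]; last by rewrite mem_cat sE.
rewrite (poly_ext_uniq g (p := p) us) => [|m mp]; last by rewrite sE mp.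
rewrite (poly_ext_uniq g (p := q) us) => [|m mq]; last by rewrite sE mq orbT.
rewrite -big_split; apply: eq_bigr => m _ /=; rewrite mcoeffD.
move: (p@_m) (q@_m) => [[|[|?]] ?] // [[|[|?]] ?] //=; rewrite ?addr0 ?add0r //.
Qed.

Lemma poly_ext0 g : poly_ext g 0 = 0.
Proof. by rewrite /poly_ext msupp0 big_nil. Qed.

Lemma poly_extX g m : poly_ext g 'X_[m] = g m.
Proof. by rewrite /poly_ext msuppX big_seq1 mcoeffX eqxx mulr1n. Qed.

Lemma poly_ext_eq0 g p : (forall m, m \in msupp p -> g m = 0) -> poly_ext g p = 0.
Proof.
by move=> h; rewrite /poly_ext big_seq big1 // => m /h ->; rewrite mul0rn.
Qed.

End PolynomialExtension.

(** * Additive maps prescribed on monomials *)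

Section LinearExtension.
Variables (n k : nat) (S : {set 'I_n}).
Local Notation V := (V n k).
Local Notation J := {i : 'I_n | i \in S}.
Local Notation BS := (BS k S).
Local Notation bmono := (@BS_mono n k S).
Implicit Types (T : {set J}) (r : 'X_{1..n}) (x y : V) (i j : J).

Lemma mpoly_F2E (p : {mpoly 'F_2[n]}) : p = \sum_(m <- msupp p) 'X_[m].
Proof.
rewrite {1}[p]mpolyE big_seq [RHS]big_seq; apply: eq_bigr => m.
rewrite mcoeff_msupp; case: (p@_m) => -[|[|?]] // h _.
by rewrite (_ : Ordinal h = 1) ?scale1r //; apply: val_inj.
Qed.

Lemma B0_monoE_sum (b : B0 n k) :
  b = \sum_(u : V * V) \sum_(m <- msupp (b u)) B0_mono m u.1 u.2.
Proof.
apply/ffunP => u; rewrite B0_sumE (bigD1 u) //= [X in _ = _ + X]big1 => [|v /negPf uv].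
  rewrite (big_morph (fun a : B0 n k => a u) (fun a c => B0D a c u) (ffunE _ _)).
  rewrite addr0 {1}[b u]mpoly_F2E; apply: eq_bigr => m _.
  by rewrite B0_monoE -surjective_pairing eqxx.
rewrite (big_morph (fun a : B0 n k => a u) (fun a c => B0D a c u) (ffunE _ _)) big1 // => m _.
by rewrite B0_monoE -surjective_pairing eq_sym uv.
Qed.

Lemma BS_mono_ind (Q : BS -> Prop) :
    Q 0 -> (forall a b, Q a -> Q b -> Q (a + b)) ->
    (forall T r x y, Q (bmono T r x y)) ->
  forall a, Q a.
Proof.
move=> Q0 QD Qm a; rewrite [a]cmono_sum; apply: big_ind => // T _.
have [b ->] := rquot_piP (a T); rewrite -[rquot_pi _ _]/(B_pi n k b).
rewrite [b]B0_monoE_sum !raddf_sum; apply: big_ind => // u _.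
by rewrite !raddf_sum; apply: big_ind => // m _; exact: Qm.
Qed.

Lemma BS_mono_eq0 T r x y : dead r x y -> bmono T r x y = 0.
Proof. by move=> /B_pi_mono_eq0 h; rewrite /BS_mono h raddf0. Qed.

Lemma B_pi_repr (b : B n k) : B_pi n k (repr b) = b.
Proof. exact: reprK. Qed.

Lemma BS_monoE T r x y T' :
  bmono T r x y T' = if T' == T then B_pi n k (B0_mono r x y) else 0.
Proof. exact: ffunE. Qed.

Section Extension.
Variable Z : zmodType.
Hypothesis Z2 : forall z : Z, z + z = 0.
Variable g : {set J} -> 'X_{1..n} -> V -> V -> Z.

(** Dead monomials get the value zero. As elements of the ideal are supported on them, the extension
    computed from an arbitrary representative descends to the quotient. *)
Definition live_part T (u : V * V) r : Z :=
  if `[< dead r u.1 u.2 >] then 0 else g T r u.1 u.2.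

Definition BS_ext (a : BS) : Z :=
  \sum_(T : {set J}) \sum_(u : V * V) poly_ext (live_part T u) ((repr (a T) : B0 n k) u).

Lemma poly_ext_repr T u (b c : B0 n k) : B_pi n k b = B_pi n k c ->
  poly_ext (live_part T u) (b u) = poly_ext (live_part T u) (c u).
Proof.
move=> /rquot_pi_eq /asboolP h.
have -> : b u = c u + (b - c) u by rewrite -B0D addrC subrK.
rewrite poly_extD // [X in _ + X]poly_ext_eq0 ?addr0 // => m hm.
case: u hm => x y /(ideal_dead h) hd; rewrite /live_part.
by case: asboolP.
Qed.

Lemma BS_extD a b : BS_ext (a + b) = BS_ext a + BS_ext b.
Proof.
rewrite -big_split; apply: eq_bigr => T _; rewrite -big_split; apply: eq_bigr => u _ /=.
rewrite -poly_extD // -B0D; apply: poly_ext_repr.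
apply: etrans (B_pi_repr _) _; rewrite cextD; apply: esym; apply: etrans (raddfD (B_pi n k) _ _) _.
by congr (_ + _); exact: B_pi_repr.
Qed.

Lemma BS_ext0 : BS_ext 0 = 0.
Proof. by apply: (addrI (BS_ext 0)); rewrite -BS_extD !addr0. Qed.

Lemma BS_ext_mono T r x y : ~ dead r x y -> BS_ext (bmono T r x y) = g T r x y.
Proof.
move=> hl; rewrite /BS_ext (bigD1 T) //= [X in _ + X]big1 => [|T' /negPf nT].
  rewrite (bigD1 (x, y)) //= [X in _ + X + _]big1 => [|u /negPf nu].
    rewrite !addr0 (@poly_ext_repr T (x, y) _ (B0_mono r x y)); last first.
      by apply: etrans (B_pi_repr _) _; rewrite BS_monoE eqxx.
    by rewrite B0_monoE eqxx poly_extX /live_part; case: asboolP.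
  rewrite (@poly_ext_repr T u _ (B0_mono r x y)); last first.
    by apply: etrans (B_pi_repr _) _; rewrite BS_monoE eqxx.
  by rewrite B0_monoE nu poly_ext0.
apply: big1 => u _; rewrite (@poly_ext_repr T' u _ 0).
  by rewrite (_ : (0 : B0 n k) u = 0) ?poly_ext0 // ffunE.
by apply: etrans (B_pi_repr _) _; rewrite BS_monoE nT raddf0.
Qed.

End Extension.
End LinearExtension.

(** * Homotopies that trade [U_j] for [C_j] *)

Section Monomials.
Variables (n k : nat) (S : {set 'I_n}).
Local Notation V := (V n k).
Local Notation J := {i : 'I_n | i \in S}.
Local Notation BS := (BS k S).
Local Notation bmono := (@BS_mono n k S).
Implicit Types (T : {set J}) (r : 'X_{1..n}) (x y z : V) (i j : J).

Definition cdeg T (t : 'I_n) : nat := #|[set j in T | val j == t]|.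

Lemma cdeg_val T j : cdeg T (val j) = (j \in T).
Proof.
rewrite /cdeg; case: (boolP (j \in T)) => jT.
  rewrite (_ : [set _ in T | _] = [set j]) ?cards1 //; apply/setP => i.
  by rewrite !inE (inj_eq val_inj) andbC; case: eqP => // ->.
rewrite (_ : [set _ in T | _] = set0) ?cards0 //; apply/setP => i.
by rewrite !inE (inj_eq val_inj) andbC; case: eqP => // ->; rewrite (negPf jT).
Qed.

Lemma cdeg_set0 t : cdeg set0 t = 0%N.
Proof. by rewrite /cdeg (_ : [set _ in _ | _] = set0) ?cards0 //; apply/setP => i; rewrite !inE. Qed.

Lemma cdegD1 T j t : j \in T -> cdeg T t = (cdeg (T :\ j) t + (val j == t))%N.
Proof.
move=> jT; rewrite /cdeg (cardsD1 j) !inE jT addnC /=; congr (_ + _)%N.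
by apply: eq_card => i; rewrite !inE andbA.
Qed.

(** The differential trades a [C_j] for a [U_j] and the homotopy does the reverse, so this exponent
    is invariant under both; with [x] and [y] it determines the intrinsic degree. *)
Definition total_deg T r : 'X_{1..n} := [multinom (r t + cdeg T t)%N | t < n].

Lemma total_degE T r t : total_deg T r t = (r t + cdeg T t)%N.
Proof. exact: mnmE. Qed.

Lemma total_degD1 T r j : j \in T ->
  total_deg (T :\ j) (U_(val j) + r)%MM = total_deg T r.
Proof.
move=> jT; apply/mnmP => t; rewrite !total_degE mnmDE mnm1E (cdegD1 t jT); lia.
Qed.

Lemma total_degU1 T r j : j \notin T -> (0 < r (val j))%N ->
  total_deg (j |: T) (r - U_(val j))%MM = total_deg T r.
Proof.
move=> jT rj; rewrite -[LHS](@total_degD1 _ _ j) ?setU11 // setU1K //.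
congr total_deg; apply/mnmP => t; rewrite mnmDE mnmBE mnm1E.
by case: eqP => [<-|_]; rewrite ?subnKC ?subn0.
Qed.

Lemma total_deg_notin T r j : j \notin T -> total_deg T r (val j) = r (val j).
Proof. by move=> jT; rewrite total_degE cdeg_val (negPf jT) addn0. Qed.

Lemma alexE T r x y t :
  alex T r x y t = (total_deg T r t)%:R + (absv x y t)%:R / 2%:R.
Proof. by rewrite ffunE total_degE natrD /cdeg addrAC. Qed.

Lemma alex_total T T' r r' x y : total_deg T r = total_deg T' r' ->
  alex T r x y = alex T' r' x y.
Proof. by move=> e; apply/ffunP => t; rewrite !alexE e. Qed.

Lemma maslov_int T r x y : exists m : int, maslov T r x y = m%:~R.
Proof.
exists (#|T|%:Z - \sum_(t in S) ((total_deg T r t).*2 + absv x y t)%:Z).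
rewrite rmorphB rmorph_sum /= /maslov mulr_sumr; congr (_ - _).
by apply: eq_bigr => t _; rewrite alexE -pmulrn natrD -muln2 natrM; lra.
Qed.

Lemma BS_diff_mono T r x y :
  BS_diff k S (bmono T r x y) = \sum_(j in T) bmono (T :\ j) (U_(val j) + r)%MM x y.
Proof.
rewrite /BS_mono [LHS]cext_diff_cmono; apply: eq_bigr => j _; congr cmono.
by rewrite -rmorphM B0_U_mono.
Qed.

Lemma BS_idem_mono z T r x y :
  BS_idem S z * bmono T r x y = if z == x then bmono T r x y else 0.
Proof.
rewrite /BS_idem /BS_mono cmonoM -setI_eq0 set0I eqxx set0U -rmorphM B0_monoM.
by case: eqP => [<-|_]; rewrite ?raddf0 // vexpxx add0m addm0.
Qed.

Lemma BS_mono_idem z T r x y :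
  bmono T r x y * BS_idem S z = if y == z then bmono T r x y else 0.
Proof.
rewrite /BS_idem /BS_mono cmonoM -setI_eq0 setI0 eqxx setU0 -rmorphM B0_monoM.
by case: eqP => [<-|_]; rewrite ?raddf0 // vexpyy !addm0.
Qed.

Let BS2 := @BS_addrr n k S.

Variable jsel : 'X_{1..n} -> V -> V -> option J.
Hypothesis jsel_gt0 : forall rho x y j, jsel rho x y = Some j -> (0 < rho (val j))%N.

(* The homotopy multiplies by [C_j / U_j], where [j] depends only on the
   intrinsic degree and the idempotents. *)
Definition htp_mono T r x y : BS :=
  if jsel (total_deg T r) x y is Some j then
    if j \in T then 0 else bmono (j |: T) (r - U_(val j))%MM x y
  else 0.

Definition htp : BS -> BS := BS_ext htp_mono.

HB.instance Definition _ := GRing.isNmodMorphism.Build BS BS htp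
  (conj (BS_ext0 BS2 htp_mono) (BS_extD BS2 htp_mono)).

Lemma htpD a b : htp (a + b) = htp a + htp b. Proof. exact: BS_extD. Qed.
Lemma htp0 : htp 0 = 0. Proof. exact: BS_ext0. Qed.

Lemma htpE T r x y : ~ dead r x y -> htp (bmono T r x y) = htp_mono T r x y.
Proof. exact: BS_ext_mono. Qed.

Lemma htp_l z (a : BS) : htp (BS_idem S z * a) = BS_idem S z * htp a.
Proof.
elim/BS_mono_ind: a => [|a b ha hb|T r x y]; first by rewrite mulr0 htp0 mulr0.
  by rewrite mulrDr !htpD mulrDr; exact: (congr2 _ ha hb).
have [hd|hl] := EM (dead r x y); first by rewrite BS_mono_eq0 // mulr0 htp0 mulr0.
rewrite BS_idem_mono htpE // /htp_mono.
case: (z =P x) => zx; [rewrite htpE // /htp_mono | rewrite htp0];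
  case: jsel => [j|]; rewrite ?mulr0 //; case: ifP => _; rewrite ?mulr0 //.
  by rewrite BS_idem_mono zx eqxx.
by rewrite BS_idem_mono; case: eqP.
Qed.

Lemma htp_r z (a : BS) : htp (a * BS_idem S z) = htp a * BS_idem S z.
Proof.
elim/BS_mono_ind: a => [|a b ha hb|T r x y]; first by rewrite mul0r htp0 mul0r.
  by rewrite mulrDl !htpD mulrDl; exact: (congr2 _ ha hb).
have [hd|hl] := EM (dead r x y); first by rewrite BS_mono_eq0 // mul0r htp0 mul0r.
rewrite BS_mono_idem htpE // /htp_mono.
case: (y =P z) => zx; [rewrite htpE // /htp_mono | rewrite htp0];
  case: jsel => [j|]; rewrite ?mul0r //; case: ifP => _; rewrite ?mul0r //.
  by rewrite BS_mono_idem zx eqxx.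
by rewrite BS_mono_idem; case: eqP.
Qed.

Lemma htp_homog m w (a : BS) : BS_homog m w a -> BS_homog (m + 1) w (htp a).
Proof.
elim=> [T r x y hm hw||b c _ hb _ hc]; last 2 first.
- by rewrite htp0; apply: BS_homog0.
- by rewrite (raddfB htp); apply: BS_homogB.
have [hd|hl] := EM (dead r x y).
  by rewrite BS_mono_eq0 // raddf0; apply: BS_homog0.
rewrite htpE // /htp_mono; case E: jsel => [j|]; last exact: BS_homog0.
case: ifPn => jT; first exact: BS_homog0.
have rj : (0 < r (val j))%N by rewrite -(total_deg_notin r jT); apply: jsel_gt0 E.
have hA : alex (j |: T) (r - U_(val j))%MM x y = w.
  by rewrite -hw; apply: alex_total; rewrite total_degU1.
apply: BS_homog_mono => //; rewrite /maslov hA intrD -hm /maslov hw cardsU1 jT natrD.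
by rewrite /=; ring.
Qed.

Local Notation d := (BS_diff k S).

Definition contracted (a : BS) : Prop := d (htp a) + htp (d a) = a.

Lemma sub_add r (i j : 'I_n) : (0 < r j)%N ->
  (U_(i) + (r - U_(j)))%MM = (U_(i) + r - U_(j))%MM.
Proof.
move=> rj; apply/mnmP => t; rewrite !(mnmDE, mnmBE, mnm1E).
by case: (j =P t) => [<-|_]; rewrite ?subn0 // addnBA.
Qed.

(** The term of the differential that removes [C_j] is sent back to the monomial. Any other term
    vanishes or still contains [C_j], and the homotopy kills it. *)
Lemma contracted_in T r x y j : ~ dead r x y ->
    jsel (total_deg T r) x y = Some j -> j \in T ->
    ~ dead (U_(val j) + r)%MM x y ->
  contracted (bmono T r x y).
Proof.
move=> hl E jT hj; rewrite /contracted htpE // /htp_mono E jT raddf0 add0r.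
rewrite BS_diff_mono raddf_sum (bigD1 j) //= big1 => [|i /andP[iT ij]].
  rewrite htpE // /htp_mono total_degD1 // E !inE eqxx /= setD1K // addr0.
  by congr (BS_mono _ _ _); apply/mnmP => t; rewrite !mnmE addKn.
have [hd|hi] := EM (dead (U_(val i) + r)%MM x y); first by rewrite BS_mono_eq0 // raddf0.
by rewrite htpE // /htp_mono total_degD1 // E !inE eq_sym ij jT.
Qed.

(** For [i] in [T], the terms of [d (htp _)] and [htp (d _)] that remove [C_i] cancel, except when
    the term of the differential is dead and the homotopy sees nothing; the last hypothesis makes
    its partner zero as well. *)
Lemma contracted_out T r x y j : ~ dead r x y ->
    jsel (total_deg T r) x y = Some j -> j \notin T ->
    (forall i, i \in T -> dead (U_(val i) + r)%MM x y ->
       dead (U_(val i) + r - U_(val j))%MM x y) ->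
  contracted (bmono T r x y).
Proof.
move=> hl E jT hT; have rj : (0 < r (val j))%N.
  by rewrite -(total_deg_notin r jT); apply: jsel_gt0 E.
rewrite /contracted htpE // /htp_mono E (negPf jT) !BS_diff_mono.
rewrite big_setU1 //= setU1K // raddf_sum -addrA -big_split /= big1 ?addr0.
  by congr (BS_mono _ _ _); apply/mnmP => t; rewrite !(mnmDE, mnmBE, mnm1E);
    case: eqP => [<-|]; rewrite ?subnKC // subn0.
move=> i iT; have ij : i != j by apply: contraNneq jT => <-.
rewrite sub_add //; have -> : (j |: T) :\ i = j |: (T :\ i).
  by apply/setP => u; rewrite !inE; case: (u =P j) => [->|] //=; rewrite eq_sym ij.
have [hd|hi] := EM (dead (U_(val i) + r)%MM x y).
  by rewrite [bmono (_ :\ _) _ _ _]BS_mono_eq0 // raddf0 BS_mono_eq0 ?addr0 //; apply: hT.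
by rewrite htpE // /htp_mono total_degD1 // E !inE (negPf jT) andbF BS2.
Qed.

Local Notation A := (BS_dga k S).
Local Notation Vr := (@Vr_pred n k).
Local Notation e := (corner_unit A Vr).
Local Notation Br := (Br_dga k S).

Lemma corner_unit_mono T r x y :
  e * bmono T r x y * e = if Vr x && Vr y then bmono T r x y else 0.
Proof.
have -> : e * bmono T r x y = if Vr x then bmono T r x y else 0.
  rewrite /corner_unit mulr_suml; case: ifP => [Vx|/negbT Vx].
    rewrite (bigD1 x) //= big1 => [|z /andP[_ /negPf nz]].
      by rewrite [X in X + _]BS_idem_mono eqxx addr0.
    by rewrite [LHS]BS_idem_mono nz.
  rewrite big1 // => z Vz; rewrite [LHS]BS_idem_mono; case: eqP => // zx.
  by rewrite -zx Vz in Vx.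
case: ifP => [Vx|]; last by rewrite mul0r.
rewrite /corner_unit mulr_sumr; case: ifP => [Vy|/negbT Vy].
  rewrite (bigD1 y) //= big1 => [|z /andP[_ /negPf nz]].
    by rewrite [X in X + _]BS_mono_idem eqxx addr0.
  by rewrite [LHS]BS_mono_idem eq_sym nz.
rewrite big1 // => z Vz; rewrite [LHS]BS_mono_idem; case: eqP => // zy.
by rewrite zy Vz in Vy.
Qed.

Lemma cornerD (a b : BS) : e * (a + b) * e = e * a * e + e * b * e.
Proof. by rewrite mulrDr mulrDl. Qed.

Lemma htp_corner (a : BS) : htp (e * a * e) = e * htp a * e.
Proof.
rewrite /corner_unit mulr_sumr mulr_sumr (raddf_sum htp); apply: eq_bigr => z _.
rewrite [LHS]htp_r; congr (_ * _).
rewrite mulr_suml mulr_suml (raddf_sum htp); apply: eq_bigr => t _; exact: htp_l.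
Qed.

Fact corner_htp_subproof (a : Br) : @corner_pred _ _ A Vr (htp (corner_val a)).
Proof. by rewrite /corner_pred -htp_corner (eqP (valP a)). Qed.

Definition corner_htp (a : Br) : Br := Corner (corner_htp_subproof a).

Lemma corner_span (b : BS) : exists2 u : seq (int * alex_group n * Br),
  (forall t, t \in u -> dga_homog t.1.1 t.1.2 t.2) &
  e * b * e = \sum_(t <- u) corner_val t.2.
Proof.
elim/BS_mono_ind: b => [|a b [u hu eu] [v hv ev]|T r x y].
- by exists [::]; rewrite ?big_nil ?mulr0 ?mul0r.
- exists (u ++ v); last by rewrite cornerD eu ev big_cat.
  by move=> t; rewrite mem_cat => /orP[/hu|/hv].
have hc : @corner_pred _ _ A Vr (e * bmono T r x y * e).
  by rewrite /corner_pred !mulrA corner_unitM -!mulrA corner_unitM.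
have [m hm] := maslov_int T r x y.
exists [:: (m, alex T r x y, Corner hc)]; last by rewrite big_seq1.
move=> t; rewrite inE => /eqP -> /=; rewrite /corner_homog /= corner_unit_mono.
by case: ifP => _; [exact: BS_homog_mono | exact: BS_homog0].
Qed.

Theorem formal_Br (psi : alex_group n -> rat) :
    (forall w w', psi (w + w') = psi w + psi w') ->
    (forall T r x y, Vr x -> Vr y -> ~ dead r x y ->
       contracted (bmono T r x y) \/
       d (bmono T r x y) = 0 /\ maslov T r x y = psi (alex T r x y)) ->
  formal Br.
Proof.
move=> psiD key.
have val_corner (a : Br) : e * corner_val a * e = corner_val a := eqP (valP a).
have htpB (a b : BS) : htp (a - b) = htp a - htp b := raddfB htp a b.
have dD (a b : BS) : d (a + b) = d a + d b := raddfD d a b.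
apply: (@formal_of_contraction _ _ _ corner_htp psi _ _ psiD).
- split=> [a b|x a|x a|m w a ha].
  + by apply: val_inj; exact: htpD.
  + by apply: val_inj; exact: htp_l.
  + by apply: val_inj; exact: htp_r.
  exact: htp_homog.
- move=> a; apply: val_inj; rewrite /= -[corner_val a]val_corner.
  elim/BS_mono_ind: (corner_val a) => [|b c hb hc|T r x y].
  + by rewrite mulr0 mul0r !(raddf0, htp0).
  + by rewrite cornerD !(dD, htpD) [X in X + _]hb [X in _ + X]hc.
  rewrite corner_unit_mono; case: ifP => [/andP[Vx Vy]|_]; last by rewrite !(raddf0, htp0).
  have [hd|hl] := EM (dead r x y); first by rewrite BS_mono_eq0 // !(raddf0, htp0).
  (* On a contracted monomial [d h d = d] results from applying [d] to the contraction identity; on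
     the others [d] is zero. *)
  case: (key T r x y Vx Vy hl) => [hc|[hc _]]; last by rewrite [in LHS]hc htp0 raddf0.
  by have := congr1 d hc; rewrite dD BS_diffK add0r.
- move=> m w a ha mw; apply: val_inj; rewrite /= -[corner_val a]val_corner.
  elim: ha => [T r x y hm hw||b c _ hb _ hc].
  + rewrite corner_unit_mono; case: ifP => [/andP[Vx Vy]|_].
      have [hd|hl] := EM (dead r x y).
        by rewrite BS_mono_eq0 // !(raddf0, htp0) addr0.
      case: (key T r x y Vx Vy hl) => // -[_]; rewrite hm hw => mw'.
      by rewrite mw' eqxx in mw.
    by rewrite !(raddf0, htp0) addr0.
  + by rewrite mulr0 mul0r !(raddf0, htp0) addr0.
  rewrite mulrBr mulrBl ![d (_ - _)](raddfB d) !htpB (raddfB d).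
  rewrite addrACA -opprD; exact: (congr2 (fun u v : BS => u - v) hb hc).
move=> a; have [u hu eu] := corner_span (corner_val a).
exists u => //; apply: val_inj; rewrite raddf_sum -[LHS]val_corner eu.
by apply: eq_bigr.
Qed.

End Monomials.

(** * Formal cases *)

Section DeadMonomials.
Variables n k : nat.
Local Notation V := (V n k).
Local Notation Vr := (@Vr_pred n k).
Implicit Types (x y z p q : V) (r g : 'X_{1..n}) (t i : 'I_n).

Lemma half_vexp x p q y t :
  ((vexp x p q t + vexp x q y t).*2 + absv x y t =
   absv x p t + absv p q t + absv q y t)%N.
Proof. by have := vexpE x p q t; have := vexpE x q y t; lia. Qed.

(** Doubling clears the halves in [vexp] and leaves inequalities that are linear in the crossing
    numbers. *)
Lemma dead_witness r x y : dead r x y -> exists g p q, gen_mono g p q /\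
  forall t, ((g t).*2 + absv x p t + absv p q t + absv q y t <= (r t).*2 + absv x y t)%N.
Proof.
move=> [g [p [q [hg hr]]]]; exists g, p, q; split=> // t.
by have := half_vexp x p q y t; have := hr t; lia.
Qed.

Lemma card_tail0 x t : val t = 0%N -> (#|tail x t| + (ord0 \in val x) = k)%N.
Proof.
move=> t0; have /eqP hx := valP x; apply: etrans hx; rewrite [RHS](cardsD1 ord0) addnC.
congr (_ + _)%N.
apply: eq_card => c; rewrite !inE /label t0 andbC; congr (_ && _).
by rewrite -val_eqE /= lt0n.
Qed.

Lemma absv_Vr x y t : Vr x -> Vr y -> val t = 0%N -> absv x y t = 0%N.
Proof.
move=> /negPf Vx /negPf Vy t0; have := card_tail0 x t0; have := card_tail0 y t0.
by rewrite Vx Vy /absv /v; lia.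
Qed.

Lemma gen_two_holes g p q : gen_mono g p q ->
  exists a b : 'I_n.+1, [/\ a != b, a \notin val p & b \notin val p].
Proof.
case=> [i j ij _ h1 h2 _ _|i j ij _ h1 h2 _ _|i h1 h2 _ _].
- exists (hi i), (hi j); split=> //; rewrite -val_eqE !hiE.
  by move: ij; rewrite /label => -[->]; rewrite eqSS neq_ltn ltnSn.
- by exists (lo i), (hi i); rewrite lo_neq_hi.
by exists (lo i), (hi i); rewrite lo_neq_hi.
Qed.

(** A state with [k = n] leaves a single site empty, while every generator needs two empty sites. *)
Lemma live_full r x y : k = n -> ~ dead r x y.
Proof.
move=> kn [g [p [q [/gen_two_holes[a [b [ab ap bp]]] _]]]].
have : (#|[set a; b]| <= #|~: val p|)%N.
  by apply/subset_leq_card/subsetP => c; rewrite !inE => /orP[] /eqP ->.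
rewrite cards2 ab cardsCs setCK card_ord; have /eqP -> := valP p; lia.
Qed.

(** Divisibility by a generator requires [U_1] at most once: either the detour through [p] and [q]
    uses the site 0, or the generator is [U_1] at a state avoiding that site, never both. *)
Lemma dead_squarefree r x y t : Vr x -> Vr y -> val t = 0%N -> (0 < r t)%N ->
  dead (U_(t) + r)%MM x y -> dead r x y.
Proof.
move=> Vx Vy t0 rt [g [p [q [hg hr]]]]; exists g, p, q; split=> // s.
case: (eqVneq s t) => [->|st]; last first.
  by have := hr s; rewrite mnmDE mnm1E eq_sym (negPf st).
apply: leq_trans rt; have := half_vexp x p q y t; rewrite (absv_Vr Vx Vy t0) addn0.
have := card_tail0 x t0; have := card_tail0 y t0; have := card_tail0 p t0.
have := card_tail0 q t0; rewrite /absv /v (negPf Vx) (negPf Vy).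
have : (g t <= (ord0 \notin val p))%N /\ (g t = 0%N \/ q = p).
  case: hg => [i j _ _ _ _ _ ->|i j _ _ _ _ _ ->|i h1 h2 -> ->]; rewrite ?mnm0E; try by split; [|left].
  split; last by right.
  rewrite mnm1E; case: eqP => // it; rewrite -it in t0.
  by rewrite (_ : ord0 = lo i) ?h1 //; apply: val_inj; rewrite /= t0.
by case: (ord0 \in val p); case: (ord0 \in val q) => -[h1 [h2|h2]]; rewrite ?h2; lia.
Qed.

Section OneHole.
Hypothesis kn : k.+1 = n.

Lemma card_tail_two_holes p (a b : 'I_n.+1) t :
  a != b -> a \notin val p -> b \notin val p ->
  (#|tail p t| + (t < a) + (t < b) = n - t)%N.
Proof.
move=> ab ap bp.
have pE : val p = ~: [set a; b].
  apply/eqP; rewrite eqEcard; apply/andP; split.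
    apply/subsetP => c cp; rewrite !inE negb_or.
    by apply/andP; split; apply: contraTneq cp => ->.
  rewrite [X in (X <= _)%N]cardsCs setCK cards2 ab card_ord.
  by have /eqP -> := valP p; lia.
have -> : (n - t)%N = #|[set c : 'I_n.+1 | (label t <= c)%N]|.
  rewrite cardsE -sum1_card -(big_geq_mkord _ _ predT (fun=> 1%N)).
  by rewrite sum_nat_const_nat muln1 /label subSS.
rewrite (cardsD1 a) (cardsD1 b) !inE /label (eq_sym b a) ab /=.
set C := (X in (_ + (_ + X))%N); suff -> : #|tail p t| = C by rewrite -addnA addnC -addnA.
by apply: eq_card => c; rewrite !inE pE !inE negb_or; case: (c == a); case: (c == b).
Qed.

Lemma exists_hole x : Vr x -> exists2 c : 'I_n.+1, ord0 != c & c \notin val x.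
Proof.
move=> Vx; have : (0 < #|~: val x :\ ord0|)%N.
  rewrite lt0n; apply/eqP => N0; have := cardsD1 ord0 (~: val x).
  rewrite N0 inE [_ \notin _]Vx cardsCs setCK card_ord; have /eqP -> := valP x; lia.
by case/card_gt0P => c; rewrite !inE => /andP[c0 cx]; exists c => //; rewrite eq_sym.
Qed.

Lemma card_tail_hole x c t : Vr x -> ord0 != c -> c \notin val x ->
  (#|tail x t| + (t < c) = n - t)%N.
Proof.
by move=> Vx c0 cx; have := card_tail_two_holes t c0 Vx cx; rewrite ltn0 addn0.
Qed.

(* Line [t] lies below the holes of [x] and [y]; these lines form the only
   generating interval of the pair [x], [y]. *)
Definition low x y t : bool := (#|tail x t| < n - t)%N && (#|tail y t| < n - t)%N.

(** Every state has two holes here, and over a low line [x] and [y] have one on each side. If [p] or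
    [q] does not, the detour costs a factor [U_t]; if both do, the generator must be [U_t] itself.
    Conversely a single generator attains this bound on all low lines at once and costs nothing
    elsewhere. *)
Lemma dead_one_holeP r x y : Vr x -> Vr y ->
  dead r x y <-> forall t, low x y t -> (0 < r t)%N.
Proof.
move=> Vx Vy; have [c c0 cx] := exists_hole Vx; have [c' c'0 cy] := exists_hole Vy.
have tx t := card_tail_hole t Vx c0 cx; have ty t := card_tail_hole t Vy c'0 cy.
split=> [/dead_witness[g [p [q [hg hr]]]] t /andP[lx ly]|h].
  have ex := tx t; have ey := ty t.
  suff key : #|tail p t|.+1 = (n - t)%N -> #|tail q t|.+1 = (n - t)%N -> (0 < g t)%N.
    have := hr t; move: lx ly key ex ey {hr tx ty}; rewrite /absv /v.
    move: #|tail x t| #|tail y t| #|tail p t| #|tail q t| (g t) (r t) (n - t)%N.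
    move=> lx ly lp lq gt rt N hx hy key.
    by case: (eqVneq lp.+1 N) key => [ep|ep]; case: (eqVneq lq.+1 N) => [eq|eq]; lia.
  have move_far (i j : 'I_n) (p' q' : V) : label j = (label i).+1 ->
      lo i \in val p' -> hi i \notin val p' -> hi j \notin val p' ->
      val q' = hi j |: (val p' :\ lo i) ->
      #|tail p' t|.+1 = (n - t)%N -> #|tail q' t|.+1 = (n - t)%N -> False.
    move=> ij h1 h2 h3 h4; have ijE : (j : nat) = i.+1 by case: ij.
    have hij : hi i != hi j by rewrite -val_eqE !hiE ijE eqSS neq_ltn ltnSn.
    have lj : lo i != hi j by rewrite -val_eqE loE hiE ijE neq_ltn ltnS leqnSn.
    have lq : lo i \notin val q' by rewrite h4 !inE eqxx orbF.
    have hq : hi i \notin val q' by rewrite h4 !inE (negPf hij) (negPf h2) andbF.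
    have := card_tail_two_holes t hij h2 h3.
    have := card_tail_two_holes t (lo_neq_hi i) lq hq.
    rewrite !hiE loE ijE; move: #|tail p' t| #|tail q' t| (n - t)%N => lp lq' N.
    by clear; lia.
  have [i j ij h1 h2 h3 h4 _|i j ij h1 h2 h3 h4 _|i h1 h2 -> ->] := hg.
  - by move=> ep eq; case: (move_far i j p q).
  - have lj : lo i != hi j by apply: contraNneq h3 => ->.
    have hij : hi i != hi j by apply: contraNneq h2 => ->.
    move=> ep eq; case: (move_far i j q p) => //.
    + by rewrite h4 setU11.
    + by rewrite h4 !inE eq_sym (negPf (lo_neq_hi i)) (negPf h2) andbF.
    + by rewrite h4 !inE eqxx orbF eq_sym.
    by rewrite h4 setU1K ?setD1K // !inE negb_and h3 orbT.
  have := card_tail_two_holes t (lo_neq_hi i) h1 h2; rewrite hiE loE mnm1E.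
  have -> : (i == t) = (nat_of_ord i == nat_of_ord t) by [].
  by move: #|tail p t| (n - t)%N => lp N; clear; lia.
have n0 : (0 < n)%N by rewrite -kn.
(* That generator is [U_1] at the state whose holes are 0 and 1. *)
pose i0 := Ordinal n0; have cp : #|~: [set ord0; hi i0]| == k.
  rewrite cardsCs setCK cards2 card_ord; have -> : ord0 != hi i0 by rewrite -val_eqE hiE.
  by rewrite -kn subn2.
pose p : V := Sub (~: [set ord0; hi i0]) cp.
have p1 : lo i0 \notin val p.
  by rewrite SubK !inE negbK (_ : lo i0 == ord0) // -val_eqE.
have p2 : hi i0 \notin val p by rewrite SubK !inE negbK eqxx orbT.
clearbody p; exists U_(i0)%MM, p, p; split=> [|t]; first exact: (gen_U p1 p2).
have := card_tail_two_holes t (lo_neq_hi i0) p1 p2; rewrite hiE loE /=.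
have := half_vexp x p p y t; have := tx t; have := ty t.
have : (0 < c)%N by rewrite lt0n eq_sym.
have : (0 < c')%N by rewrite lt0n eq_sym.
rewrite /absv /v mnm1E; have -> : (i0 == t) = (0%N == t) by [].
have := h t; rewrite /low; move: (nat_of_ord t) (ltn_ord t) => m ltm.
move: #|tail x t| #|tail y t| #|tail p t| (vexp x p p t) (vexp x p y t) (r t) => lx ly lp v1 v2 rt.
case: andP => [[l1 l2] /(_ isT)|/andP l] => *; first by lia.
by move: l; rewrite negb_and -!leqNgt => /orP[] *; lia.
Qed.

End OneHole.
End DeadMonomials.

Section FormalCases.
#[local] Opaque B0_mono BS_mono.
Variables (n k : nat) (S : {set 'I_n}).
Local Notation V := (V n k).
Local Notation Vr := (@Vr_pred n k).
Local Notation J := {i : 'I_n | i \in S}.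
Local Notation bmono := (@BS_mono n k S).
Implicit Types (T : {set J}) (r rho : 'X_{1..n}) (x y : V) (t : 'I_n) (i j : J).

(** Selecting no line gives the zero homotopy, for the cases in which the differential vanishes on
    live monomials. *)
Definition no_sel : 'X_{1..n} -> V -> V -> option J := fun _ _ _ => None.

Lemma no_sel_gt0 rho x y j : no_sel rho x y = Some j -> (0 < rho (val j))%N.
Proof. by []. Qed.

Lemma total_deg_gt0 T r j : j \in T -> (0 < total_deg T r (val j))%N.
Proof. by move=> jT; rewrite total_degE cdeg_val jT addn1. Qed.

Lemma BS_diff_mono_set0 r x y : BS_diff k S (bmono set0 r x y) = 0.
Proof. by rewrite BS_diff_mono big_set0. Qed.

Lemma formal_S0 : S = set0 -> formal (Br_dga k S).
Proof.
move=> S0; apply: (formal_Br no_sel_gt0 (psi := fun=> 0)) => [w w'|T r x y Vx Vy hl].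
  by rewrite addr0.
have -> : T = set0.
  apply/setP => j; have : val j \in (set0 : {set 'I_n}) by rewrite -S0 (valP j).
  by rewrite inE.
right; split; first exact: BS_diff_mono_set0.
by rewrite /maslov cards0 big1 ?mulr0 ?subr0 // => t; rewrite S0 inE.
Qed.

Definition sum_S (w : alex_group n) : rat := \sum_(t in S) w t.

Lemma sum_SD w w' : sum_S (w + w') = sum_S w + sum_S w'.
Proof. by rewrite -big_split; apply: eq_bigr => t _; rewrite ffunE. Qed.

Lemma sum_cdeg T : (\sum_(t in S) cdeg T t = #|T|)%N.
Proof.
rewrite -sum1_card; under eq_bigr => t _ do rewrite /cdeg -sum1dep_card.
rewrite (exchange_big_dep (mem T)) /=; last by move=> t j _ /andP[].
apply: eq_bigr => j jT; rewrite (big_pred1 (val j)) // => t.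
rewrite jT /= [RHS]eq_sym; case: eqP => [<-|_]; rewrite ?andbF ?andbT ?(valP j) //.
Qed.

(** With no points every [U_t] is zero, so a live monomial is a product of [C_i], each adding 1 to
    the sum of [w] over [S] and [- 1] to the Maslov degree. *)
Lemma formal_k0 : k = 0%N -> formal (Br_dga k S).
Proof.
move=> k0; apply: (formal_Br no_sel_gt0 (psi := fun w => - sum_S w)) => [w w'|T r x y Vx Vy hl].
  by rewrite sum_SD opprD.
have e0 (z : V) : val z = set0.
  by apply/eqP; rewrite -cards_eq0; have /eqP -> := valP z; apply/eqP.
have xy : x = y by apply: val_inj; rewrite !e0.
subst y.
have hd (s : 'X_{1..n}) t : (0 < s t)%N -> dead s x x.
  move=> st; exists U_(t)%MM, x, x; split.
    by apply: (@gen_U _ _ _ _ _ t); rewrite ?e0 ?inE.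
  by move=> u; rewrite vexpxx mnm0E !addn0 mnm1E; case: eqP => [<-|].
right; split.
  rewrite BS_diff_mono big1 // => j jT; apply: BS_mono_eq0; apply: (hd _ (val j)).
  by rewrite mnmDE mnm1E eqxx.
rewrite /maslov -/(sum_S _) -sum_cdeg natr_sum; set s := (X in X - _ = _).
suff -> : sum_S (alex T r x x) = s by lra.
apply: eq_bigr => t _; rewrite alexE total_degE /absv v_id absz0 mul0r addr0.
by case: (posnP (r t)) => [->//|/hd].
Qed.

(** No monomial vanishes, so every monomial of positive degree along [S] is contracted, and those
    left contain no [C]. *)
Lemma formal_kn : k = n -> formal (Br_dga k S).
Proof.
move=> kn; pose sel rho (x y : V) : option J := [pick j : J | (0 < rho (val j))%N].
have sel_gt0 rho x y j : sel rho x y = Some j -> (0 < rho (val j))%N.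
  by rewrite /sel; case: pickP => // i hi [<-].
apply: (formal_Br sel_gt0 (psi := fun w => - 2%:R * sum_S w)) => [w w'|T r x y Vx Vy hl].
  by rewrite sum_SD mulrDr.
have hlive s : ~ dead s x y by apply: live_full.
case E: (sel (total_deg T r) x y) => [j|]; [left|right].
  case: (boolP (j \in T)) => jT; first exact: contracted_in E _ _.
  by apply: (contracted_out sel_gt0 _ E) => // i _ /hlive.
have -> : T = set0.
  apply/setP => j; rewrite inE; apply/negP => jT; move: E; rewrite /sel.
  by case: pickP => // /(_ j); rewrite total_deg_gt0.
split; first exact: BS_diff_mono_set0.
by rewrite /maslov cards0 sub0r mulNr.
Qed.

Lemma formal_S1 (i0 : 'I_n) : label i0 = 1%N -> S = [set i0] -> formal (Br_dga k S).
Proof.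
move=> [i00] S1; have i0S : i0 \in S by rewrite S1 inE.
pose j0 : J := Sub i0 i0S; have jE j : j = j0.
  apply: val_inj; have : val j \in [set i0] by rewrite -S1 (valP j).
  by rewrite inE => /eqP.
pose sel rho (x y : V) : option J :=
  if (0 < rho i0)%N && `[< ~ dead rho x y >] then Some j0 else None.
have sel_gt0 rho x y j : sel rho x y = Some j -> (0 < rho (val j))%N.
  by rewrite /sel; case: ifP => // /andP[h _] [<-].
apply: (formal_Br sel_gt0 (psi := fun w => - w i0)) => [w w'|T r x y Vx Vy hl].
  by rewrite ffunE opprD.
have maslovE : maslov T r x y = #|T|%:R - 2%:R * (total_deg T r i0)%:R.
  rewrite /maslov (big_pred1 i0) => [|t]; last by rewrite S1 inE.
  by rewrite alexE absv_Vr // mul0r addr0.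
have alexE0 : alex T r x y i0 = (total_deg T r i0)%:R.
  by rewrite alexE absv_Vr // mul0r addr0.
have TE : T = if j0 \in T then [set j0] else set0.
  by apply/setP => j; rewrite (jE j); case: ifP => [jT|jT]; rewrite !inE // eqxx.
case E: (sel (total_deg T r) x y) => [j|].
  left; rewrite (jE j) in E; case: (boolP (j0 \in T)) => jT.
    apply: (contracted_in hl E jT).
    move: E; rewrite /sel; case: ifP => // /andP[_ /asboolP hr] _.
    suff -> : (U_(val j0) + r)%MM = total_deg T r by [].
    rewrite -(total_degD1 r jT) TE jT setDv; apply/mnmP => t.
    by rewrite total_degE cdeg_set0 addn0.
  by apply: (contracted_out sel_gt0 hl E jT) => i iT; rewrite -(jE i) iT in jT.
right; case: (boolP (j0 \in T)) => jT; last first.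
  have T0 : T = set0 by rewrite TE (negPf jT).
  split; first by rewrite T0 BS_diff_mono_set0.
  rewrite alexE0 maslovE {1}T0 cards0 sub0r.
  suff -> : total_deg T r i0 = 0%N by rewrite mulr0 oppr0.
  have rE : total_deg T r = r by apply/mnmP => t; rewrite total_degE T0 cdeg_set0 addn0.
  move: E; rewrite /sel rE; case: posnP => //= _.
  by case: asboolP => // /contrapT.
have i0T : (0 < total_deg T r i0)%N := total_deg_gt0 r jT.
have hd : dead (U_(i0) + r)%MM x y.
  have -> : (U_(i0) + r)%MM = total_deg T r.
    rewrite -(total_degD1 r jT) TE jT setDv; apply/mnmP => t.
    by rewrite total_degE cdeg_set0 addn0.
  by move: E; rewrite /sel i0T /=; case: asboolP => // /contrapT.
split.
  rewrite BS_diff_mono big1 // => j _; rewrite (jE j); exact: BS_mono_eq0.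
have r0 : r i0 = 0%N.
  apply/eqP; rewrite -leqn0 leqNgt; apply/negP => r0.
  exact/hl/(dead_squarefree Vx Vy i00 r0).
rewrite alexE0 maslovE total_degE r0 -[i0]/(val j0) cdeg_val jT {1}TE jT cards1.
by rewrite add0n mulr1n; lra.
Qed.

End FormalCases.

(** * States with one hole besides 0 *)

Section OneHoleFormal.
#[local] Opaque B0_mono BS_mono.
Variables (n k : nat) (S : {set 'I_n}).
Hypothesis kn : k.+1 = n.
Local Notation V := (V n k).
Local Notation Vr := (@Vr_pred n k).
Local Notation J := {i : 'I_n | i \in S}.
Local Notation bmono := (@BS_mono n k S).
Implicit Types (T : {set J}) (r rho : 'X_{1..n}) (x y : V) (t : 'I_n) (i j : J).

(* Multiplication by [U_j] does not change which monomials of total degree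
   [rho] vanish. *)
Definition cone_point rho x y j : bool :=
  (0 < rho (val j))%N &&
  [|| (1 < rho (val j))%N, ~~ low x y (val j) | [exists t, low x y t && (rho t == 0%N)]].

Lemma low0 x y t : Vr x -> Vr y -> val t = 0%N -> low x y t.
Proof.
move=> Vx Vy t0; have tn := ltn_ord t; have := card_tail0 x t0; have := card_tail0 y t0.
rewrite (negPf Vx : (ord0 \in val x) = false) (negPf Vy : (ord0 \in val y) = false).
by rewrite /low !addn0 => -> ->; move: t0 tn => /= ->; rewrite subn0 -kn ltnSn.
Qed.

Lemma formal_one_hole (i0 : 'I_n) : label i0 = 1%N -> i0 \in S -> formal (Br_dga k S).
Proof.
move=> [i00] i0S; pose j0 : J := Sub i0 i0S.
pose sel rho (x y : V) : option J :=
  if [pick j | cone_point rho x y j] is Some j then Some j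
  else if (0 < rho i0)%N then Some j0 else None.
have sel_gt0 rho x y j : sel rho x y = Some j -> (0 < rho (val j))%N.
  rewrite /sel; case: pickP => [i /andP[hi _] [<-] //|_].
  by case: ifP => // h [<-].
apply: (formal_Br sel_gt0 (psi := fun w => w i0 - 2%:R * sum_S S w)) => [w w'|T r x y Vx Vy hl].
  by rewrite sum_SD ffunE; ring.
have deadP s := dead_one_holeP kn s Vx Vy.
have [t0 lt0 rt0] : exists2 t, low x y t & r t = 0%N.
  apply: contrapT => h; apply: hl; apply/deadP => t lt; rewrite lt0n; apply/eqP => rt.
  by apply: h; exists t.
have maslovE : maslov T r x y = #|T|%:R - 2%:R * sum_S S (alex T r x y) by [].
have alexE0 : alex T r x y i0 = (total_deg T r i0)%:R.
  by rewrite alexE absv_Vr // mul0r addr0.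
have liveU (j : J) t : low x y t -> (U_(val j) + r)%MM t = 0%N -> ~ dead (U_(val j) + r)%MM x y.
  by move=> lt e /deadP/(_ t lt); rewrite e.
have UE (j : J) t : (U_(val j) + r)%MM t = ((val j == t) + r t)%N by rewrite mnmDE mnm1E.
have degE := total_degE T r.
case E: (sel (total_deg T r) x y) => [j|]; last first.
  right; have r0 : total_deg T r i0 = 0%N.
    by move: E; rewrite /sel; case: pickP => // _; case: posnP.
  have T0 : T = set0.
    apply/setP => j; rewrite inE; apply/negP => jT; move: E; rewrite /sel.
    case: pickP => // /(_ j) /negP[]; rewrite /cone_point total_deg_gt0 //=.
    apply/or3P; apply: Or33; apply/existsP; exists i0.
    by rewrite r0 eqxx andbT; apply: low0.
  split; first by rewrite T0 BS_diff_mono_set0.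
  by rewrite maslovE alexE0 r0 T0 cards0.
move: (E); rewrite {1}/sel; case: pickP => [j' hc [ej]|hnc].
  subst j'; left; case: (boolP (j \in T)) => jT.
    apply: (contracted_in hl E jT).
    have hj : total_deg T r (val j) = (r (val j)).+1 by rewrite degE cdeg_val jT addn1.
    case/andP: hc => _ /or3P[h1|h2|/existsP[t /andP[lt /eqP rt]]].
    - apply: (liveU j t0 lt0); rewrite UE rt0; case: eqP => // e.
      by move: h1; rewrite hj e rt0.
    - apply: (liveU j t0 lt0); rewrite UE rt0; case: eqP => // e.
      by rewrite e lt0 in h2.
    apply: (liveU j t lt); rewrite UE; have : r t = 0%N by move: rt; rewrite degE; lia.
    by move=> ->; case: eqP => // e; rewrite -e hj in rt.
  apply: (contracted_out sel_gt0 hl E jT) => i iT /deadP hi; apply/deadP => t lt.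
  have := hi t lt; rewrite !mnmBE !mnm1E UE; case: (val j =P t) => [e|_]; last by rewrite subn0.
  have hj : total_deg T r (val j) = r (val j) by apply: total_deg_notin.
  case/andP: hc => _ /or3P[h1|h2|/existsP[t' /andP[lt' /eqP rt']]].
  - by move: h1; rewrite hj e; lia.
  - by rewrite e lt in h2.
  have := hi t' lt'; rewrite UE; move: rt'; rewrite degE.
  case: eqP => [<-|_]; first by rewrite cdeg_val iT addn1.
  by lia.
case: ifP => // r0 [ej]; subst j.
have nc t : low x y t -> (0 < total_deg T r t)%N.
  move=> lt; rewrite lt0n; apply/negP => e.
  have := hnc j0; rewrite /cone_point r0 /=.
  have -> : [exists t, low x y t && (total_deg T r t == 0%N)] by apply/existsP; exists t; rewrite lt.
  by rewrite !orbT.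
have ncT j : j \in T -> low x y (val j) /\ r (val j) = 0%N.
  move=> jT; have := hnc j; rewrite /cone_point total_deg_gt0 //= => /negbT.
  rewrite !negb_or negbK degE cdeg_val jT addn1 ltnS -leqNgt leqn0.
  by case/and3P => /eqP.
have deadU a : T = [set a] -> dead (U_(val a) + r)%MM x y.
  move=> Ta; apply/deadP => t lt; have := nc t lt.
  rewrite -(@total_degD1 _ _ _ r a); last by rewrite Ta inE.
  by rewrite Ta setDv total_degE cdeg_set0 addn0.
case: (set_0Vmem T) => [T0|[a aT]].
  exfalso; apply: hl; apply/deadP => t lt; have := nc t lt.
  by rewrite degE T0 cdeg_set0 addn0.
case: (set_0Vmem (T :\ a)) => [Ta|[b]].
  have {}Ta : T = [set a] by rewrite -(setD1K aT) Ta setU0.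
  right; split; first by rewrite BS_diff_mono Ta big_set1; apply/BS_mono_eq0/deadU.
  rewrite maslovE alexE0 {1}Ta cards1; congr (_ - _).
  suff -> : total_deg T r i0 = 1%N by [].
  have := hnc j0; rewrite /cone_point r0 /= => /negbT; rewrite negb_or => /andP[].
  by move: r0; rewrite -leqNgt; lia.
rewrite !inE => /andP[ba bT]; left.
have [la ra] := ncT a aT; have [lb rb] := ncT b bT.
have liveT i : i \in T -> ~ dead (U_(val i) + r)%MM x y.
  move=> iT; case: (eqVneq i a) => [->|ia].
    apply: (liveU _ (val b) lb); rewrite UE rb.
    by rewrite (inj_eq val_inj) eq_sym (negPf ba).
  by apply: (liveU _ (val a) la); rewrite UE ra (inj_eq val_inj) (negPf ia).
case: (boolP (j0 \in T)) => jT; first exact: (contracted_in hl E jT (liveT _ jT)).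
by apply: (contracted_out sel_gt0 hl E jT) => i /liveT hi /hi.
Qed.

End OneHoleFormal.

(** * Non-formal cases *)

Section NotFormal.
#[local] Opaque B0_mono.
Variables (n k : nat) (S : {set 'I_n}).
Local Notation V := (V n k).
Local Notation Vr := (@Vr_pred n k).
Local Notation J := {i : 'I_n | i \in S}.
Local Notation BS := (BS k S).
Local Notation bmono := (@BS_mono n k S).
Local Notation A := (BS_dga k S).
Local Notation Br := (Br_dga k S).
Implicit Types (T : {set J}) (r s : 'X_{1..n}) (x y z : V) (t : 'I_n) (j : J).

Lemma BS_monoM T1 T2 r s x y y' z : bmono T1 r x y * bmono T2 s y' z =
  if [disjoint T1 & T2] && (y == y') then
    bmono (T1 :|: T2) (r + s + vexp x y z)%MM x z else 0.
Proof.
rewrite /BS_mono cmonoM; case: ifP => //= _; rewrite -rmorphM B0_monoM.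
by case: ifP => // _; rewrite !raddf0.
Qed.

Lemma BS_mono_neq0 T r x y : ~ dead r x y -> bmono T r x y <> 0.
Proof.
move=> hl /(congr1 (fun a : BS => a T)); rewrite BS_monoE eqxx ffunE.
by move/B_pi_mono_eq0.
Qed.

Fact corner_mono_subproof T r x y : Vr x && Vr y ->
  @corner_pred _ _ A Vr (bmono T r x y).
Proof. by move=> h; rewrite /corner_pred corner_unit_mono h. Qed.

Definition corner_mono T r x y (h : Vr x && Vr y) : Br :=
  Corner (corner_mono_subproof T r h).

(** Multiplying by the two idempotents discards, from a combination of monomials of the given
    bidegree, all those with other ends. *)
Lemma piece_ind (m : int) w x y (P : BS -> Prop) (e : BS) :
    BS_homog m w e -> BS_idem S x * e = e -> e * BS_idem S y = e ->
    P 0 -> (forall a b, P a -> P b -> P (a - b)) ->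
    (forall T r, maslov T r x y = m%:~R -> alex T r x y = w -> P (bmono T r x y)) ->
  P e.
Proof.
move=> he xe ey P0 PB Pm; rewrite -ey -xe.
elim: {xe ey} he => [T r x' y' hm hw||a b _ ha _ hb].
- rewrite BS_idem_mono; case: eqP => [xx|_]; last by rewrite mul0r.
  rewrite BS_mono_idem; case: eqP => [yy|_] //; subst x' y'; exact: Pm.
- by rewrite mulr0 mul0r.
by rewrite mulrBr mulrBl; apply: PB.
Qed.

Variables (x y z : V) (j : J) (s : 'X_{1..n}).
Hypotheses (Vx : Vr x) (Vy : Vr y) (Vz : Vr z).
Hypothesis yz : forall t, absv y z t = (val j == t).
Hypothesis s0 : forall i : J, s (val i) = 0%N.
Hypothesis yx : forall i : J, (absv y x (val i) <= 1)%N.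
Hypothesis yxj : absv y x (val j) = 0%N.
Hypothesis zyx_dead : dead (s + vexp z y x)%MM z x.
Hypothesis yx_live : ~ dead s y x.
Hypothesis yy_live : ~ dead U_(val j)%MM y y.

Lemma absvC x' y' t : absv (k := k) x' y' t = absv y' x' t.
Proof. by rewrite /absv -abszN /v opprB. Qed.

Lemma zy t : absv z y t = (val j == t).
Proof. by rewrite absvC yz. Qed.

Lemma vexp_yzy : vexp y z y = U_(val j)%MM.
Proof.
apply/mnmP => t; have := vexpE y z y t; rewrite zy yz /absv v_id mnm1E.
by case: (_ == _); lia.
Qed.

Theorem not_formal_of_path : ~ formal Br.
Proof.
move=> hF.
pose yz2 : Vr y && Vr z := introT andP (conj Vy Vz).
pose zy2 : Vr z && Vr y := introT andP (conj Vz Vy).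
pose yy2 : Vr y && Vr y := introT andP (conj Vy Vy).
pose yx2 : Vr y && Vr x := introT andP (conj Vy Vx).
have [ma hma] := maslov_int (S := S) set0 0%MM y z.
have [mb hmb] := maslov_int (S := S) set0 0%MM z y.
have [mc hmc] := maslov_int (S := S) set0 s y x.
pose wa := alex (S := S) set0 0%MM y z; pose wb := alex (S := S) set0 0%MM z y.
pose wc := alex (S := S) set0 s y x.
have wabE t : (wa + wb) t = (val j == t)%:R.
  rewrite ffunE !alexE !total_degE !cdeg_set0 !mnm0E yz zy.
  by case: (_ == _); rewrite /=; lra.
(* The Maslov degree is the number of [C] minus a linear form in the intrinsic degree, so one degree
   above a product of two monomials without [C] there is exactly one [C]. *)
have one_C T r x' y' T' r' T2 r2 x2 y2 z2 (m1 m2 : int) :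
    maslov T' r' x2 y2 = m1%:~R -> maslov T2 r2 y2 z2 = m2%:~R -> #|T'| = 0%N -> #|T2| = 0%N ->
    maslov T r x' y' = (m1 + m2 + 1)%:~R ->
    alex T r x' y' = alex T' r' x2 y2 + alex T2 r2 y2 z2 -> exists i : J, T = [set i].
  move=> h1 h2 c1 c2 h3 h4; apply/cards1P; apply/eqP.
  have : #|T|%:R = 1%:R :> rat; last by move/eqP; rewrite eqr_nat => /eqP.
  move: h1 h2 h3; rewrite !intrD /maslov -!/(sum_S S _) h4 sum_SD c1 c2 => <- <-; lra.
pose X := {x : V | Vr x}.
pose xX : X := Sub x Vx; pose yX : X := Sub y Vy; pose zX : X := Sub z Vz.
(* The only candidate is [C_j I_y], whose differential [U_j I_y] is nonzero. *)
have acy1 : @acyclic_piece _ _ Br (ma + mb + 1) (wa + wb) yX yX.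
  move=> e he ye ey de; exists 0; rewrite raddf0; apply: val_inj.
  have : val e = 0 \/ val e = bmono [set j] 0%MM y y.
    apply: (piece_ind (P := fun b => b = 0 \/ b = bmono [set j] 0%MM y y) he
      (congr1 val ye) (congr1 val ey)).
    - by left.
    - move=> a b ha hb; rewrite -[- b]add0r -[b in 0 - b]/b.
      have -> : 0 - b = b by rewrite sub0r; apply/eqP; rewrite eq_sym -addr_eq0 BS_addrr.
      by case: ha hb => -> [] ->; rewrite ?addr0 ?add0r ?BS_addrr; auto.
    move=> T r hm hw; right; have [i Ti] := one_C _ _ _ _ _ _ _ _ _ _ _ _ _ hma hmb (cards0 _) (cards0 _) hm hw.
    have degE t : (r t + (val i == t))%N = (val j == t).
      apply/eqP; rewrite -(eqr_nat rat); apply/eqP.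
      rewrite -wabE -hw alexE total_degE /absv v_id absz0 mul0r addr0 Ti.
      by rewrite (@cdegD1 _ _ _ i t) ?inE // setDv cdeg_set0.
    have ij : i = j.
      by apply: val_inj; apply/eqP; have := degE (val i); rewrite eqxx eq_sym; case: eqP => // _; lia.
    rewrite Ti ij; congr BS_mono; apply/mnmP => t; rewrite mnm0E.
    by have := degE t; rewrite ij; lia.
  case=> // eu; exfalso; apply: (BS_mono_neq0 (T := set0) yy_live).
  have := congr1 val de; rewrite /= eu [LHS]BS_diff_mono big_set1 setDv addm0 => ->.
  by [].
(* A factor [C_i] requires [w_i] to be at least 1, but here every component along [S] is at most
   1/2: the two paths never cross the same line of [S]. *)
have acy2 : @acyclic_piece _ _ Br (mb + mc + 1) (wb + wc) zX xX.
  move=> e he ze ex de; exists 0; rewrite raddf0; apply: val_inj.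
  apply: (piece_ind (P := fun b => b = 0) he (congr1 val ze) (congr1 val ex)) => //.
    by move=> a b -> ->; rewrite subr0.
  move=> T r hm hw; exfalso.
  have [i Ti] := one_C _ _ _ _ _ _ _ _ _ _ _ _ _ hmb hmc (cards0 _) (cards0 _) hm hw.
  have : alex T r z x (val i) = wb (val i) + wc (val i) by rewrite hw ffunE.
  rewrite !alexE !total_degE !cdeg_set0 mnm0E s0 zy Ti cdeg_val inE eqxx.
  have := yx i; case: (eqVneq (val j) (val i)) => [<-|_]; rewrite ?yxj.
    move=> _ /=; rewrite natrD; have : 0 <= (r (val j))%:R :> rat by apply: ler0n.
    have : 0 <= (absv z x (val j))%:R :> rat by apply: ler0n.
    by lra.
  rewrite -(ler_nat rat) natrD; have : 0 <= (r (val i))%:R :> rat by apply: ler0n.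
  have : 0 <= (absv z x (val i))%:R :> rat by apply: ler0n.
  by rewrite /=; lra.
have [|||||||||||||||e' he'] := @formal_massey _ _ Br (corner_mono set0 0%MM yz2)
   (corner_mono set0 0%MM zy2) (corner_mono set0 s yx2) (corner_mono [set j] 0%MM yy2)
   ma mb mc wa wb wc yX yX zX xX hF _ _ _ _ _ _ _ _ _ _ _ _ _ _ _ acy1 acy2.
- exact: BS_homog_mono hma _.
- exact: BS_homog_mono hmb _.
- exact: BS_homog_mono hmc _.
- have hu : alex [set j] 0%MM y y = wa + wb.
    apply/ffunP => t; rewrite wabE alexE total_degE mnm0E /absv v_id absz0 mul0r addr0.
    by rewrite (@cdegD1 _ _ _ j t) ?inE // setDv cdeg_set0.
  apply: BS_homog_mono => //; rewrite !intrD -hma -hmb /maslov hu -!/(sum_S S _) sum_SD.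
  by rewrite !cards0 cards1; ring.
- by apply: val_inj; exact: BS_diff_mono_set0.
- by apply: val_inj; exact: BS_diff_mono_set0.
- by apply: val_inj; exact: BS_diff_mono_set0.
- apply: val_inj; rewrite [LHS]BS_diff_mono big_set1 setDv addm0.
  have d0 : [disjoint (set0 : {set J}) & (set0 : {set J})] by rewrite -setI_eq0 setI0.
  by rewrite [RHS]BS_monoM d0 eqxx vexp_yzy set0U !add0m.
- apply: val_inj; rewrite [LHS]BS_monoM; case: ifP => // _; rewrite add0m set0U.
  exact: BS_mono_eq0.
- by apply: val_inj; rewrite [LHS]BS_idem_mono eqxx.
- by apply: val_inj; rewrite [LHS]BS_mono_idem eqxx.
- by apply: val_inj; rewrite [LHS]BS_idem_mono eqxx.
- by apply: val_inj; rewrite [LHS]BS_mono_idem eqxx.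
- by apply: val_inj; rewrite [LHS]BS_idem_mono eqxx.
- by apply: val_inj; rewrite [LHS]BS_mono_idem eqxx.
have F2 (c : 'F_2) : c + c = 0 by case: c => -[|[|]] // ?; apply: val_inj.
(* A functional vanishing on boundaries: the differential only produces exponents that are positive
   somewhere on [S], while [s] is zero there. Its value on [C_j U^s f_yx] is 1. *)
pose coef (T : {set J}) (r : 'X_{1..n}) (x' y' : V) : 'F_2 :=
  if (T == [set j]) && (r == s) then 1 else 0.
have coef_d (b : BS) : BS_ext coef (BS_diff k S b) = 0.
  elim/BS_mono_ind: b => [|b c hb hc|T r x' y'].
  - by rewrite raddf0 BS_ext0.
  - by rewrite (raddfD (BS_diff k S)) BS_extD // hb hc addr0.
  rewrite BS_diff_mono; apply: (big_ind (fun b => BS_ext coef b = 0)).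
  - by rewrite BS_ext0.
  - by move=> b c hb hc; rewrite BS_extD // hb hc addr0.
  move=> i _; have [hd|hl] := EM (dead (U_(val i) + r)%MM x' y').
    by rewrite BS_mono_eq0 // BS_ext0.
  rewrite BS_ext_mono // /coef; case: (_ =P s) => [es|]; last by rewrite andbF.
  by have := s0 i; rewrite -es mnmDE mnm1E eqxx.
have := congr1 val he'; rewrite [LHS]/= BS_monoM setU0 eqxx andbT add0m vexpxx addm0.
have -> : [disjoint [set j] & (set0 : {set J})] by rewrite -setI_eq0 setI0.
move/(congr1 (BS_ext coef)); rewrite BS_ext_mono // coef_d /coef !eqxx.
by move/eqP; rewrite oner_eq0.
Qed.
End NotFormal.

(** * States carrying a nonzero Massey product *)

Section NotFormalCases.
Variables (n k : nat) (S : {set 'I_n}).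
Local Notation V := (V n k).
Local Notation Vr := (@Vr_pred n k).
Implicit Types (x y z p q : V) (t i : 'I_n) (a b c : 'I_n.+1).

Lemma card_tail_inj x y : (forall t, #|tail x t| = #|tail y t|) -> x = y.
Proof.
move=> h; pose u (w : V) (m : nat) := #|[set c in val w | (m <= c)%N]|.
have uS w c : u w c = ((c \in val w) + u w c.+1)%N.
  rewrite /u (cardsD1 c) !inE leqnn andbT; congr (_ + _)%N; apply: eq_card => b.
  by rewrite !inE andbCA -val_eqE /= eq_sym -ltn_neqAle.
have ueq m : (m <= n.+1)%N -> u x m = u y m.
  case: m => [_|m]; last rewrite ltnS leq_eqVlt => /orP[/eqP ->|mn].
  - have u0 w : u w 0 = k.
      by have /eqP <- := valP w; apply: eq_card => c; rewrite !inE andbT.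
    by rewrite !u0.
  - have un w : u w n.+1 = 0%N.
      by apply: eq_card0 => c; rewrite !inE leqNgt ltn_ord andbF.
    by rewrite !un.
  exact: h (Ordinal mn).
apply/val_inj/setP => c; have := uS x c; rewrite !ueq ?ltn_ord 1?ltnW // (uS y c).
by move/eqP; rewrite eqn_add2r; case: (c \in val x); case: (c \in val y).
Qed.

(** Generators that change the state cross two lines, which is why paths crossing a single line stay
    alive. *)
Lemma gen_long g p q : gen_mono g p q ->
  (exists2 i, g = U_(i)%MM & [/\ q = p, lo i \notin val p & hi i \notin val p]) \/
  exists i j, [/\ i != j, absv p q i = 1%N & absv p q j = 1%N].
Proof.
have neq (i j : 'I_n) : label j = (label i).+1 -> i != j.
  by move=> [ij]; rewrite -val_eqE /= ij neq_ltn ltnSn.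
case=> [i j ij h1 h2 h3 h4 _|i j ij h1 h2 h3 h4 _|i h1 h2 -> ->]; last 1 first.
- by left; exists i.
- right; exists i, j; rewrite !(absv_move _ h1 h3 h4) !hiE !loE neq //.
  by move: ij; rewrite /label => -[->]; split=> //; lia.
right; exists i, j; rewrite !(absv_move _ h1 h3 h4) !hiE !loE neq //.
by move: ij; rewrite /label => -[->]; split=> //; lia.
Qed.

Lemma live_loop y i : (lo i \in val y) || (hi i \in val y) -> ~ dead U_(i)%MM y y.
Proof.
move=> hy /dead_witness[g [p [q [/gen_long hg hr]]]].
have v0 t : absv y y t = 0%N by rewrite /absv v_id.
case: hg => [[l gE [qp l1 l2]]|[l [m [lm hl hm]]]]; last first.
  have := hr l; have := hr m; rewrite hl hm !v0 !mnm1E.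
  by case: (i =P l) => [->|_]; [rewrite (negPf lm) | case: (i == m)]; lia.
have li : i = l.
  by have := hr l; rewrite gE v0 !mnm1E eqxx; case: eqP => //; lia.
subst l q; have py : p = y.
  apply: card_tail_inj => t; have := hr t; rewrite gE v0 !mnm1E /absv /v.
  by case: (i == t); lia.
by rewrite -py (negPf l1) (negPf l2) in hy.
Qed.

Lemma live_step y x i : (forall t, absv y x t = (i == t)) -> ~ dead 0%MM y x.
Proof.
move=> yx /dead_witness[g [p [q [/gen_long hg hr]]]].
case: hg => [[l gE _]|[l [m [lm hl hm]]]].
  by have := hr l; rewrite gE yx mnm0E mnm1E eqxx; case: (i == l); lia.
have := hr l; have := hr m; rewrite hl hm !yx !mnm0E.
by case: (i =P l) => [->|_]; [rewrite (negPf lm) | case: (i == m)]; lia.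
Qed.

Lemma exists_state (F : {set 'I_n.+1}) b : b \notin F -> (0 < k)%N ->
  (k + #|F| <= n.+1)%N ->
  exists2 y : V, b \in val y & forall c, c \in F -> c \notin val y.
Proof.
move=> bF k0 kF; pose e := take k.-1 (enum (~: F :\ b)).
have ce : size e = k.-1.
  rewrite size_takel // -cardE -ltnS.
  have <- : #|~: F| = #|~: F :\ b|.+1 by rewrite (cardsD1 b) inE bF.
  by have := cardsC F; rewrite card_ord; lia.
have eP c : c \in e -> (c != b) && (c \notin F).
  by move=> /mem_take; rewrite mem_enum !inE.
have cy : #|b |: [set c in e]| == k.
  rewrite cardsU1 inE; have -> : b \notin e by apply/negP => /eP; rewrite eqxx.
  by rewrite cardsE (card_uniqP _) ?take_uniq ?enum_uniq // ce add1n prednK.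
exists (Sub (b |: [set c in e]) cy); rewrite SubK; first by rewrite setU11.
move=> c cF; rewrite !inE negb_or; apply/andP; split; first by apply: contraNneq bF => <-.
by apply/negP => /eP; rewrite cF andbF.
Qed.

Lemma Vr_move x y a b : Vr x -> b != ord0 -> val y = b |: (val x :\ a) -> Vr y.
Proof.
rewrite /Vr_pred => Vx b0 ->; rewrite !inE negb_or eq_sym b0 negb_and negbK.
by rewrite Vx orbT.
Qed.

(** A point of [y] sits at [b] between empty neighbours [a] and [c]; moving it there gives [z] and
    [x]. The path from [z] through [y] to [x] is then a straight move of two steps, dead by the last
    hypothesis. The sites 0, [a] and [c] can all be empty because [k.+1 < n]. *)
Lemma not_formal_turn (i i' : 'I_n) a b c : i \in S -> (0 < k)%N -> (k.+1 < n)%N ->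
    [/\ a != ord0, b != ord0, c != ord0, a != b & c != b] -> a != c ->
    (forall t : 'I_n, `|(t < a)%:Z - (t < b)%:Z|%N = (i == t)) ->
    (forall t : 'I_n, `|(t < c)%:Z - (t < b)%:Z|%N = (i' == t)) -> i' != i ->
    (b == lo i) || (b == hi i) ->
    (forall z x, a \in val z -> b \notin val z -> c \notin val z ->
       val x = c |: (val z :\ a) -> dead 0%MM z x) ->
  ~ formal (Br_dga k S).
Proof.
move=> iS k0 kn [a0 b0 c0 ab cb] ac hab hcb ii bi hd.
have [|//||y yb yF] := @exists_state [set ord0; a; c] b.
- by rewrite !inE !negb_or b0 eq_sym ab eq_sym cb.
- apply: leq_trans (_ : k + 3 <= _)%N; last by rewrite addn3.
  rewrite leq_add2l; apply: leq_trans (leq_card_setU _ _) _.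
  by rewrite cards2 cards1 addn1; case: (_ != _).
have ya : a \notin val y by apply: yF; rewrite !inE eqxx orbT.
have yc : c \notin val y by apply: yF; rewrite !inE eqxx !orbT.
have Vy : Vr y by apply: yF; rewrite !inE eqxx.
have [z zE] := exists_move yb ya; have [x xE] := exists_move yb yc.
have yzt t : absv y z t = (i == t) by rewrite (absv_move t yb ya zE) hab.
have yxt t : absv y x t = (i' == t) by rewrite (absv_move t yb yc xE) hcb.
apply: (@not_formal_of_path _ _ _ x y z (Sub i iS) 0%MM); rewrite ?SubK //.
- exact: Vr_move xE.
- exact: Vr_move zE.
- by move=> j; rewrite mnm0E.
- by move=> j; rewrite yxt; case: (_ == _).
- by rewrite yxt (negPf ii).
- apply: (@dead_le _ _ 0%MM); last by move=> t; rewrite mnm0E.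
  apply: hd; rewrite zE ?setU11 //.
  + by rewrite !inE eqxx (negPf (_ : b != a)) // eq_sym.
  + by rewrite !inE (negPf yc) andbF orbF eq_sym.
  rewrite xE; congr (_ |: _); apply/setP => u; rewrite !inE.
  by case: (u =P a) => [->|] //=; rewrite (negPf ya) andbF.
- exact: live_step yxt.
by apply: live_loop; case/orP: bi => /eqP <-; rewrite yb ?orbT.
Qed.

Lemma not_formal_many_holes (i : 'I_n) : i \in S -> (0 < i)%N -> (0 < k)%N ->
  (k.+1 < n)%N -> ~ formal (Br_dga k S).
Proof.
(* The three sites ascend from [lo i], which is not 0, unless [i] is the last line. Then they
   descend from [n] to [n - 2], which is not 0 because [0 < k] and [k.+1 < n]. *)
move=> iS i0 k0 kn; have [ltn'|gen] := ltnP i.+1 n.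
  pose i' := Ordinal ltn'; have il : label i' = (label i).+1 by [].
  have nE c d : (c != d) = (val c != val d :> nat) by [].
  apply: (@not_formal_turn i i' (lo i) (hi i) (hi i')) => //.
  - by split; rewrite nE ?hiE ?loE //=; lia.
  - by rewrite nE hiE loE /=; lia.
  - by move=> t; rewrite hiE loE -val_eqE /=; lia.
  - by move=> t; rewrite !hiE -val_eqE /=; lia.
  - by rewrite -val_eqE /=; lia.
  - by rewrite eqxx orbT.
  move=> z x h1 h2 h3 h4; apply: dead_gen; exact: (gen_RR il).
have hi' : (i.-1 < n)%N by have := ltn_ord i; lia.
pose i' := Ordinal hi'; have il : label i = (label i').+1 by rewrite /label /= prednK.
have nE c d : (c != d) = (val c != val d :> nat) by [].
have lE := lo_hi il.
apply: (@not_formal_turn i i' (hi i) (lo i) (lo i')) => //.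
- by split; rewrite nE ?hiE ?loE //=; have := ltn_ord i; lia.
- by rewrite nE hiE loE /=; lia.
- by move=> t; rewrite hiE loE -val_eqE /=; lia.
- by move=> t; rewrite !loE -val_eqE /=; lia.
- by rewrite -val_eqE /=; lia.
- by rewrite eqxx.
move=> z x h1 h2 h3 h4; apply: dead_gen; rewrite lE in h2; exact: (gen_LL il).
Qed.

(** For the least line of [S], [y] has its hole just above it and [z] just below. The product of the
    [U_t] on the lines before it avoids [S]; it covers all lines below both holes of [z] and [y],
    hence dies there, but survives at [y], where the line itself is low as well. *)
Lemma not_formal_one_hole : k.+1 = n -> S != set0 -> (forall i, i \in S -> (0 < i)%N) ->
  ~ formal (Br_dga k S).
Proof.
move=> kn /set0Pn[i1 i1S] S0.
have [i iS imin] : exists2 i, i \in S & forall j, j \in S -> (i <= j)%N.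
  by case: (arg_minnP (fun i : 'I_n => val i) i1S) => i iS h; exists i.
have i0 := S0 i iS; have nE c d : (c != d) = (val c != val d :> nat) by [].
have cy : #|~: [set ord0; hi i]| == k.
  rewrite cardsCs setCK cards2 card_ord; have -> : ord0 != hi i by rewrite nE hiE.
  by rewrite -kn subn2.
pose y : V := Sub (~: [set ord0; hi i]) cy.
have yE c : (c \in val y) = (c != ord0) && (c != hi i) by rewrite SubK !inE negb_or.
have Vy : Vr y by rewrite /Vr_pred yE.
have yl : lo i \in val y by rewrite yE lo_neq_hi nE loE /= -lt0n i0.
have yh : hi i \notin val y by rewrite yE eqxx andbF.
have [z zE] := exists_move yl yh.
have Vz : Vr z by apply: Vr_move zE.
have yzt t : absv y z t = (i == t).
  by rewrite (absv_move t yl yh zE) hiE loE -val_eqE /=; lia.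
have zl : lo i \notin val z by rewrite zE !inE eqxx orbF lo_neq_hi.
have h0 : ord0 != hi i by rewrite nE hiE.
have l0 : ord0 != lo i by rewrite nE loE /= eq_sym -lt0n.
pose s : 'X_{1..n} := [multinom (t < i : nat)%N | t < n].
have sE t : s t = (t < i)%N by rewrite mnmE.
have absvyy t : absv y y t = 0%N by rewrite /absv v_id.
apply: (@not_formal_of_path _ _ _ y y z (Sub i iS) s); rewrite ?SubK //.
- by move=> j; rewrite sE ltnNge imin ?(valP j).
- by move=> j; rewrite absvyy.
- apply: (@dead_le _ _ s); last by move=> t; rewrite mnmDE leq_addr.
  apply/(dead_one_holeP kn _ Vz Vy) => t /andP[lz _]; rewrite sE.
  by have := card_tail_hole kn t Vz l0 zl; rewrite loE; move: lz; case: (t < i)%N => //; lia.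
- move/(dead_one_holeP kn _ Vy Vy)/(_ i); rewrite sE ltnn => h; suff: (0 < 0)%N by [].
  apply: h; rewrite /low andbb; have := card_tail_hole kn i Vy h0 yh.
  by rewrite hiE ltnSn; lia.
by apply: live_loop; rewrite yl.
Qed.

End NotFormalCases.

Local Close Scope ring_scope.

Theorem theorem5p13 (n k : nat) (S : {set 'I_n}) (hk : k <= n) :
  formal (Br_dga k S) <->
  [\/ S = set0,
      exists2 i : 'I_n, label i = 1 & S = [set i],
      k = 0 |
      k = n]
  \/ (k.+1 = n /\ exists2 i : 'I_n, label i = 1 & i \in S).
Proof.
split=> [hF|[[S0|[i li S1]|k0|kn]|[kn [i li iS]]]]; last 5 first.
- exact: formal_S0.
- exact: formal_S1 li S1.
- exact: formal_k0.
- exact: formal_kn.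
- exact: formal_one_hole kn _ li iS.
apply: contrapT => h.
have S0 : S != set0 by apply/eqP => S0; apply: h; left; apply: Or41.
have k0 : (0 < k)%N by rewrite lt0n; apply/eqP => k0; apply: h; left; apply: Or43.
have kn : (k < n)%N by rewrite ltn_neqAle hk andbT; apply/eqP => kn; apply: h; left; apply: Or44.
case: (eqVneq k.+1 n) => [kn1|kn1].
  apply: (not_formal_one_hole kn1 S0 _ hF) => i iS; rewrite lt0n; apply/eqP => i0.
  by apply: h; right; split=> //; exists i; rewrite // /label i0.
have [i iS i0] : exists2 i, i \in S & (0 < i)%N.
  apply: contrapT => hS; apply: h; left; apply: Or42.
  have z i : i \in S -> nat_of_ord i = 0%N.
    by move=> iS; case: (posnP i) => // i0; case: hS; exists i.
  case/set0Pn: S0 => i iS; exists i; first by rewrite /label z.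
  apply/setP => j; rewrite inE; apply/idP/eqP => [jS|->//].
  by apply: val_inj; rewrite /= !z.
by apply: (not_formal_many_holes iS i0 k0 _ hF); rewrite ltn_neqAle kn1.
Qed.
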